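(* Let $m,n\ge1$ be integers and $d=m+n$. For an affine unimodular lattice $\Lambda+\mathbf{v}\subset\mathbb{R}^d=\mathbb{R}^m\times\mathbb{R}^n$, $b>0$ and $T>1$, let $$R_{b,T}(\Lambda+\mathbf{v}) := \#\left\{(\mathbf{x},\mathbf{y})\in\Lambda+\mathbf{v} : \|\mathbf{x}\|^m\|\mathbf{y}\|^n \le b,\ 1\le\|\mathbf{y}\|<T\right\},$$ where $\mathbf{x}\in\mathbb{R}^m$ and $\mathbf{y}\in\mathbb{R}^n$. Then for each $b>0$ and for almost every affine unimodular lattice $\Lambda+\mathbf{v}\subset\mathbb{R}^d$ (with respect to the Haar measure on the space of affine unimodular lattices), $$\lim_{T\to\infty}\frac{R_{b,T}(\Lambda+\mathbf{v})}{b B_m C_n\log T}=1.$$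
   Context: A unimodular lattice in $\mathbb{R}^d$ is a discrete subgroup of covolume $1$. An affine unimodular lattice $\Lambda+\mathbf{v}$ is a translate of a unimodular lattice $\Lambda\subset\mathbb{R}^d$ by a vector $\mathbf{v}\in\mathbb{R}^d/\Lambda$. The space of affine unimodular lattices is identified with $Y_d=(\mathrm{SL}(d,\mathbb{R})\ltimes\mathbb{R}^d)/(\mathrm{SL}(d,\mathbb{Z})\ltimes\mathbb{Z}^d)$, which is a fiber bundle over $\mathrm{SL}(d,\mathbb{R})/\mathrm{SL}(d,\mathbb{Z})$ whose fiber over $\Lambda$ is the torus $\mathbb{R}^d/\Lambda$; its Haar measure is the probability measure on $Y_d$ induced by Haar measure on $\mathrm{SL}(d,\mathbb{R})\ltimes\mathbb{R}^d$. $\|\cdot\|$ denotes the Euclidean norm. $B_k$ denotes the volume of the Euclidean unit ball in $\mathbb{R}^k$, and $C_k$ denotes the surface area of the unit sphere $\mathbb{S}^{k-1}\subset\mathbb{R}^k$ (e.g. $C_1=2$, $C_2=2\pi$). *)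

(* Defs.v *)
From HB Require Import structures.
From mathcomp Require Import all_boot all_order all_algebra.
From mathcomp Require Import archimedean finmap.
From mathcomp Require Import all_classical all_reals all_analysis.

Set Implicit Arguments.
Unset Strict Implicit.
Unset Printing Implicit Defensive.

Import Order.TTheory GRing.Theory Num.Theory.
Import numFieldNormedType.Exports.

Local Open Scope classical_set_scope.
Local Open Scope ring_scope.

(* The library norm `|x| on matrices is the sup norm, hence this definition. *)
Definition enorm (R : realType) k (x : 'cV[R]_k) : R :=
  Num.sqrt (\sum_(i < k) x i 0 ^+ 2).

(* k-dimensional Lebesgue measure of Borel sets, as an iterated product: the
   successor case is how the library defines the value of the product measure
   mu1 \x mu2 at A, namely the integral of the mu2-measures of the sections. *)
Fixpoint volume (R : realType) (k : nat) : set 'cV[R]_k -> \bar R :=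
  match k with
  | 0 => fun A => (\1_A (0 : 'cV[R]_0))%:E
  | k'.+1 => fun A =>
      (\int[@lebesgue_measure R]_x
         @volume R k' [set v : 'cV[R]_k' | A (col_mx x%:M v)])%E
  end.

Definition ball_volume (R : realType) (k : nat) : R :=
  fine (volume [set x : 'cV[R]_k | enorm x <= 1]).

(* Area of the unit sphere of R^k as its (k-1)-dimensional Minkowski content:
   the limit of the volume of the eps-neighbourhood divided by 2 eps. *)
Definition sphere_area (R : realType) (k : nat) : R :=
  lim ((fine (volume [set x : 'cV[R]_k |
                        exists2 u, enorm u = 1 & enorm (x - u) < eps])
          / (2 * eps)) @[eps --> (0 : R)^'+]).

Definition int_vector (R : realType) d : set 'cV[R]_d :=
  [set z | z \is a mxOver Num.int].

Section SpecialLinear.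
Variables (R : realType) (d : nat).

Definition SL : Type := [set g : 'M[R]_d | \det g = 1].

HB.instance Definition _ := Topological.on SL.

Definition SL1 : SL := exist _ 1%:M (mem_set (det1 R d)).

HB.instance Definition _ := isPointed.Build SL SL1.

Lemma det_mul_SL (g h : SL) : \det (val g *m val h) = 1.
Proof.
by rewrite det_mulmx (set_mem (valP g)) (set_mem (valP h)) mulr1.
Qed.

Definition SL_mul (g h : SL) : SL :=
  exist _ (val g *m val h) (mem_set (det_mul_SL g h)).

End SpecialLinear.

Section AffineGroup.
Variables (R : realType) (d : nat).

(* (g, w) stands for the affine map x |-> g x + w; the topology is the product
   topology. *)
Definition ASL : Type := (SL R d * 'cV[R]_d)%type.

Definition ASL_mul (a b : ASL) : ASL :=
  (SL_mul a.1 b.1, val a.1 *m b.2 + a.2).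

Definition ASLZ : set ASL :=
  [set a | val a.1 \is a mxOver Num.int /\ int_vector a.2].

Definition borelASL : Type := g_sigma_algebraType (@open ASL).

(* The group is second countable and locally compact, so that regularity
   follows from finiteness on compact sets. *)
Definition is_haar (nu : {measure set borelASL -> \bar R}) : Prop :=
  [/\ forall (a : ASL) (A : set borelASL), measurable A ->
        nu (ASL_mul a @` A) = nu A,
      forall K : set ASL, compact K -> (nu K < +oo)%E
    & nu [set: borelASL] <> 0%E].

Definition fundamental_domain (F : set borelASL) : Prop :=
  measurable F /\
  forall a : ASL, exists! c : ASL, ASLZ c /\ F (ASL_mul a c).

End AffineGroup.

Section AffineLattices.
Variables (R : realType) (d : nat).

(* The covolume of the lattice spanned by the columns of g is `|\det g|. *)
Definition unimodular_lattice (L : set 'cV[R]_d) : Prop :=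
  exists2 g : 'M[R]_d, `|\det g| = 1 & L = mulmx g @` @int_vector R d.

Definition affine_unimodular_lattice (L : set 'cV[R]_d) : Prop :=
  exists2 L0, unimodular_lattice L0 & exists v, L = [set x + v | x in L0].

Definition lattice_space : Type :=
  set_type (fun L : set 'cV[R]_d => affine_unimodular_lattice L).

Lemma ASL_orbit_subproof (a : ASL R d) :
  affine_unimodular_lattice
    [set x + a.2 | x in mulmx (val a.1) @` @int_vector R d].
Proof.
exists (mulmx (val a.1) @` @int_vector R d); last by exists a.2.
by exists (val a.1) => //; rewrite (set_mem (valP a.1)) normr1.
Qed.

(* (g, w) |-> g Z^d + w, whose fibres are the cosets a ASLZ: it identifies
   ASL / ASLZ with the space of affine unimodular lattices. *)
Definition lattice_of (a : ASL R d) : lattice_space :=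
  exist _ [set x + a.2 | x in mulmx (val a.1) @` @int_vector R d]
    (mem_set (ASL_orbit_subproof a)).

HB.instance Definition _ := Choice.on lattice_space.
HB.instance Definition _ := isPointed.Build lattice_space (lattice_of point).

(* Borel sets of the quotient topology. *)
Definition affine_lattices : Type :=
  g_sigma_algebraType
    [set U : set lattice_space | open (lattice_of @^-1` U)].

Definition lattice_points (L : affine_lattices) : set 'cV[R]_d := val L.

Definition is_haar_probability (mu : set affine_lattices -> \bar R) : Prop :=
  exists (nu : {measure set (borelASL R d) -> \bar R}) (F : set (borelASL R d)),
    [/\ is_haar nu, fundamental_domain F
      & forall A : set affine_lattices, measurable A ->
          mu A = nu (F `&` lattice_of @^-1` A)].

End AffineLattices.

(* The set is finite when 0 < m, a lattice being discrete. *)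
Definition count_points (R : realType) (m n : nat)
    (L : affine_lattices R (m + n)) (b T : R) : nat :=
  #|` fset_set [set p : 'cV[R]_(m + n) |
        [/\ lattice_points L p,
            enorm (usubmx p) ^+ m * enorm (dsubmx p) ^+ n <= b
          & 1 <= enorm (dsubmx p) < T]] |%fset.

(* Main.v *)
(* The proof is a second moment argument. For a uniformly random matrix [Th] and
   vector [s], the vectors [Th q + s] mod [Z^m], with [q] in [Z^n], are uniform and
   pairwise independent. Multiplying an element of the affine group on the right
   by the random shear [(x, y) |-> (x + Th y + s, y)] thus makes the numbers of
   lattice points over the different [q] in the region [|x|^m |y|^n < c],
   [r < |y| < T] pairwise independent; being bounded, they add up to a count whose
   variance is at most a constant times its mean. The mean is a sum of volumes of
   sections, asymptotic to [c B_m n B_n ln T] by comparison of thin shells in [y]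
   with their volumes. Chebyshev's inequality and the Borel-Cantelli lemma give the
   almost sure asymptotics along [T = exp (k^2)]; the counts are monotone in [T]
   and [(k + 1)^2 / k^2] tends to 1, which covers all [T]. The asymptotics do not
   depend on [r], so the closed region of the theorem lies between the open ones
   for [c = b], [r = 1] and for [c > b] close to [b], [r = 1/2].

   A set of group elements which is almost surely avoided by the random right
   translates of each group element is null for Haar measure, by Fubini. Pairwise
   independence needs an invertible upper left [m x m] block, which is arranged by
   right multiplication with an integral unipotent matrix. *)

Require Import Defs.
From HB Require Import structures.
From mathcomp Require Import all_boot all_order all_algebra.
From mathcomp Require Import archimedean finmap.
From mathcomp Require Import all_classical all_reals all_analysis.
From mathcomp Require Import perm measurable_realfun.
From mathcomp Require Import ring lra.

Set Implicit Arguments.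
Unset Strict Implicit.
Unset Printing Implicit Defensive.

Import Order.TTheory GRing.Theory Num.Theory.
Import numFieldNormedType.Exports.

Local Open Scope classical_set_scope.
Local Open Scope ring_scope.

(** * Lebesgue measure on column vectors *)

(** The translation [s] is what makes the affine case easy: without it the vectors [Th q] for
    proportional [q] would be dependent, and [q = 0] would not be random at all. The variance is
    linear in the mean, which grows like [ln T]; along [T = exp (k^2)] Chebyshev's bound is
    therefore of order [1 / k^2], which is summable. For a group element with invertible upper left
    block [A], eliminating [A] brings the lattice points into the form [(A z, C z + D q + w)] with
    [D] a Schur complement. Since [\det A * \det D = 1], the asymptotic mean is the same for all
    these elements, although the sections over [q] are not. The term [C z] and the passage from
    lattice points to volumes displace [|y|] by a bounded amount only, which is negligible for large
    [|y|]. Open regions are used because the number of lattice points in them is lower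
    semicontinuous in the lattice, hence measurable; the closed count itself is only sandwiched. *)

Fact mx_display : measure_display. Proof. exact: default_measure_display. Qed.

Section MatrixMeasurable.
Variables (R : realType) (p q : nat).

Definition mx_cylinders : set (set 'M[R]_(p, q)) :=
  [set A | exists i j (B : set (measurableTypeR R)),
     measurable B /\ A = (fun M : 'M[R]_(p, q) => M i j) @^-1` B].

Let measurable_mx := <<s mx_cylinders >>.

Let mx0 : measurable_mx set0. Proof. exact: sigma_algebra0. Qed.

Let mxC A : measurable_mx A -> measurable_mx (~` A).
Proof. exact: sigma_algebraC. Qed.

Let mx_bigcup (F : (set _)^nat) :
  (forall i, measurable_mx (F i)) -> measurable_mx (\bigcup_i (F i)).
Proof. exact: sigma_algebra_bigcup. Qed.

HB.instance Definition _ :=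
  @isMeasurable.Build mx_display 'M[R]_(p, q) measurable_mx mx0 mxC mx_bigcup.

Lemma measurable_mx_coord i j :
  measurable_fun [set: 'M[R]_(p, q)] (fun M => M i j : measurableTypeR R).
Proof.
move=> _ B mB; rewrite setTI; apply: sub_sigma_algebra.
by exists i, j, B.
Qed.

Lemma measurable_mxP d (T : measurableType d) (f : T -> 'M[R]_(p, q)) :
  (forall i j, measurable_fun [set: T] (fun x => f x i j : measurableTypeR R)) ->
  measurable_fun [set: T] f.
Proof.
move=> mf; apply: (@measurability _ _ _ _ setT f mx_cylinders) => //.
move=> _ [_ [i [j [B [mB ->]]]] <-].
by rewrite -comp_preimage; exact: mf.
Qed.

End MatrixMeasurable.

(** Both exhaustions are increasing, so the rectangles with equal indices already cover the
    product. *)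
Lemma sigma_finite_product d1 d2 (T1 : measurableType d1)
    (T2 : measurableType d2) (R : realType)
    (m1 : {sigma_finite_measure set T1 -> \bar R})
    (m2 : {sigma_finite_measure set T2 -> \bar R}) :
  sigma_finite setT (m1 \x m2)%E.
Proof.
have /sigma_finiteP[F [TF ndF Foo]] := sigma_finiteT m1.
have /sigma_finiteP[G [TG ndG Goo]] := sigma_finiteT m2.
exists (fun i => F i `*` G i) => [|i].
  apply/seteqP; split => // -[x y] _.
  have [i _ Fix] : (\bigcup_i F i) x by rewrite -TF.
  have [j _ Gjy] : (\bigcup_j G j) y by rewrite -TG.
  exists (maxn i j) => //; split.
  - by move: x Fix; exact/subsetPset/ndF/leq_maxl.
  - by move: y Gjy; exact/subsetPset/ndG/leq_maxr.
have [mF Fioo] := Foo i; have [mG Gioo] := Goo i; split.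
  exact: measurableX.
by rewrite product_measure1E// lte_mul_pinfty// ge0_fin_numE.
Qed.

Section VolumeMeasure.
Variable R : realType.
Implicit Type k : nat.
Local Notation T1 := (measurableTypeR R).
Let leb1 : {sigma_finite_measure set T1 -> \bar R} := @lebesgue_measure R.

Let ccons k (xv : T1 * 'cV[R]_k) : 'cV[R]_k.+1 := col_mx xv.1%:M xv.2.

Let cuncons k (v : 'cV[R]_k.+1) : T1 * 'cV[R]_k :=
  (v 0 0, dsubmx (v : 'cV[R]_(1 + k))).

Lemma measurable_col_mx k :
  measurable_fun [set: T1 * 'cV[R]_k]
    (fun xv => col_mx xv.1%:M xv.2 : 'cV[R]_k.+1).
Proof.
apply: measurable_mxP => i j; rewrite (ord1 j).
have [i0 ii0|ii0] := fintype.unliftP (0 : 'I_k.+1) i.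
- rewrite (_ : (fun _ => _) = (fun xv : T1 * 'cV[R]_k => xv.2 i0 0)).
    apply: (measurableT_comp (f := fun v : 'cV[R]_k => v i0 0)) => //.
    exact: measurable_mx_coord.
  apply/funext => xv; rewrite ii0 (_ : lift 0 i0 = rshift 1 i0); last exact/val_inj.
  exact: (@col_mxEd _ 1 k 1 xv.1%:M xv.2 i0 0).
- rewrite (_ : (fun _ => _) = fst); first exact: measurable_fst.
  apply/funext => xv.
  rewrite ii0 (_ : 0 = lshift k (0 : 'I_1)); last exact/val_inj.
  by rewrite (@col_mxEu _ 1 k 1 xv.1%:M xv.2 0 0) mxE.
Qed.

Let measurable_cuncons k : measurable_fun [set: 'cV[R]_k.+1] (@cuncons k).
Proof.
apply/measurable_fun_pair; first exact: measurable_mx_coord.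
apply: measurable_mxP => i j; rewrite (ord1 j).
rewrite (_ : (fun _ => _) = (fun v : 'cV[R]_k.+1 => v (rshift 1 i : 'I_(1 + k)) 0)).
  exact: measurable_mx_coord.
by apply/funext => v; rewrite mxE.
Qed.

Let cunconsK k : cancel (@ccons k) (@cuncons k).
Proof.
move=> [x v]; rewrite /cuncons /ccons/= col_mxKd; congr pair.
rewrite (_ : 0 = lshift k (0 : 'I_1)); last exact/val_inj.
by rewrite (@col_mxEu _ 1 k 1 x%:M v 0 0) mxE.
Qed.

(** [volume] is a mere set function; on measurable sets it is the image under [col_mx] of a product
    measure. Sigma-finiteness is carried through the induction because the next product needs it. *)
Lemma volume_measure k : exists mu : {sigma_finite_measure set 'cV[R]_k -> \bar R},
  forall A, measurable A -> mu A = volume A.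
Proof.
elim: k => [|k [mu muE]].
  by exists (dirac (0 : 'cV[R]_0)) => A mA.
pose nu := measure_function_pushforward__canonical__measure_function_Measure
  (leb1 \x mu)%E (@measurable_col_mx k).
have sf : sigma_finite setT nu.
  have [F FT mF] := sigma_finite_product leb1 mu.
  exists (fun i => @cuncons k @^-1` F i).
    apply/seteqP; split => // v _.
    have : (\bigcup_i F i) (cuncons v) by rewrite -FT.
    by move=> [i _ Fi]; exists i.
  move=> i; have [mFi Fioo] := mF i; split.
    by rewrite -[X in measurable X]setTI; exact: measurable_cuncons.
  rewrite /= /pushforward; congr (_ < _)%E: Fioo; congr (product_measure1 _ _ _).
  by apply/seteqP; split => x /=; rewrite [col_mx _ _](_ : _ = ccons x)// cunconsK.
pose H1 := Measure_isSigmaFinite.Build _ _ _ nu sf.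
pose nu' : {sigma_finite_measure set 'cV[R]_k.+1 -> \bar R} :=
  HB.pack (Measure.sort nu) H1.
exists nu' => A mA.
have mc : measurable (@ccons k @^-1` A).
  by rewrite -[X in measurable X]setTI; exact: measurable_col_mx.
rewrite /= /pushforward/=; apply: eq_integral => x _ /=.
rewrite -muE; first by congr (mu _); apply/seteqP; split => v /=; rewrite /xsection/= inE.
rewrite (_ : [set v | _] = xsection (@ccons k @^-1` A) x); first exact: measurable_xsection.
by apply/seteqP; split => v /=; rewrite /xsection/= inE.
Qed.

Definition leb k : {sigma_finite_measure set 'cV[R]_k -> \bar R} :=
  projT1 (cid (volume_measure k)).

Lemma lebE k A : measurable A -> leb k A = volume A.
Proof. exact: (projT2 (cid (volume_measure k))). Qed.

End VolumeMeasure.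

Section ScaledPushforward.
Context d1 d2 (X : measurableType d1) (Y : measurableType d2) (R : realType).
Variables (m1 : {measure set X -> \bar R}) (m2 : {measure set Y -> \bar R}).
Variables (phi : X -> Y) (mphi : measurable_fun setT phi) (r : R) (r0 : 0 <= r).

(** Lifts a scaling law from sets to nonnegative functions: the image measure of [m1] and [r] times
    [m2] agree on measurable sets. *)
Lemma integral_scaled_pushforward :
  (forall A, measurable A -> m1 (phi @^-1` A) = (r%:E * m2 A)%E) ->
  forall f : Y -> \bar R, measurable_fun setT f -> (forall y, (0 <= f y)%E) ->
  (\int[m1]_x f (phi x) = r%:E * \int[m2]_y f y)%E.
Proof.
move=> mE f mf f0.
rewrite -[LHS]/((\int[m1]_(x in phi @^-1` setT) (f \o phi) x)%E).
rewrite -(ge0_integral_pushforward mphi)//.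
rewrite -(ge0_integral_mscale m2 measurableT (NngNum r0))//.
apply: (@eq_measure_integral _ _ _ _
  (mscale (NngNum r0) m2)
  (measure_function_pushforward__canonical__measure_function_Measure m1 mphi)).
by move=> A mA _; exact: mE.
Qed.

End ScaledPushforward.

Section LebesgueAffine.
Variable R : realType.
Local Notation T1 := (measurableTypeR R).
Local Notation mu := (@lebesgue_measure R).

Lemma measurable_affine (a c : R) :
  measurable_fun [set: T1] (fun x => a * x + c : T1).
Proof.
apply: (@measurable_funD _ T1 R setT (fun x : T1 => a * x) (fun=> c)) => //.
exact: (@measurable_funM _ T1 R setT (fun=> a) idfun (measurable_cst _) (@measurable_id _ _ _)).
Qed.

(** The rescaled image measure agrees with Lebesgue measure on the intervals []x, y]], which
    determine the latter. *)
Lemma lebesgue_affine (a c : R) (A : set T1) : a != 0 -> measurable A ->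
  mu ((fun x => a * x + c : T1) @^-1` A) = (`|a|^-1%:E * mu A)%E.
Proof.
move=> a0 mA.
have an0 : 0 < `|a| by rewrite normr_gt0.
pose nu := measure_function_pushforward__canonical__measure_function_Measure
  mu (measurable_affine a c).
rewrite (@lebesgue_measure_unique R (mscale (NngNum (ltW an0)) nu) _ A)//.
  rewrite /mscale/= muleA -EFinM mulVf ?gt_eqF// mul1e.
  by [].
move=> _ [[x y] _ <-].
rewrite /mscale/= /pushforward.
have [apos|aneg|a00] := ltgtP 0 a; last by rewrite -a00 eqxx in a0.
- rewrite [X in _ = (_ * mu X)%E](_ : _ = `](x - c) / a, (y - c) / a]%classic).
    rewrite !lebesgue_measure_itv/= !lte_fin ltr_pM2r ?invr_gt0// ltrBlDr subrK.
    case: ifPn => xy; last by rewrite mule0.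
    rewrite -!EFinB -EFinM; congr EFin; rewrite gtr0_norm//; field.
    by rewrite gt_eqF.
  apply/seteqP; split => z /=; rewrite !in_itv/= ltr_pdivrMr// ler_pdivlMr// ltrBlDr lerBrDr [z * a]mulrC//.
(* A negative slope reverses the interval, so the closed end is now the left one. *)
- rewrite [X in _ = (_ * mu X)%E](_ : _ = `[(y - c) / a, (x - c) / a[%classic).
    rewrite !lebesgue_measure_itv/= !lte_fin ltr_nM2r ?invr_lt0// ltrBlDr subrK.
    case: ifPn => xy; last by rewrite mule0.
    rewrite -!EFinB -EFinM; congr EFin; rewrite ltr0_norm//; field.
    by rewrite lt_eqF.
  apply/seteqP; split => z /=; rewrite !in_itv/= ltr_ndivlMr// ler_ndivrMr// ltrBlDr lerBrDr [z * a]mulrC andbC//.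
Qed.

Lemma integral_lebesgue_affine (a c : R) (f : T1 -> \bar R) : a != 0 ->
  measurable_fun setT f -> (forall x, (0 <= f x)%E) ->
  (\int[mu]_x f (a * x + c)%R = `|a|^-1%:E * \int[mu]_x f x)%E.
Proof.
move=> a0 mf f0.
apply: (@integral_scaled_pushforward _ _ _ _ _ mu mu
  (fun x => a * x + c : T1)) => //.
- exact: measurable_affine.
- by move=> A mA; exact: lebesgue_affine.
Qed.

End LebesgueAffine.

Lemma measurable_preimageT d1 d2 (X : measurableType d1)
    (Y : measurableType d2) (f : X -> Y) (A : set Y) :
  measurable_fun setT f -> measurable A -> measurable (f @^-1` A).
Proof. by move=> mf mA; rewrite -[X in measurable X]setTI; exact: mf. Qed.

Section Leb.
Variable R : realType.
Implicit Type k : nat.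
Local Notation T1 := (measurableTypeR R).
Let leb1 : {sigma_finite_measure set T1 -> \bar R} := @lebesgue_measure R.

Lemma measurable_mulmxD p q r (M : 'M[R]_(p, q)) (c : 'M[R]_(p, r)) :
  measurable_fun setT (fun v : 'M[R]_(q, r) => M *m v + c).
Proof.
apply: measurable_mxP => i j.
rewrite (_ : (fun _ => _) = (fun v : 'M[R]_(q, r) => (\sum_l M i l * v l j) + c i j)).
  apply: (@measurable_funD _ _ R) => //; apply: measurable_sum => l.
  apply: (@measurable_funM _ _ R) => //; exact: measurable_mx_coord.
by apply/funext => v; rewrite !mxE.
Qed.

Lemma measurable_addmx p q (c : 'M[R]_(p, q)) :
  measurable_fun setT (fun v : 'M[R]_(p, q) => v + c).
Proof.
rewrite (_ : (fun _ => _) = (fun v : 'M[R]_(p, q) => 1%:M *m v + c)).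
  exact: measurable_mulmxD.
by apply/funext => v; rewrite mul1mx.
Qed.

Lemma measurable_mulmx p q r (M : 'M[R]_(p, q)) :
  measurable_fun setT (fun v : 'M[R]_(q, r) => M *m v).
Proof.
rewrite (_ : (fun _ => _) = (fun v : 'M[R]_(q, r) => M *m v + 0)).
  exact: measurable_mulmxD.
by apply/funext => v; rewrite addr0.
Qed.

Lemma leb_product k (A : set 'cV[R]_k.+1) : measurable A ->
  leb R k.+1 A = (leb1 \x leb R k)%E [set xv : T1 * 'cV[R]_k | A (col_mx xv.1%:M xv.2)].
Proof.
move=> mA; rewrite lebE//=; apply: eq_integral => x _ /=.
have mc : measurable [set xv : T1 * 'cV[R]_k | A (col_mx xv.1%:M xv.2)].
  exact: (measurable_preimageT (@measurable_col_mx R k) mA).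
rewrite -lebE.
  by congr (leb R k _); apply/seteqP; split => v /=; rewrite /xsection/= inE.
rewrite (_ : [set v | _] = xsection [set xv : T1 * 'cV[R]_k | A (col_mx xv.1%:M xv.2)] x).
  exact: measurable_xsection.
by apply/seteqP; split => v /=; rewrite /xsection/= inE.
Qed.

Lemma leb_sectionl k (A : set 'cV[R]_k.+1) : measurable A ->
  leb R k.+1 A = (\int[@lebesgue_measure R]_x
    leb R k [set v : 'cV[R]_k | A (col_mx x%:M v)])%E.
Proof.
move=> mA; rewrite leb_product//; apply: eq_integral => x _ /=.
by congr (leb R k _); apply/seteqP; split => v /=; rewrite /xsection/= inE.
Qed.

(** Uniqueness of the product measure exchanges the order of integration. This order is needed in
    [det_scaling_upper], where the first coordinate is translated by an amount depending on the
    others. *)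
Lemma leb_sectionr k (A : set 'cV[R]_k.+1) : measurable A ->
  leb R k.+1 A = (\int[leb R k]_v
    @lebesgue_measure R [set x | A (col_mx x%:M v)])%E.
Proof.
move=> mA; rewrite leb_product//.
rewrite (@product_measure_unique _ _ _ _ _ leb1 (leb R k)
  (product_measure2 leb1 (leb R k))).
- apply: eq_integral => x _ /=.
  by congr (lebesgue_measure _); apply/seteqP; split => v /=; rewrite /ysection/= inE.
- by move=> B C mB mC; exact: product_measure2E.
- exact: (measurable_preimageT (@measurable_col_mx R k) mA).
Qed.

End Leb.

Section LebLinear.
Variable R : realType.
Implicit Type k : nat.
Local Notation T1 := (measurableTypeR R).
Local Notation mu := (@lebesgue_measure R).

Definition vcons k (x : T1) (v : 'cV[R]_k) : 'cV[R]_k.+1 := col_mx x%:M v.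

Lemma vcons_surj k (w : 'cV[R]_k.+1) : exists x v, w = vcons x v.
Proof.
exists (w 0 0), (dsubmx (w : 'cV_(1 + k))).
rewrite /vcons (_ : _%:M = usubmx (w : 'cV_(1 + k))).
  exact/esym/(@vsubmxK _ 1 k 1 w).
by apply/matrixP => i j; rewrite !ord1 !mxE; congr (w _ _); exact/val_inj.
Qed.

Lemma vconsD k (x y : T1) (v w : 'cV[R]_k) :
  vcons x v + vcons y w = vcons (x + y) (v + w).
Proof.
rewrite /vcons; have -> : ((x + y)%:M : 'M[R]_1) = x%:M + y%:M.
  by rewrite raddfD.
exact: (@add_col_mx _ 1 k 1).
Qed.

Lemma measurable_vcons_section k (A : set 'cV[R]_k.+1) x :
  measurable A -> measurable [set v | A (vcons x v)].
Proof.
move=> mA.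
have mc := measurable_preimageT (@measurable_col_mx R k) mA.
rewrite (_ : [set _ | _] = xsection ((fun xv : T1 * 'cV[R]_k => vcons xv.1 xv.2) @^-1` A) x).
  exact: measurable_xsection.
by apply/seteqP; split => v /=; rewrite /xsection/= inE.
Qed.

Lemma measurable_vcons_sectionr k (A : set 'cV[R]_k.+1) v :
  measurable A -> measurable [set x : T1 | A (vcons x v)].
Proof.
move=> mA.
have mc := measurable_preimageT (@measurable_col_mx R k) mA.
rewrite (_ : [set _ | _] = ysection ((fun xv : T1 * 'cV[R]_k => vcons xv.1 xv.2) @^-1` A) v).
  exact: measurable_ysection.
by apply/seteqP; split => x /=; rewrite /ysection/= inE.
Qed.

Lemma measurable_leb_section k (A : set 'cV[R]_k.+1) : measurable A ->
  measurable_fun setT (fun x => leb R k [set v | A (vcons x v)]).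
Proof.
move=> mA.
have mc := measurable_preimageT (@measurable_col_mx R k) mA.
rewrite (_ : (fun _ => _) = leb R k \o
    xsection ((fun xv : T1 * 'cV[R]_k => vcons xv.1 xv.2) @^-1` A)).
  exact: measurable_fun_xsection.
apply/funext => x /=; congr (leb R k _).
by apply/seteqP; split => v /=; rewrite /xsection/= inE.
Qed.

Lemma leb_translate k (c : 'cV[R]_k) (A : set 'cV[R]_k) : measurable A ->
  leb R k [set v | A (v + c)] = leb R k A.
Proof.
elim: k c A => [|k IH] c A mA.
  by congr (leb R 0 _); apply/seteqP; split => v /=; congr A; apply/matrixP => -[].
rewrite leb_sectionl; last exact: (measurable_preimageT (@measurable_addmx R _ _ c) mA).
have [y [w ->]] := vcons_surj c.
rewrite leb_sectionl//.
pose g x := leb R k [set v | A (vcons x v)].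
transitivity (\int[mu]_x g (1 * x + y)%R)%E.
  apply: eq_integral => x _; rewrite /g -(IH w [set v | A (vcons (1 * x + y) v)]); last exact: measurable_vcons_section.
  by congr (leb R k _); apply/seteqP; split => v /=; rewrite -/(vcons x v) vconsD mul1r.
rewrite integral_lebesgue_affine ?oner_neq0//; last exact: measurable_leb_section.
by rewrite normr1 invr1 mul1e.
Qed.

Definition det_scaling k (M : 'M[R]_k) := forall A, measurable A ->
  leb R k [set v | A (M *m v)] = (`|\det M|^-1%:E * leb R k A)%E.

Lemma det_scalingM k (M N : 'M[R]_k) :
  det_scaling M -> det_scaling N -> det_scaling (M *m N).
Proof.
move=> hM hN A mA.
have mB : measurable [set v | A (M *m v)].
  exact: (measurable_preimageT (@measurable_mulmx R _ _ _ M) mA).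
transitivity (leb R k [set v | [set v | A (M *m v)] (N *m v)]).
  by congr (leb R k _); apply/seteqP; split => v /=; rewrite mulmxA.
rewrite hN// hM// muleA -EFinM det_mulmx normrM invfM.
by rewrite mulrC.
Qed.

Lemma det_scaling_block_diag k (a : R) (D : 'M[R]_k) : a != 0 ->
  det_scaling D -> det_scaling (block_mx a%:M 0 0 D : 'M[R]_(1 + k)).
Proof.
move=> a0 hD A mA.
have vE x v : block_mx a%:M 0 0 D *m (vcons x v : 'cV_(1 + k)) = vcons (a * x) (D *m v).
  rewrite /vcons mul_block_col !mul0mx addr0 add0r.
  by rewrite -scalar_mxM.
rewrite leb_sectionl; last exact: (measurable_preimageT (@measurable_mulmx R _ _ _ _) mA).
rewrite leb_sectionl//.
pose g x := leb R k [set v | A (vcons x v)].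
have mg : measurable_fun setT g by exact: measurable_leb_section.
transitivity (\int[mu]_x (`|\det D|^-1%:E * g (a * x + 0)%R))%E.
  apply: eq_integral => x _; rewrite /g -(hD [set v | A (vcons (a * x + 0) v)]); last exact: measurable_vcons_section.
  congr (leb R k _); apply/seteqP; split => v /=; rewrite -/(vcons x v) vE addr0//.
rewrite ge0_integralZl//=.
- rewrite integral_lebesgue_affine// muleA -EFinM det_ublock normrM invfM det_scalar1.
  by rewrite mulrC.
- exact: (measurableT_comp mg (measurable_affine _ _)).
Qed.

Lemma det_scaling_lower k (c : 'cV[R]_k) :
  det_scaling (block_mx 1%:M 0 c 1%:M : 'M[R]_(1 + k)).
Proof.
move=> A mA.
have vE x v : block_mx 1%:M 0 c 1%:M *m (vcons x v : 'cV_(1 + k)) = vcons x (v + x *: c).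
  by rewrite /vcons mul_block_col !mul1mx !mul0mx addr0 addrC mul_mx_scalar.
rewrite leb_sectionl; last exact: (measurable_preimageT (@measurable_mulmx R _ _ _ _) mA).
rewrite leb_sectionl// det_lblock !det1 mulr1 normr1 invr1 mul1e.
apply: eq_integral => x _; rewrite -(leb_translate (x *: c) (A := [set v | A (vcons x v)])); last exact: measurable_vcons_section.
by congr (leb R k _); apply/seteqP; split => v /=; rewrite -/(vcons x v) vE.
Qed.

Lemma det_scaling_upper k (e : 'rV[R]_k) :
  det_scaling (block_mx 1%:M e 0 1%:M : 'M[R]_(1 + k)).
Proof.
move=> A mA.
have vE x v : block_mx 1%:M e 0 1%:M *m (vcons x v : 'cV_(1 + k)) = vcons (1 * x + (e *m v) 0 0) v.
  rewrite /vcons mul_block_col !mul1mx !mul0mx add0r mul1r raddfD/=.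
  by rewrite -mx11_scalar.
rewrite leb_sectionr; last exact: (measurable_preimageT (@measurable_mulmx R _ _ _ _) mA).
rewrite leb_sectionr// det_ublock !det1 mulr1 normr1 invr1 mul1e.
apply: eq_integral => v _.
transitivity (mu ((fun x : T1 => 1 * x + (e *m v) 0 0 : T1) @^-1` [set x | A (vcons x v)])).
  by congr (mu _); apply/seteqP; split => x /=; rewrite -/(vcons x v) vE.
rewrite lebesgue_affine ?oner_neq0//; last exact: measurable_vcons_sectionr.
by rewrite normr1 invr1 mul1e.
Qed.

(* Block Gaussian elimination; [e] makes the corner entry invertible. *)
Lemma leb_mulmx k (M : 'M[R]_k) : \det M != 0 -> det_scaling M.
Proof.
elim: k M => [|k IH] M dM.
  move=> A mA; rewrite det_mx00 normr1 invr1 mul1e.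
  by congr (leb R 0 _); apply/seteqP; split => v /=; congr A; apply/matrixP => -[].
have pivot (N : 'M[R]_(1 + k)) : \det N != 0 -> N 0 0 != 0 -> det_scaling N.
  move=> dN N00; set a := N 0 0 in N00.
  pose b := ursubmx N; pose c := dlsubmx N; pose D := drsubmx N.
  have aE : ulsubmx N = a%:M.
    by apply/matrixP => i j; rewrite !ord1 !mxE /a; congr (N _ _); exact/val_inj.
  have NE : N = block_mx 1%:M 0 (a^-1 *: c) 1%:M *m
      block_mx a%:M 0 0 (D - (a^-1 *: c) *m b) *m block_mx 1%:M (a^-1 *: b) 0 1%:M.
    rewrite !mulmx_block !(mulmx0, mul0mx, mulmx1, mul1mx, addr0, add0r).
    rewrite -[LHS]submxK aE; congr block_mx.
    - by rewrite mul_scalar_mx scalerA mulfV// scale1r.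
    - by rewrite mul_mx_scalar scalerA mulfV// scale1r.
    - rewrite mul_mx_scalar scalerA mulfV// scale1r -scalemxAl -scalemxAr -/D.
      by rewrite addrC subrK.
  rewrite NE; apply: det_scalingM; last exact: det_scaling_upper.
  apply: det_scalingM; first exact: det_scaling_lower.
  apply: det_scaling_block_diag => //; apply: IH.
  move: dN; rewrite NE !det_mulmx det_lblock !det_ublock !det1 !mulr1 mul1r.
  by rewrite mulf_eq0 negb_or => /andP[].
have [M0|M0] := eqVneq (M 0 0) 0; last exact: pivot.
have [i Mi0] : exists i, M i 0 != 0.
  apply/existsP; apply: contraNT dM => /existsPn/= M00.
  rewrite (expand_det_col _ 0) big1// => i _.
  by have /negPn/eqP -> := M00 i; rewrite mul0r.
have [j ij] : exists j : 'I_k, i = rshift 1 j.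
  case: (unliftP 0 i) Mi0 => [j ->|->]; last by rewrite M0 eqxx.
  by exists j; exact/val_inj.
(* Multiplication by [U 1] adds to the first row a row whose first entry is nonzero; [U (-1)] undoes
   it. *)
pose U (s : R) : 'M[R]_(1 + k) := block_mx 1%:M (s *: delta_mx 0 j) 0 1%:M.
have UE : M = U (-1) *m (U 1 *m M).
  rewrite mulmxA /U mulmx_block !(mulmx0, mul0mx, mulmx1, mul1mx, addr0, add0r).
  by rewrite -scalerDl subrr scale0r -scalar_mx_block mul1mx.
rewrite UE; apply: det_scalingM; first exact: det_scaling_upper.
apply: pivot; first by rewrite det_mulmx det_ublock !det1 !mul1r.
rewrite mxE big_split_ord big_ord1 /=.
have -> : 0 = lshift k (0 : 'I_1) by exact/val_inj.
rewrite block_mxEul mxE mul1r (bigD1 j)//= big1 => [|l lj].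
  rewrite block_mxEur scale1r mxE !eqxx mul1r addr0.
  by rewrite (_ : lshift k 0 = 0) ?M0 ?add0r -?ij//; exact/val_inj.
by rewrite block_mxEur scale1r mxE (negbTE lj) andbF mul0r.
Qed.

End LebLinear.

(** * Integer translates of the unit cube *)

Section Cube.
Variable R : realType.
Implicit Type k : nat.
Local Notation T1 := (measurableTypeR R).
Local Notation mu := (@lebesgue_measure R).

Definition cube k : set 'cV[R]_k := [set v | forall i, 0 <= v i 0 < 1].

Definition intv k (p : 'cV[int]_k) : 'cV[R]_k := map_mx intr p.

Definition flv k (v : 'cV[R]_k) : 'cV[int]_k := map_mx Num.floor v.

Lemma flvP k (v : 'cV[R]_k) p : (flv v = p) <-> cube (v - intv p).
Proof.
split => [<- i|vp].
  rewrite !mxE; have /andP[h1 h2] := floor_itv (v i 0).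
  by rewrite subr_ge0 h1 ltrBlDl -(intrD _ _ 1%Z).
apply/matrixP => i j; rewrite ord1 mxE; apply: floor_def.
by have := vp i; rewrite !mxE subr_ge0 ltrBlDl intrD.
Qed.

Lemma flvD k (v : 'cV[R]_k) p : flv (v + intv p) = flv v + p.
Proof.
apply/flvP; rewrite /intv map_mxD opprD addrACA subrr addr0 -/(intv _).
exact/flvP.
Qed.

Lemma flv_cube k (v : 'cV[R]_k) : cube v -> flv v = 0.
Proof. by move=> cv; apply/flvP; rewrite /intv map_mx0 subr0. Qed.

Lemma measurable_cube k : measurable (@cube k).
Proof.
rewrite (_ : @cube k = \bigcap_(i in [set: 'I_k])
    ((fun v : 'cV[R]_k => v i 0 : R) @^-1` `[0, 1[%classic)).
  apply: fin_bigcap_measurable => // i _.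
  by apply: measurable_preimageT; [exact: measurable_mx_coord|exact: measurable_itv].
by apply/seteqP; split => v vc i; [move=> _|]; have := vc i; rewrite /= in_itv/=; auto.
Qed.

Lemma vcons0 k x (v : 'cV[R]_k) : vcons x v 0 0 = x.
Proof.
rewrite (_ : vcons x v 0 0 = vcons x v (lshift k (0 : 'I_1)) 0).
  by rewrite (@col_mxEu _ 1 k 1) mxE.
by congr (vcons x v _ _); exact/val_inj.
Qed.

Lemma vconsS k x (v : 'cV[R]_k) i : vcons x v (lift 0 i) 0 = v i 0.
Proof.
rewrite (_ : vcons x v (lift 0 i) 0 = vcons x v (rshift 1 i) 0).
  by rewrite (@col_mxEd _ 1 k 1).
by congr (vcons x v _ _); exact/val_inj.
Qed.

Lemma leb_cube k : leb R k (cube (k := k)) = 1%E.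
Proof.
elim: k => [|k IH].
  rewrite lebE; last exact: measurable_cube.
  by rewrite /= indicE mem_set// => -[].
rewrite leb_sectionl; last exact: measurable_cube.
rewrite (eq_integral (fun x => (\1_(`[0%R, 1%R[%classic : set T1) x)%:E)).
  rewrite integral_indic// setIT.
  have := @lebesgue_measure_itv R `[0, 1[.
  by rewrite /= lte_fin ltr01 oppr0 adde0.
move=> x _; rewrite indicE; have cE v : cube (vcons x v) <-> (0 <= x < 1 /\ cube v).
  split=> [h|[hx hv] i].
    by split=> [|i]; [have := h 0; rewrite vcons0|have := h (lift 0 i); rewrite vconsS].
  by case: (unliftP 0 i) => [j ->|->]; rewrite ?vconsS ?vcons0.
have [xin|xout] := boolP (x \in `[0, 1[).
  rewrite mem_set// -[RHS]IH; congr (leb R k _).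
  apply/seteqP; split => v /=; rewrite -/(vcons x v) cE; first by case.
  by move: xin; rewrite in_itv/=.
rewrite memNset/=; last by apply/negP.
rewrite (_ : [set v : 'cV[R]_k | _] = set0) ?measure0//.
apply/seteqP; split => v //=; rewrite -/(vcons x v) cE => -[hx _].
by move: xout; rewrite in_itv/= hx.
Qed.

Local Open Scope ereal_scope.

Lemma integral_leb_translate k (c : 'cV[R]_k) (f : 'cV[R]_k -> \bar R) :
  measurable_fun setT f -> (forall v, 0 <= f v) ->
  \int[leb R k]_v f (v + c)%R = \int[leb R k]_v f v.
Proof.
move=> mf f0.
rewrite (@integral_scaled_pushforward _ _ _ _ _ (leb R k) (leb R k)
  (fun v => v + c)%R (@measurable_addmx R k 1 c) 1%R ler01)//; first by rewrite mul1e.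
by move=> A mA; rewrite mul1e; exact: leb_translate.
Qed.

(** Space is cut into the unit cubes with integral corners. The functions of interest vanish outside
    finitely many of them, so a finite sum over [B] replaces a series. *)
Lemma leb_unfold k (B : {fset 'cV[int]_k}) (f : 'cV[R]_k -> \bar R) :
  measurable_fun setT f -> (forall v, 0 <= f v) ->
  (forall v, f v != 0 -> flv v \in B) ->
  \int[leb R k]_v f v =
  \sum_(p <- B) \int[leb R k]_(t in @cube k) f (t + intv p)%R.
Proof.
move=> mf f0 fB.
pose Q p : set 'cV[R]_k := [set v | cube (v - intv p)%R].
have mQ p : measurable (Q p).
  exact: (measurable_preimageT (@measurable_addmx R k 1 (- intv p)%R) (@measurable_cube k)).
transitivity (\int[leb R k]_v \sum_(p <- B) (f v * (\1_(Q p) v)%:E)).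
  apply: eq_integral => v _; have [->|fv0] := eqVneq (f v) 0.
    by rewrite big1// => p _; rewrite mul0e.
  rewrite (big_fsetD1 (flv v)) ?fB//= big_seq_cond big1.
    by rewrite adde0 indicE mem_set ?mule1//; apply/flvP.
  move=> p; rewrite in_fsetD1 andbT => /andP[pv _].
  rewrite indicE memNset ?mule0// => /flvP pE.
  by rewrite pE eqxx in pv.
have mfQ p : measurable_fun setT (fun v => f v * (\1_(Q p) v)%:E).
  apply: emeasurable_funM => //; apply/measurable_EFinP; exact: measurable_indic.
rewrite ge0_integral_sum//; last by move=> p v _; rewrite mule_ge0// lee_fin.
apply: eq_bigr => p _.
rewrite -(integral_leb_translate (intv p))//; last by move=> v; rewrite mule_ge0// lee_fin.
rewrite [RHS]integral_mkcond; apply: eq_integral => v _.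
rewrite patchE indicE /Q.
have -> : (v + intv p)%R \in [set v0 | cube (v0 - intv p)%R] = (v \in @cube k).
  by apply/idP/idP => /set_mem h; apply/mem_set; move: h; rewrite /= addrK.
by case: ifP => _; rewrite ?mule1 ?mule0.
Qed.

End Cube.

Lemma finite_int_box k (a : 'cV[int]_k) (w : nat) :
  finite_set [set p : 'cV[int]_k | forall i, a i 0 <= p i 0 <= a i 0 + w%:Z].
Proof.
pose F (g : {ffun 'I_k -> 'I_w.+1}) : 'cV[int]_k := \col_i (a i 0 + (g i : nat)%:Z).
apply: (@sub_finite_set _ _ (F @` setT)); last first.
  by apply: finite_image; exact: finite_finset.
move=> p /= pb; exists [ffun i => inord (absz (p i 0 - a i 0)%R)] => //.
apply/matrixP => i j; rewrite ord1 mxE ffunE inordK.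
  have /andP[h _] := pb i.
  by rewrite gez0_abs ?subr_ge0// addrC subrK.
have /andP[h1 h2] := pb i.
by rewrite ltnS -lez_nat gez0_abs ?subr_ge0// lerBlDl.
Qed.

Section Periodic.
Variable R : realType.
Implicit Type k : nat.
Local Notation cube := (@cube R _).
Local Open Scope ereal_scope.

Definition periodic k (H : 'cV[R]_k -> \bar R) :=
  [/\ measurable_fun setT H, forall v, 0 <= H v
    & forall v p, H (v + intv R p)%R = H v].

Lemma intvN k (p : 'cV[int]_k) : intv R (- p)%R = (- intv R p)%R.
Proof. exact: map_mxN. Qed.

Lemma periodic_shift k (H : 'cV[R]_k -> \bar R) c :
  periodic H -> periodic (fun v => H (v + c)%R).
Proof.
move=> [mH H0 HP]; split => // [|v p]; last by rewrite addrAC HP.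
exact: (measurableT_comp mH (@measurable_addmx R k 1 c)).
Qed.

Lemma periodicM k (H G : 'cV[R]_k -> \bar R) :
  periodic H -> periodic G -> periodic (fun v => H v * G v).
Proof.
move=> [mH H0 HP] [mG G0 GP]; split => [|v|v p]; last by rewrite HP GP.
- exact: emeasurable_funM.
- exact: mule_ge0.
Qed.

Lemma measurable_cube_indic k : measurable_fun setT (fun v : 'cV[R]_k => (\1_cube v : R)%:E).
Proof. by apply/measurable_EFinP; apply: measurable_indic; exact: measurable_cube. Qed.

(** Cut along the integral cubes, the unit cube at [c] falls into pieces whose integral translates
    tile the standard cube; a periodic function does not see these translations. *)
Lemma cube_translate k (H : 'cV[R]_k -> \bar R) c : periodic H ->
  \int[leb R k]_(t in cube) H (t + c)%R = \int[leb R k]_(t in cube) H t.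
Proof.
move=> [mH H0 HP].
pose f v := H v * (\1_cube (v - c)%R)%:E.
have f0 v : 0 <= f v by rewrite mule_ge0// lee_fin.
have mf : measurable_fun setT f.
  apply: emeasurable_funM => //.
  exact: (measurableT_comp (@measurable_cube_indic k) (@measurable_addmx R k 1 (- c)%R)).
(* The floors of the points of the cube at [c] exceed those of [c] by 0 or 1 in each coordinate. *)
pose B := fset_set [set p : 'cV[int]_k | forall i, flv c i 0%R <= p i 0%R <= flv c i 0%R + 1%:Z]%R.
have inB p : (p \in B) = (p \in [set p : 'cV[int]_k | forall i, flv c i 0%R <= p i 0%R <= flv c i 0%R + 1%:Z]%R).
  by rewrite in_fset_set//; exact: finite_int_box.
have fB v : f v != 0 -> flv v \in B.
  rewrite /f indicE; case: (boolP ((v - c)%R \in cube)) => [|_]; last by rewrite mule0 eqxx.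
  move=> /set_mem vc _; rewrite inB; apply/mem_set => i /=.
  have /andP[] := vc i; rewrite !mxE subr_ge0 ltrBlDl => h1 h2.
  rewrite le_floor//=.
  rewrite -ltzD1 -(ltr_int R) !intrD.
  have /andP[h3 _] := floor_itv (v i 0)%R.
  have /andP[_] := floor_itv (c i 0)%R; rewrite intrD => h4.
  by move: h2 h3 h4; lra.
transitivity (\int[leb R k]_v f v).
  rewrite -(integral_leb_translate c)// [LHS]integral_mkcond; apply: eq_integral => v _.
  by rewrite patchE /f addrK indicE; case: ifP; rewrite ?mule1 ?mule0.
rewrite (leb_unfold mf f0 fB) -ge0_integral_sum//; last 2 first.
- exact: measurable_cube.
- move=> p; apply: measurable_funTS.
  exact: (measurableT_comp mf (@measurable_addmx R k 1 (intv R p))).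
apply: eq_integral => t /set_mem tc.
have [Ht0|Ht0] := eqVneq (H t) 0.
  by rewrite big1 ?Ht0// => p _; rewrite /f HP Ht0 mul0e.
(* Exactly one integral translate of [t], the one by [- q], lies in the cube at [c]. *)
pose q := flv (t - c)%R.
have fE p : f (t + intv R p)%R = H t * (p == - q)%R%:R%:E.
  rewrite /f HP indicE; congr (_ * (_%:R)%:E); congr nat_of_bool.
  have -> : (t + intv R p - c = (t - c) - intv R (- p))%R.
    by rewrite intvN opprK addrAC.
  apply/idP/eqP => [/set_mem/flvP qE|->].
    by rewrite /q qE opprK.
  by apply/mem_set; rewrite opprK; exact/flvP.
rewrite (eq_bigr (fun p => H t * (p == - q)%R%:R%:E)) => [|p _]; last exact: fE.
have qB : (- q)%R \in B.
  have : f (t + intv R (- q))%R != 0 by rewrite fE eqxx mule1.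
  by move/fB; rewrite flvD flv_cube// add0r.
rewrite (big_fsetD1 (- q)%R)//= eqxx mule1 big_seq_cond big1 ?adde0//.
by move=> p; rewrite in_fsetD1 andbT => /andP[/negbTE -> _]; rewrite mule0.
Qed.

End Periodic.

(** * Random affine maps *)

Section RandomAffine.
Variable R : realType.
Implicit Type k : nat.
Local Notation cube := (@cube R _).
Local Open Scope ereal_scope.

Lemma periodic_measurable k (H : 'cV[R]_k -> \bar R) :
  periodic H -> measurable_fun setT H.
Proof. by case. Qed.

(** The restriction of [leb] to the cube has mass 1; as a probability on the whole space it can
    serve as a factor of the probability space built in [random_affine]. *)
Lemma uniform_cube k : exists P : probability 'cV[R]_k R,
  forall f, measurable_fun setT f -> (forall v, 0 <= f v) ->
    \int[P]_v f v = \int[leb R k]_(v in cube) f v.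
Proof.
have mc := @measurable_cube R k.
pose nu := measure_function_mrestr__canonical__measure_function_Measure (leb R k) mc.
have nu1 : nu setT = 1 by rewrite /= /mrestr setTI leb_cube.
pose H := Measure_isProbability.Build _ _ _ nu nu1.
pose P : probability 'cV[R]_k R := HB.pack (Measure.sort nu) H.
exists P => f mf f0.
have nuC : P (~` cube) = 0.
  by rewrite /P /= /mrestr setICl measure0.
rewrite (@ge0_negligible_integral _ _ _ P setT (~` cube) f)//; last exact: measurableC.
rewrite setDE setCK setTI; apply: eq_measure_integral => A mA Ac.
by rewrite /= /mrestr setIidl.
Qed.

Lemma integral_prob_cst d (T : measurableType d) (P : probability T R) (c : \bar R) :
  \int[P]_x c = c.
Proof.
rewrite integral_cst// -[RHS]mule1; congr (_ * _); exact: probability_setT.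
Qed.

Lemma measurable_scalemx k (a : R) :
  measurable_fun setT (fun v : 'cV[R]_k => a *: v)%R.
Proof.
rewrite (_ : (fun _ => _) = (fun v : 'cV[R]_k => a%:M *m v)%R).
  exact: measurable_mulmx.
by apply/funext => v; rewrite mul_scalar_mx.
Qed.

Lemma measurable_addmx2 d (T : measurableType d) k (f g : T -> 'cV[R]_k) :
  measurable_fun setT f -> measurable_fun setT g ->
  measurable_fun setT (fun x => f x + g x)%R.
Proof.
move=> mf mg; apply: measurable_mxP => i j.
under eq_fun do rewrite mxE.
apply: (@measurable_funD _ _ R).
- exact: (measurableT_comp (measurable_mx_coord i j) mf).
- exact: (measurableT_comp (measurable_mx_coord i j) mg).
Qed.

(* By translation invariance one may average over all translates of [l t], and
   then integrate over the translation first. *)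
Lemma cube_dilate k (H : 'cV[R]_k -> \bar R) (l : int) : periodic H -> (l != 0)%R ->
  \int[leb R k]_(t in cube) H (l%:~R *: t)%R = \int[leb R k]_(t in cube) H t.
Proof.
move=> pH l0; have [mH H0 HP] := pH; have [U UE] := uniform_cube k.
have mHl : measurable_fun setT (fun t : 'cV[R]_k => H (l%:~R *: t)%R).
  exact: (measurableT_comp mH (@measurable_scalemx k _)).
have pHl : periodic (fun t : 'cV[R]_k => H (l%:~R *: t)%R).
  split => // v p; rewrite scalerDr (_ : _ *: intv R p = intv R (l *: p))%R ?HP//.
  by rewrite /intv map_mxZ.
have H1 c : \int[leb R k]_(t in cube) H (l%:~R *: t)%R = \int[U]_t H (l%:~R *: t + c)%R.
  rewrite UE//; last exact: (measurableT_comp (periodic_measurable (periodic_shift c pH)) (@measurable_scalemx k _)).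
  rewrite -(cube_translate (l%:~R^-1 *: c)%R pHl); apply: eq_integral => t _.
  by rewrite scalerDr scalerA mulfV ?scale1r// intr_eq0.
rewrite -(integral_prob_cst U (\int[leb R k]_(t in cube) H (l%:~R *: t)%R)).
rewrite (eq_integral (fun c => \int[U]_t H (l%:~R *: t + c)%R)) => [|c _]; last exact: H1.
have mf : measurable_fun setT (fun ct : 'cV[R]_k * 'cV[R]_k => H (l%:~R *: ct.2 + ct.1)%R).
  apply: (measurableT_comp mH); apply: measurable_addmx2 => //.
  exact: (measurableT_comp (@measurable_scalemx k _)).
rewrite (fubini_tonelli (m1 := U) (m2 := U) (fun ct => H (l%:~R *: ct.2 + ct.1)%R))//=.
rewrite -[RHS](integral_prob_cst U); apply: eq_integral => t _.
rewrite UE//; last first.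
  by under eq_fun do rewrite addrC; exact: (periodic_measurable (periodic_shift _ pH)).
rewrite -[RHS](cube_translate (l%:~R *: t)%R pH).
by apply: eq_integral => c _; rewrite addrC.
Qed.

(* The random vectors [Th q + s] mod [Z^m], [q] in [Z^n], are uniformly
   distributed and pairwise independent. *)
Definition pairwise_uniform d (W : measurableType d) (P : probability W R) m n
    (Th : W -> 'M[R]_(m, n)) (s : W -> 'cV[R]_m) :=
  [/\ measurable_fun setT Th, measurable_fun setT s,
    forall (q : 'cV[int]_n) H, periodic H ->
      \int[P]_w H (Th w *m intv R q + s w)%R = \int[leb R m]_(t in cube) H t
  & forall (q q' : 'cV[int]_n) H H', q != q' -> periodic H -> periodic H' ->
      \int[P]_w (H (Th w *m intv R q + s w)%R * H' (Th w *m intv R q' + s w)%R) =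
      \int[leb R m]_(t in cube) H t * \int[leb R m]_(t in cube) H' t].

(* The entries of [Th] and [s] are independent and uniform mod 1. If [q] and [q']
   differ only in their first entry, by [l], then the two values differ by [l t]
   with [t] the first column of [Th]; hence [cube_dilate]. *)
Lemma random_affine m n : exists d (W : measurableType d) (P : probability W R)
    (Th : W -> 'M[R]_(m, n)) (s : W -> 'cV[R]_m), pairwise_uniform P Th s.
Proof.
have [U UE] := uniform_cube m.
elim: n => [|n [d [W [P [Th [s [mTh ms IH1 IH2]]]]]]].
  (* With no columns there is only one [q], and independence is vacuous. *)
  exists _, 'cV[R]_m, U, (fun=> 0%R), id; split => //.
  - move=> q H [mH H0 HP]; rewrite -UE//.
    by apply: eq_integral => w _; rewrite /= mul0mx add0r.
  - by move=> q q' H H' /eqP[]; apply/matrixP => -[].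
pose Th' (tw : 'cV[R]_m * W) : 'M[R]_(m, 1 + n) := row_mx tw.1 (Th tw.2).
pose s' (tw : 'cV[R]_m * W) := s tw.2.
have mms : measurable_fun setT s' by exact: (measurableT_comp ms).
have mTh' : measurable_fun setT Th'.
  apply: measurable_mxP => i j; rewrite /Th'.
  case: (fintype.split_ordP j) => l ->.
    rewrite (_ : (fun _ => _) = (fun tw : 'cV[R]_m * W => tw.1 i 0%R)).
      exact: (measurableT_comp (measurable_mx_coord i 0%R) measurable_fst).
    by apply/funext => tw; rewrite row_mxEl ord1.
  rewrite (_ : (fun _ => _) = (fun tw : 'cV[R]_m * W => Th tw.2 i l)).
    exact: (measurableT_comp (measurable_mx_coord i l) (measurableT_comp mTh measurable_snd)).
  by apply/funext => tw; rewrite row_mxEr.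
have ThE t w (u : 'cV[int]_(1 + n)) : (Th' (t, w) *m intv R u + s' (t, w) =
    (Th w *m intv R (dsubmx u) + s w) + (u 0 0)%:~R *: t)%R.
  rewrite /Th' /s' /= -{1}[u]vsubmxK /intv map_col_mx mul_row_col.
  rewrite -addrA addrC; congr (_ + _)%R.
  rewrite [map_mx _ (usubmx u)]mx11_scalar mul_mx_scalar !mxE.
  by congr ((u _ _)%:~R *: _)%R; exact/val_inj.
have mHT : forall (u : 'cV[int]_(1 + n)) H, periodic H ->
    measurable_fun setT (fun tw => H (Th' tw *m intv R u + s' tw)%R).
  move=> u H [mH _ _]; apply: (measurableT_comp mH); apply: measurable_addmx2 => //.
  apply: measurable_mxP => i j; under eq_fun do rewrite mxE.
  apply: measurable_sum => l; apply: (@measurable_funM _ _ R) => //.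
  exact: (measurableT_comp (measurable_mx_coord i l) mTh').
exists _, ('cV[R]_m * W)%type, (U \x P), Th', s'; split => //.
- move=> p H pH; pose q : 'cV[int]_(1 + n) := p; have [mH H0 HP] := pH.
  rewrite (fubini_tonelli1 (m1 := U) (m2 := P) (fun tw => H (Th' tw *m intv R q + s' tw)%R))//; last exact: mHT.
  rewrite -[RHS](integral_prob_cst U) /fubini_F; apply: eq_integral => t _.
  rewrite -(cube_translate ((q 0 0)%:~R *: t)%R pH).
  rewrite -(IH1 (dsubmx q) _ (periodic_shift ((q 0 0)%:~R *: t)%R pH)).
  by apply: eq_integral => w _; rewrite ThE.
- move=> p p' H H' qq' pH pH'; pose q : 'cV[int]_(1 + n) := p; pose q' : 'cV[int]_(1 + n) := p'.
  rewrite (fubini_tonelli1 (m1 := U) (m2 := P)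
    (fun tw => H (Th' tw *m intv R q + s' tw)%R * H' (Th' tw *m intv R q' + s' tw)%R)); last 2 first.
  + by apply: emeasurable_funM; exact: mHT.
  + by move=> tw; rewrite mule_ge0//; [case: pH|case: pH'].
  rewrite /fubini_F.
  (* If the tails differ, the induction hypothesis gives independence for each fixed new column [t],
     whose only effect is to translate the two functions. *)
  have [qq|qq] := eqVneq (dsubmx q) (dsubmx q'); last first.
    rewrite -[RHS](integral_prob_cst U); apply: eq_integral => t _.
    rewrite -(cube_translate ((q 0 0)%:~R *: t)%R pH) -(cube_translate ((q' 0 0)%:~R *: t)%R pH').
    rewrite -(IH2 _ _ _ _ qq (periodic_shift _ pH) (periodic_shift _ pH')).
    by apply: eq_integral => w _; rewrite !ThE.
  have q0 : (q' 0 0 - q 0 0 != 0)%R.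
    rewrite subr_eq0; apply: contra qq' => /eqP q00; apply/eqP.
    change (q = q'); rewrite -[LHS]vsubmxK -[RHS]vsubmxK qq; congr col_mx.
    by apply/matrixP => i j; rewrite !ord1 !mxE (_ : lshift n 0 = 0)%R//; exact/val_inj.
  set l := (_ - _)%R in q0.
  have lE : (q 0 0 + l = q' 0 0)%R by rewrite /l addrC subrK.
  (* If the tails agree, their common value is uniform for fixed [t]; what remains is the
     correlation of [H] with the translate of [H'] by [l t]. *)
  transitivity (\int[U]_t \int[leb R m]_(x in cube) (H x * H' (l%:~R *: t + x)%R)).
    apply: eq_integral => t _.
    pose G x := H x * H' (x + l%:~R *: t)%R.
    have pG : periodic G by apply: periodicM => //; exact: periodic_shift.
    transitivity (\int[leb R m]_(x in cube) G x); last by apply: eq_integral => x _; rewrite /G addrC.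
    rewrite -(cube_translate ((q 0 0)%:~R *: t)%R pG).
    rewrite -(IH1 (dsubmx q) _ (periodic_shift _ pG)); apply: eq_integral => w _.
    rewrite !ThE /G qq; congr (_ * H' _).
    by rewrite -[RHS]addrA -scalerDl -intrD lE.
  have mHH : measurable_fun setT (fun tx : 'cV[R]_m * 'cV[R]_m => H tx.2 * H' (l%:~R *: tx.1 + tx.2)%R).
    apply: emeasurable_funM; first by apply: measurableT_comp => //; case: pH.
    case: pH' => mH' _ _; apply: (measurableT_comp mH'); apply: measurable_addmx2 => //.
    exact: (measurableT_comp (@measurable_scalemx m _)).
  have H0 tx : 0 <= H tx.2 * H' (l%:~R *: tx.1 + tx.2)%R.
    by case: pH => ? ? ?; case: pH' => ? ? ?; exact: mule_ge0.
  transitivity (\int[U]_t \int[U]_x (H x * H' (l%:~R *: t + x)%R)).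
    apply: eq_integral => t _; rewrite -UE//.
    - apply: emeasurable_funM; first by case: pH.
      rewrite (_ : (fun _ => _) = (fun x => H' (x + l%:~R *: t)%R)).
        exact: (periodic_measurable (periodic_shift _ pH')).
      by apply/funext => x; rewrite addrC.
    - by move=> x; exact: (H0 (t, x)).
  rewrite (fubini_tonelli (m1 := U) (m2 := U)
    (fun tx => H tx.2 * H' (l%:~R *: tx.1 + tx.2)%R))//=.
  have [mH H0' HP] := pH; rewrite -(UE H)// -ge0_integralZr//; last first.
    by apply: integral_ge0 => ? _; case: pH'.
  apply: eq_integral => x _.
  have mHl : measurable_fun setT (fun t : 'cV[R]_m => H' (l%:~R *: t + x)%R).
    exact: (measurableT_comp (periodic_measurable (periodic_shift x pH')) (@measurable_scalemx m _)).
  have H'0 v : 0 <= H' v by case: pH'.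
  rewrite ge0_integralZl// UE//; congr (_ * _).
  rewrite (cube_dilate (periodic_shift x pH'))//.
  exact: cube_translate.
Qed.

End RandomAffine.

(** * Second moments of hitting counts *)

Section Hits.
Variables (R : realType) (k : nat) (B : {fset 'cV[int]_k}).
Local Notation cube := (@cube R _).

(* The number of [p] with [t + p] in [S], provided that [S] is covered by the
   unit cubes with corners in [B]. *)
Definition hits (S : set 'cV[R]_k) (t : 'cV[R]_k) : R :=
  \sum_(p <- B) \1_S (t - intv R (flv t) + intv R p).

Lemma hits_ge0 S t : 0 <= hits S t.
Proof. by apply: sumr_ge0 => p _; rewrite indicE. Qed.

Lemma hits_le S t : hits S t <= #|` B|%:R.
Proof.
rewrite /hits -sum1_size natr_sum; apply: ler_sum => p _.
by rewrite indicE; case: (_ \in _).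
Qed.

Lemma measurable_flv : measurable_fun setT (fun t : 'cV[R]_k => intv R (flv t)).
Proof.
apply: measurable_mxP => i j.
rewrite (_ : (fun _ => _) = (fun x : R => (Num.floor x)%:~R) \o (fun v : 'cV[R]_k => v i j)).
  apply: measurableT_comp; last exact: measurable_mx_coord.
  apply: nondecreasing_measurable => // x y xy.
  by rewrite ler_int; exact: le_floor.
by apply/funext => v; rewrite !mxE.
Qed.

Lemma measurable_hits S : measurable S -> measurable_fun setT (hits S).
Proof.
move=> mS; apply: measurable_sum => p.
apply: (measurableT_comp (f := \1_S : 'cV[R]_k -> R)); first exact: measurable_indic.
apply: (measurableT_comp (@measurable_addmx R k 1 _)).
apply: measurable_addmx2 => //.
rewrite (_ : (fun _ => _) = (fun t => -1 *: intv R (flv t))).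
  by apply: (measurableT_comp (@measurable_scalemx R k _)); exact: measurable_flv.
by apply/funext => t; rewrite scaleN1r.
Qed.

Lemma hits_periodic S v p : hits S (v + intv R p) = hits S v.
Proof.
apply: eq_bigr => r _; congr (\1_S (_ + _)).
by rewrite flvD /intv map_mxD opprD addrACA subrr addr0.
Qed.

Lemma periodic_hits S : measurable S -> periodic (fun t => (hits S t)%:E).
Proof.
move=> mS; split=> [|v|v p]; last by rewrite hits_periodic.
- by apply/measurable_EFinP; exact: measurable_hits.
- by rewrite lee_fin hits_ge0.
Qed.

(** The mean number of points of a uniformly translated integer lattice in [S] is the volume of [S]:
    on the cube [flv t] vanishes, and [leb_unfold] applies. *)
Lemma integral_hits S : measurable S -> (forall v, S v -> flv v \in B) ->
  (\int[leb R k]_(t in cube) (hits S t)%:E = leb R k S)%E.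
Proof.
move=> mS SB.
transitivity (\int[leb R k]_v (\1_S v)%:E)%E; last by rewrite integral_indic// setIT.
rewrite [RHS](@leb_unfold R k B)//; first last.
- move=> v; rewrite indicE; case: (boolP (v \in S)) => [/set_mem Sv _|_]; first exact: SB.
  by rewrite eqxx.
- by apply/measurable_EFinP; exact: measurable_indic.
rewrite -ge0_integral_sum//; first last.
- move=> p; apply/measurable_funTS/measurable_EFinP.
  apply: (measurableT_comp (f := \1_S : 'cV[R]_k -> R)); first exact: measurable_indic.
  exact: measurable_addmx.
- exact: measurable_cube.
apply: eq_integral => t /set_mem tc; rewrite sumEFin; congr EFin.
by apply: eq_bigr => p _; rewrite flv_cube// /intv map_mx0 subr0.
Qed.

End Hits.

Lemma chebyshev_second_moment (R : realType) d (W : measurableType d)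
    (P : probability W R) (N : W -> R) (M K a : R) :
  measurable_fun setT N -> (forall w, 0 <= N w) -> 0 < a ->
  (\int[P]_w (N w)%:E = M%:E)%E ->
  (\int[P]_w ((N w) ^+ 2)%R%:E <= (M ^+ 2 + K)%R%:E)%E ->
  (P [set w | (a <= `|N w - M|)%R] <= (K / a ^+ 2)%R%:E)%E.
Proof.
move=> mN N0 a0 EN EN2.
have M0 : 0 <= M by rewrite -lee_fin -EN; apply: integral_ge0 => w _; rewrite lee_fin.
have mD : measurable_fun setT (fun w => (N w - M) ^+ 2).
  by apply: measurable_funX; apply: measurable_funB.
have mND : measurable_fun setT (fun w => ((N w - M) ^+ 2)%R%:E) by exact/measurable_EFinP.
have mN2 : measurable_fun setT (fun w => (N w ^+ 2)%R%:E).
  by apply/measurable_EFinP; exact: measurable_funX.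
have mA : measurable [set w | a <= `|N w - M|].
  rewrite (_ : [set w | _] = (fun w => `|N w - M|) @^-1` `[a, +oo[%classic).
    apply: measurable_preimageT; last exact: measurable_itv.
    apply: measurableT_comp => //; exact: measurable_funB.
  by apply/seteqP; split => w /=; rewrite in_itv/= andbT.
have var : (\int[P]_w ((N w - M) ^+ 2)%R%:E <= K%:E)%E.
  (* With the term [2 * M * N] moved to the left, all integrands are nonnegative, and additivity
     requires no integrability. *)
  have : (\int[P]_w ((N w - M) ^+ 2)%R%:E + \int[P]_w ((2 * M)%R%:E * (N w)%:E) =
    \int[P]_w ((N w) ^+ 2)%R%:E + \int[P]_w (M ^+ 2)%R%:E)%E.
    rewrite -!ge0_integralD//.
    + apply: eq_integral => w _; rewrite -EFinM -!EFinD; congr EFin; ring.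
    + by move=> w _; rewrite lee_fin sqr_ge0.
    + by move=> w _; rewrite lee_fin sqr_ge0.
    + by move=> w _; rewrite lee_fin sqr_ge0.
    + by move=> w _; rewrite -EFinM lee_fin !mulr_ge0.
    + apply: emeasurable_funM => //; exact/measurable_EFinP.
  rewrite ge0_integralZl// ?lee_fin ?mulr_ge0//; last 2 first.
  - exact/measurable_EFinP.
  - by move=> w _; rewrite lee_fin.
  rewrite EN integral_prob_cst => e.
  have : (\int[P]_w ((N w - M) ^+ 2)%R%:E + (2 * M)%R%:E * M%:E <= (M ^+ 2 + K)%R%:E + (M ^+ 2)%R%:E)%E.
    by rewrite e leeD2r.
  rewrite -EFinM -EFinD -leeBrDr// -EFinB => /le_trans; apply.
  by rewrite lee_fin; lra.
have a20 : 0 < a ^+ 2 by rewrite exprn_gt0.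
rewrite EFinM muleC -lee_pdivrMl// ?invr_gt0// invrK.
apply: le_trans var.
rewrite -[X in (_ * P X)%E]setIT -integral_indic// -ge0_integralZl//; last 2 first.
- by apply/measurable_EFinP; exact: measurable_indic.
- by rewrite lee_fin ltW.
apply: ge0_le_integral => //.
- by move=> w _; rewrite -EFinM lee_fin mulr_ge0// ltW.
- by apply/measurable_EFinP/measurable_funM => //; exact: measurable_indic.
- move=> w _; rewrite -EFinM lee_fin indicE.
  case: (boolP (w \in _)) => [/set_mem/= aw|_]; last by rewrite mulr0 sqr_ge0.
  by rewrite mulr1 -[leRHS]real_normK ?num_real// lerXn2r ?nnegrE// ltW.
Qed.

Section CountMoments.
Variables (R : realType) (m n : nat) (d : measure_display) (W : measurableType d).
Variables (P : probability W R) (Th : W -> 'M[R]_(m, n)) (s : W -> 'cV[R]_m).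
Hypothesis Ths : pairwise_uniform P Th s.
Variables (B : {fset 'cV[int]_m}) (Q : {fset 'cV[int]_n}).
Variables (S : 'cV[int]_n -> set 'cV[R]_m) (c : 'cV[int]_n -> 'cV[R]_m).
Hypothesis mS : forall q, measurable (S q).
Hypothesis SB : forall q v, S q v -> flv v \in B.
Local Notation cube := (@cube R _).

Let X q w := hits B (S q) (Th w *m intv R q + s w + c q).

Definition total_hits w := \sum_(q <- Q) X q w.

(** The integral of [hits] over the cube is at most the size of [B]. *)
Lemma leb_bounded q : leb R m (S q) \is a fin_num.
Proof.
rewrite ge0_fin_numE// -(@integral_hits R m B)//; last exact: SB.
apply: (@le_lt_trans _ _ (\int[leb R m]_(t in cube) (cst (#|` B|%:R%:E) t))%E).
  apply: ge0_le_integral => //.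
  - exact: measurable_cube.
  - by move=> t _; rewrite lee_fin hits_ge0.
  - by apply/measurable_EFinP/measurable_funTS; exact: measurable_hits.
  - by move=> t _; rewrite lee_fin hits_le.
rewrite integral_cst; last exact: measurable_cube.
by rewrite [X in (_ * X)%E](@leb_cube R m) mule1 ltry.
Qed.

Definition mean_hits := \sum_(q <- Q) fine (leb R m (S q)).

Let pX q : periodic (fun t => (hits B (S q) (t + c q))%:E).
Proof. exact: (periodic_shift (c q) (periodic_hits B (mS q))). Qed.

Let IX q : (\int[leb R m]_(t in cube) (hits B (S q) (t + c q))%:E =
  (fine (leb R m (S q)))%:E)%E.
Proof.
rewrite (cube_translate (c q) (periodic_hits B (mS q))) integral_hits//; last exact: SB.
by rewrite fineK ?leb_bounded.
Qed.

Let X0 q w : 0 <= X q w. Proof. exact: hits_ge0. Qed.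

Let mX q : measurable_fun setT (X q).
Proof.
case: Ths => mTh ms _ _; apply: (measurableT_comp (measurable_hits B (mS q))).
apply: (measurableT_comp (@measurable_addmx R m 1 (c q))).
apply: measurable_addmx2 => //.
apply: measurable_mxP => i j; under eq_fun do rewrite mxE.
apply: measurable_sum => l; apply: (@measurable_funM _ _ R) => //.
exact: (measurableT_comp (measurable_mx_coord i l) mTh).
Qed.

Lemma measurable_total_hits : measurable_fun setT total_hits.
Proof. by apply: measurable_sum => q; exact: mX. Qed.

Lemma total_hits_ge0 w : 0 <= total_hits w.
Proof. by apply: sumr_ge0 => q _; exact: X0. Qed.

Let EX q : (\int[P]_w (X q w)%:E = (fine (leb R m (S q)))%:E)%E.
Proof. by rewrite -IX; case: Ths => _ _ E1 _; rewrite -(E1 q _ (pX q)). Qed.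

(** On the diagonal, [X q] is at most the size of [B], so its square is at most that multiple of
    [X q]. Off the diagonal, pairwise independence factors the mean. *)
Let EXX q q' : (\int[P]_w (X q w * X q' w)%:E <=
  (fine (leb R m (S q)) * fine (leb R m (S q'))
   + (q == q')%:R * (#|` B|%:R * fine (leb R m (S q))))%:E)%E.
Proof.
have [->|qq'] := eqVneq q q'.
  rewrite mul1r; apply: (@le_trans _ _ (#|` B|%:R * fine (leb R m (S q')))%:E).
    rewrite EFinM -EX -ge0_integralZl//; last 2 first.
    - by apply/measurable_EFinP; exact: mX.
    - by move=> w _; rewrite lee_fin X0.
    apply: ge0_le_integral => //.
    - by move=> w _; rewrite lee_fin mulr_ge0.
    - by apply/measurable_EFinP/measurable_funM; exact: mX.
    - apply/measurable_EFinP; apply: measurable_funM => //; exact: mX.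
    - by move=> w _; rewrite -EFinM lee_fin ler_wpM2r// hits_le.
  by rewrite lee_fin lerDr mulr_ge0// fine_ge0.
rewrite mul0r addr0 EFinM -!IX; case: Ths => _ _ _ E2.
by rewrite -(E2 _ _ _ _ qq' (pX q) (pX q')).
Qed.

(** Only the diagonal pairs push the second moment above the square of the mean, so the variance is
    at most the size of [B] times the mean. *)
Lemma total_hits_deviation a : 0 < a ->
  (P [set w | (a <= `|total_hits w - mean_hits|)%R] <=
   (#|` B|%:R * mean_hits / a ^+ 2)%:E)%E.
Proof.
move=> a0; apply: chebyshev_second_moment => //.
- exact: measurable_total_hits.
- exact: total_hits_ge0.
- rewrite /total_hits /mean_hits.
  under eq_integral do rewrite -sumEFin.
  rewrite ge0_integral_sum//; first by rewrite -sumEFin; apply: eq_bigr => q _; rewrite EX.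
  + by move=> q; apply/measurable_EFinP; exact: mX.
  + by move=> q w _; rewrite lee_fin X0.
- rewrite [leLHS](_ : _ = \int[P]_w \sum_(q <- Q) \sum_(q' <- Q) (X q w * X q' w)%:E)%E; last first.
    apply: eq_integral => w _; rewrite /total_hits expr2 big_distrlr/= -sumEFin.
    by apply: eq_bigr => q _; rewrite -sumEFin.
  have mXX q q' : measurable_fun setT (fun w => (X q w * X q' w)%:E).
    by apply/measurable_EFinP/measurable_funM; exact: mX.
  rewrite ge0_integral_sum//; last 2 first.
  + by move=> q; apply: emeasurable_sum => q'.
  + by move=> q w _; apply: sume_ge0 => q' _; rewrite lee_fin mulr_ge0.
  apply: (@le_trans _ _ (\sum_(q <- Q) \sum_(q' <- Q) (fine (leb R m (S q)) * fine (leb R m (S q'))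
   + (q == q')%:R * (#|` B|%:R * fine (leb R m (S q))))%:E)%E).
    apply: lee_sum => q _; rewrite ge0_integral_sum//; last first.
      by move=> q' w _; rewrite lee_fin mulr_ge0.
    by apply: lee_sum => q' _; exact: EXX.
  under eq_bigr do rewrite sumEFin.
  rewrite sumEFin lee_fin.
  under eq_bigr do rewrite big_split/=.
  rewrite big_split/= expr2 [mean_hits * mean_hits]big_distrlr/= lerD2l.
  rewrite [leRHS]mulr_sumr [leRHS]big_seq [leLHS]big_seq; apply: ler_sum => q qQ.
  rewrite (big_fsetD1 q)//= eqxx mul1r big_seq_cond big1 ?addr0//.
  by move=> q'; rewrite in_fsetD1 eq_sym => /andP[/andP[/negbTE -> _] _]; rewrite mul0r.
Qed.

End CountMoments.

(** * Euclidean balls and shells *)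

Section EuclideanNorm.
Variable R : realType.
Implicit Type k : nat.

Lemma enorm_ge0 k (v : 'cV[R]_k) : 0 <= enorm v.
Proof. exact: sqrtr_ge0. Qed.

Lemma sqr_enorm k (v : 'cV[R]_k) : enorm v ^+ 2 = \sum_i v i 0 ^+ 2.
Proof. by rewrite sqr_sqrtr//; apply: sumr_ge0 => i _; exact: sqr_ge0. Qed.

Lemma enorm0 k : enorm (0 : 'cV[R]_k) = 0.
Proof. by rewrite /enorm big1 ?sqrtr0// => i _; rewrite mxE expr0n. Qed.

Lemma enormZ k (a : R) (v : 'cV[R]_k) : enorm (a *: v) = `|a| * enorm v.
Proof.
rewrite /enorm -sqrtr_sqr -sqrtrM ?sqr_ge0//; congr Num.sqrt.
by rewrite mulr_sumr; apply: eq_bigr => i _; rewrite mxE exprMn.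
Qed.

Lemma enormN k (v : 'cV[R]_k) : enorm (- v) = enorm v.
Proof. by rewrite -scaleN1r enormZ normrN1 mul1r. Qed.

Lemma cauchy_schwarz k (u v : 'cV[R]_k) :
  \sum_i u i 0 * v i 0 <= enorm u * enorm v.
Proof.
have [v0|v0] := eqVneq (enorm v) 0.
  rewrite v0 mulr0 big1// => i _.
  have : \sum_i v i 0 ^+ 2 == 0 by rewrite -sqr_enorm v0 expr0n.
  rewrite psumr_eq0 => [/allP/(_ i)|j _]; last exact: sqr_ge0.
  by rewrite mem_index_enum sqrf_eq0 => /(_ isT)/= /eqP ->; rewrite mulr0.
have vp : 0 < enorm v by rewrite lt_neqAle eq_sym v0 enorm_ge0.
have [u0|u0] := eqVneq (enorm u) 0.
  rewrite u0 mul0r big1// => i _.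
  have : \sum_i u i 0 ^+ 2 == 0 by rewrite -sqr_enorm u0 expr0n.
  rewrite psumr_eq0 => [/allP/(_ i)|j _]; last exact: sqr_ge0.
  by rewrite mem_index_enum sqrf_eq0 => /(_ isT)/= /eqP ->; rewrite mul0r.
have up : 0 < enorm u by rewrite lt_neqAle eq_sym u0 enorm_ge0.
(* This sum of squares equals [2 |u| |v| (|u| |v| - s)] with [s] the scalar product. *)
have : 0 <= \sum_i (enorm v * u i 0 - enorm u * v i 0) ^+ 2.
  by apply: sumr_ge0 => i _; exact: sqr_ge0.
have -> : \sum_i (enorm v * u i 0 - enorm u * v i 0) ^+ 2 =
    enorm v ^+ 2 * (\sum_i u i 0 ^+ 2) + enorm u ^+ 2 * (\sum_i v i 0 ^+ 2)
    - 2 * (enorm u * enorm v) * \sum_i u i 0 * v i 0.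
  rewrite !mulr_sumr -big_split -sumrB/=; apply: eq_bigr => i _; ring.
rewrite -!sqr_enorm; set s := \sum_i _ => h.
have : 0 <= 2 * (enorm u * enorm v) * (enorm u * enorm v - s).
  by apply: (le_trans h); rewrite le_eqVlt; apply/orP; left; apply/eqP; ring.
by rewrite pmulr_rge0 ?subr_ge0// !mulr_gt0.
Qed.

Lemma enormD k (u v : 'cV[R]_k) : enorm (u + v) <= enorm u + enorm v.
Proof.
rewrite -(ler_pXn2r (n := 2))// ?nnegrE ?addr_ge0 ?enorm_ge0// sqr_enorm.
rewrite (eq_bigr (fun i => u i 0 ^+ 2 + v i 0 ^+ 2 + 2 * (u i 0 * v i 0))); last first.
  by move=> i _; rewrite mxE; ring.
rewrite !big_split/= -!sqr_enorm -mulr_sumr.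
by have := cauchy_schwarz u v; lra.
Qed.

Lemma enormB_le k (u v : 'cV[R]_k) : enorm u - enorm v <= enorm (u + v).
Proof.
by rewrite lerBlDr -[X in _ + X](enormN v) (le_trans _ (enormD _ _))// addrK.
Qed.

Lemma coord_le_enorm k (v : 'cV[R]_k) i : `|v i 0| <= enorm v.
Proof.
rewrite -sqrtr_sqr ler_sqrt; last by apply: sumr_ge0 => j _; exact: sqr_ge0.
by rewrite (bigD1 i)//= lerDl sumr_ge0// => j _; exact: sqr_ge0.
Qed.

Lemma enorm_le_sum k (v : 'cV[R]_k) : enorm v <= \sum_i `|v i 0|.
Proof.
rewrite -(ler_pXn2r (n := 2))// ?nnegrE ?enorm_ge0 ?sumr_ge0//.
rewrite sqr_enorm expr2 mulr_suml; apply: ler_sum => i _.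
rewrite -[leLHS]real_normK ?num_real// expr2 ler_wpM2l//.
by rewrite (bigD1 i)//= lerDl sumr_ge0.
Qed.

(** A crude operator norm, by [enorm_mulmx]; its exact size never matters. *)
Definition entry_sum p q (M : 'M[R]_(p, q)) := \sum_i \sum_j `|M i j|.

Lemma entry_sum_ge0 p q (M : 'M[R]_(p, q)) : 0 <= entry_sum M.
Proof. by apply: sumr_ge0 => i _; exact: sumr_ge0. Qed.

Lemma enorm_mulmx p q (M : 'M[R]_(p, q)) v :
  enorm (M *m v) <= entry_sum M * enorm v.
Proof.
apply: (le_trans (enorm_le_sum _)); rewrite mulr_suml; apply: ler_sum => i _.
rewrite mxE (le_trans (ler_norm_sum _ _ _))// mulr_suml; apply: ler_sum => j _.
by rewrite normrM ler_wpM2l// coord_le_enorm.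
Qed.

Lemma measurable_enorm k : measurable_fun setT (@enorm R k).
Proof.
apply: measurableT_comp; first by apply: continuous_measurable_fun; exact: sqrt_continuous.
apply: measurable_sum => i; apply: measurable_funX; exact: measurable_mx_coord.
Qed.

Lemma measurable_enorm_affine p q (M : 'M[R]_(p, q)) c :
  measurable_fun setT (fun v : 'cV[R]_q => enorm (M *m v + c)).
Proof. exact: (measurableT_comp (@measurable_enorm p) (measurable_mulmxD M c)). Qed.

End EuclideanNorm.

Section BallVolume.
Variable R : realType.
Implicit Type k : nat.

Lemma measurable_enorm_le p q (M : 'M[R]_(p, q)) c r :
  measurable [set v : 'cV[R]_q | enorm (M *m v + c) <= r].
Proof.
rewrite (_ : [set v | _] = (fun v => enorm (M *m v + c)) @^-1` `]-oo, r]%classic).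
  by apply: measurable_preimageT; [exact: measurable_enorm_affine|exact: measurable_itv].
by apply/seteqP; split => v /=; rewrite in_itv.
Qed.

Lemma measurable_enorm_lt p q (M : 'M[R]_(p, q)) c r :
  measurable [set v : 'cV[R]_q | enorm (M *m v + c) < r].
Proof.
rewrite (_ : [set v | _] = (fun v => enorm (M *m v + c)) @^-1` `]-oo, r[%classic).
  by apply: measurable_preimageT; [exact: measurable_enorm_affine|exact: measurable_itv].
by apply/seteqP; split => v /=; rewrite in_itv.
Qed.

Lemma measurable_ball_le k r : measurable [set v : 'cV[R]_k | enorm v <= r].
Proof.
have := @measurable_enorm_le k k 1%:M 0 r; congr measurable.
by apply/seteqP; split => v /=; rewrite mul1mx addr0.
Qed.

Lemma measurable_ball_lt k r : measurable [set v : 'cV[R]_k | enorm v < r].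
Proof.
have := @measurable_enorm_lt k k 1%:M 0 r; congr measurable.
by apply/seteqP; split => v /=; rewrite mul1mx addr0.
Qed.

Lemma leb_affine k (M : 'M[R]_k) c (A : set 'cV[R]_k) : \det M != 0 ->
  measurable A -> leb R k [set v | A (M *m v + c)] = (`|\det M|^-1%:E * leb R k A)%E.
Proof.
move=> dM mA; rewrite -(leb_translate c mA) -leb_mulmx//.
exact: (measurable_preimageT (@measurable_addmx R k 1 c) mA).
Qed.

Lemma leb_ball_fin_num k : leb R k [set v | enorm v <= 1] \is a fin_num.
Proof.
rewrite ge0_fin_numE//.
have d4 : \det ((4%:R^-1)%:M : 'M[R]_k) != 0.
  by rewrite det_scalar expf_neq0// invr_neq0// pnatr_eq0.
(* The map [v / 4 + 1/2] takes the unit ball into the cube, as coordinates end up between 1/4 and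
   3/4. *)
apply: (@le_lt_trans _ _ (leb R k [set v | @cube R k ((4%:R^-1)%:M *m v + const_mx 2%:R^-1)%R])).
  apply: le_measure; rewrite ?inE.
  - exact: measurable_ball_le.
  - exact: (measurable_preimageT (measurable_mulmxD _ _) (@measurable_cube R k)).
  - move=> v /= v1 i; rewrite mul_scalar_mx !mxE.
    have := le_trans (coord_le_enorm v i) v1; rewrite ler_norml => /andP[h1 h2].
    by apply/andP; split; lra.
rewrite leb_affine//; last exact: measurable_cube.
by rewrite leb_cube mule1 ltry.
Qed.

Lemma leb_unit_ball k : leb R k [set v | enorm v <= 1] = (ball_volume R k)%:E.
Proof.
rewrite /ball_volume -lebE ?fineK//; first exact: leb_ball_fin_num.
exact: measurable_ball_le.
Qed.

Lemma leb_ball k (M : 'M[R]_k) c r : \det M != 0 -> 0 < r ->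
  leb R k [set v | enorm (M *m v + c) <= r] =
  (r ^+ k * ball_volume R k / `|\det M|)%:E.
Proof.
move=> dM r0.
rewrite (_ : [set v | _] = [set v | [set v | enorm v <= 1] (r^-1 *: M *m v + r^-1 *: c)]).
  rewrite leb_affine//.
  - rewrite leb_unit_ball -EFinM detZ normrM invfM exprVn normfV invrK normrX (gtr0_norm r0).
    by congr EFin; rewrite mulrAC.
  - by rewrite detZ mulf_neq0// expf_neq0// invr_neq0// gt_eqF.
  - exact: measurable_ball_le.
apply/seteqP; split => v /=; rewrite -scalemxAl -scalerDr enormZ gtr0_norm ?invr_gt0//;
  by rewrite -ler_pdivlMl ?invr_gt0// invrK mulr1.
Qed.

Lemma ball_volume_ge0 k : 0 <= ball_volume R k.
Proof. by rewrite -lee_fin -leb_unit_ball. Qed.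

(** The open ball contains the closed balls of smaller radii [s], whose volumes tend to that of the
    closed ball of radius [r] as [s] increases to [r]. *)
Lemma leb_open_ball k (M : 'M[R]_k) c r : \det M != 0 -> 0 < r ->
  leb R k [set v | enorm (M *m v + c) < r] =
  (r ^+ k * ball_volume R k / `|\det M|)%:E.
Proof.
move=> dM r0.
have le_open s : 0 < s -> s < r ->
    ((s ^+ k * ball_volume R k / `|\det M|)%R%:E <= leb R k [set v | (enorm (M *m v + c) < r)%R])%E.
  move=> s0 sr; rewrite -(leb_ball c dM s0); apply: le_measure; rewrite ?inE.
  - exact: measurable_enorm_le.
  - exact: measurable_enorm_lt.
  - by move=> v /= /le_lt_trans; apply.
have open_le : (leb R k [set v | (enorm (M *m v + c) < r)%R] <=
    (r ^+ k * ball_volume R k / `|\det M|)%R%:E)%E.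
  rewrite -(leb_ball c dM r0); apply: le_measure; rewrite ?inE.
  - exact: measurable_enorm_lt.
  - exact: measurable_enorm_le.
  - by move=> v /= /ltW.
apply/eqP; rewrite eq_le open_le/=.
have [x xE] : exists x : R, leb R k [set v | enorm (M *m v + c) < r] = x%:E.
  by exists (fine (leb R k [set v | enorm (M *m v + c) < r]));
    rewrite fineK// ge0_fin_numE// (le_lt_trans open_le)// ltry.
rewrite xE lee_fin.
have cv : (s ^+ k * ball_volume R k / `|\det M|) @[s --> r^'-] -->
    r ^+ k * ball_volume R k / `|\det M|.
  apply: cvg_at_left_filter; apply: cvgMl; apply: cvgMl; exact: exprn_continuous.
rewrite -(cvg_lim _ cv)//; apply: limr_le; first exact: cvgP cv.
near=> s.
have := @le_open s; rewrite xE lee_fin; apply.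
- near: s; exact: nbhs_left_gt.
- near: s; exact: nbhs_left_lt.
Unshelve. all: by end_near. Qed.

Lemma ball_volume_gt0 k : 0 < ball_volume R k.
Proof.
rewrite lt_neqAle ball_volume_ge0 andbT eq_sym; apply/negP => /eqP V0.
(* The unit cube lies in a ball of radius [k + 1], so balls of volume zero would give the cube
   volume zero. *)
have : (leb R k (@cube R k) <= leb R k [set v | (enorm (1%:M *m v + 0) <= k.+1%:R)%R])%E.
  apply: le_measure; rewrite ?inE.
  - exact: measurable_cube.
  - exact: measurable_enorm_le.
  - move=> v vc /=; rewrite mul1mx addr0 (le_trans (enorm_le_sum v))//.
    apply: (@le_trans _ _ (\sum_(i < k) 1)).
      apply: ler_sum => i _; have /andP[h1 h2] := vc i.
      by rewrite ger0_norm// ltW.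
    by rewrite sumr_const card_ord ler_nat.
by rewrite leb_cube leb_ball ?det1 ?oner_neq0// V0 mulr0 mul0r lee_fin ler10.
Qed.

End BallVolume.

Section LatticeShells.
Variable R : realType.

Lemma enorm_le_affine k (M : 'M[R]_k) (c : 'cV[R]_k) v : \det M != 0 ->
  enorm v <= entry_sum (invmx M) * (enorm (M *m v + c) + enorm c).
Proof.
move=> dM.
have Mu : M \in unitmx by rewrite unitmxE unitfE.
rewrite -{1}[v](mulKmx Mu); apply: (le_trans (enorm_mulmx _ _)).
apply: ler_wpM2l; first exact: entry_sum_ge0.
by rewrite -{1}[M *m v](addrK c) (le_trans (enormD _ _))// enormN.
Qed.

Lemma finite_cover k (r : R) : exists Q : {fset 'cV[int]_k},
  forall v : 'cV[R]_k, enorm v <= r -> flv v \in Q.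
Proof.
pose a := Num.floor (- r); pose w := `|Num.floor r - a|%N.
exists (fset_set [set p : 'cV[int]_k | forall i, (const_mx a : 'cV[int]_k) i 0 <= p i 0 <=
  (const_mx a : 'cV[int]_k) i 0 + w%:Z]).
move=> v vr; rewrite in_fset_set; last exact: finite_int_box.
apply/mem_set => i /=; rewrite !mxE.
have := le_trans (coord_le_enorm v i) vr; rewrite ler_norml => /andP[h1 h2].
rewrite le_floor//= -lerBlDl /w (le_trans _ (ler_norm _))// ?lerB// ?le_floor//.
Qed.

Lemma finite_cover_affine k (M : 'M[R]_k) (c : 'cV[R]_k) (r : R) : \det M != 0 ->
  exists Q : {fset 'cV[int]_k}, forall v, enorm (M *m v + c) <= r -> flv v \in Q.
Proof.
move=> dM; have [Q QP] := @finite_cover k (entry_sum (invmx M) * (r + enorm c)).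
exists Q => v vr; apply: QP; apply: (le_trans (enorm_le_affine c v dM)).
by apply: ler_wpM2l; [exact: entry_sum_ge0|rewrite lerD2r].
Qed.

Lemma enorm_cube k (t : 'cV[R]_k) : cube t -> enorm t <= k%:R.
Proof.
move=> tc; apply: (le_trans (enorm_le_sum t)).
apply: (@le_trans _ _ (\sum_(i < k) 1)); last by rewrite sumr_const card_ord.
apply: ler_sum => i _; have /andP[h1 h2] := tc i.
by rewrite ger0_norm// ltW.
Qed.

Variables (n : nat) (D : 'M[R]_n) (w : 'cV[R]_n).
Hypothesis dD : \det D != 0.

Definition shell a b : set 'cV[R]_n := [set v | a <= enorm (D *m v + w) < b].

Lemma measurable_shell a b : measurable (shell a b).
Proof.
rewrite (_ : shell a b = (fun v => enorm (D *m v + w)) @^-1` `[a, b[%classic).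
  by apply: measurable_preimageT; [exact: measurable_enorm_affine|exact: measurable_itv].
by apply/seteqP; split => v /=; rewrite in_itv.
Qed.

Lemma leb_shell a b : 0 < a -> a <= b ->
  leb R n (shell a b) = ((b ^+ n - a ^+ n) * ball_volume R n / `|\det D|)%:E.
Proof.
move=> a0 ab; have b0 := lt_le_trans a0 ab.
rewrite (_ : shell a b = [set v | enorm (D *m v + w) < b] `\` [set v | enorm (D *m v + w) < a]).
  rewrite measureD//; [|exact: measurable_enorm_lt|exact: measurable_enorm_lt|].
    rewrite setIidr; last by move=> v /= /lt_le_trans; apply.
    by rewrite [X in (X - _)%E]leb_open_ball// [X in (_ - X)%E]leb_open_ball// -EFinB !mulrBl.
  by rewrite [X in (X < _)%E]leb_open_ball// ltry.
apply/seteqP; split => v /=; first by move=> /andP[h1 h2]; split => //; apply/negP; rewrite -leNgt.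
by move=> [h1 /negP]; rewrite -leNgt => h2; apply/andP.
Qed.

(** Bounds [|D t|] for [t] in the unit cube, hence the change of [|D v + w|] between the corner of
    an integral cell and its other points. *)
Definition cell_diam := entry_sum D * n%:R.

Lemma cell_diam_ge0 : 0 <= cell_diam.
Proof. by rewrite mulr_ge0// entry_sum_ge0. Qed.

Definition shell_count (Q : {fset 'cV[int]_n}) a b : R :=
  \sum_(q <- Q) \1_(shell a b) (intv R q).

Let near_cell t q : cube t -> `|enorm (D *m (t + intv R q) + w) - enorm (D *m intv R q + w)| <= cell_diam.
Proof.
move=> tc; have h : enorm (D *m t) <= cell_diam.
  apply: (le_trans (enorm_mulmx _ _)); apply: ler_wpM2l; first exact: entry_sum_ge0.
  exact: enorm_cube.
rewrite mulmxDr -addrA; set y := _ + w.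
have h1 := enormD (D *m t) y.
have := enormB_le y (D *m t); rewrite [y + _]addrC => h2.
by rewrite ler_norml; apply/andP; split; lra.
Qed.

(** The argument of Gauss for lattice points: the cells whose corners are counted are disjoint and
    lie in the shell thickened by [cell_diam]. *)
Lemma shell_count_le (Q : {fset 'cV[int]_n}) a b : cell_diam < a -> a <= b ->
  (forall v, enorm (D *m v + w) <= b + cell_diam -> flv v \in Q) ->
  shell_count Q a b <=
  ((b + cell_diam) ^+ n - (a - cell_diam) ^+ n) * ball_volume R n / `|\det D|.
Proof.
move=> ka ab QP; rewrite -lee_fin -leb_shell; [|lra|have := cell_diam_ge0; lra].
rewrite -(@integral_hits R n Q); [|exact: measurable_shell|]; last first.
  by move=> v /andP[_ /ltW]; exact: QP.
(* The count is its own integral over the cube of volume 1, where it is compared with [hits]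
   pointwise. *)
rewrite -[leLHS]mule1 -(@leb_cube R n) -integral_cst; last exact: measurable_cube.
apply: ge0_le_integral => //.
- exact: measurable_cube.
- by move=> t _; rewrite lee_fin; apply: sumr_ge0 => q _; rewrite indicE.
- apply/measurable_EFinP/measurable_funTS; apply: measurable_hits; exact: measurable_shell.
- move=> t tc; rewrite lee_fin; apply: ler_sum => q _.
  rewrite flv_cube// /intv map_mx0 subr0 -/(intv R q) !indicE.
  case: (boolP (intv R q \in _)) => // /set_mem/= /andP[h1 h2].
  rewrite mem_set//=; have := near_cell q tc.
  by rewrite ler_norml => /andP[h3 h4]; apply/andP; split; lra.
Qed.

(** Conversely, the cells whose corners are counted cover the shell thinned by [cell_diam]. *)
Lemma shell_count_ge (Q : {fset 'cV[int]_n}) a b : 0 < a ->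
  a + cell_diam <= b - cell_diam ->
  (forall v, enorm (D *m v + w) <= b -> flv v \in Q) ->
  ((b - cell_diam) ^+ n - (a + cell_diam) ^+ n) * ball_volume R n / `|\det D|
  <= shell_count Q a b.
Proof.
move=> a0 ab QP; have k0 := cell_diam_ge0.
rewrite -lee_fin -leb_shell//; last lra.
rewrite -(@integral_hits R n Q); [|exact: measurable_shell|]; last first.
  by move=> v /andP[_ h]; apply: QP; lra.
rewrite -[leRHS]mule1 -(@leb_cube R n) -integral_cst; last exact: measurable_cube.
apply: ge0_le_integral => //.
- exact: measurable_cube.
- by move=> t _; rewrite lee_fin hits_ge0.
- apply/measurable_EFinP/measurable_funTS; apply: measurable_hits; exact: measurable_shell.
- move=> t tc; rewrite lee_fin; apply: ler_sum => q _.
  rewrite flv_cube// /intv map_mx0 subr0 -/(intv R q) !indicE.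
  case: (boolP (t + intv R q \in _)) => // /set_mem/= /andP[h1 h2].
  rewrite mem_set//=; have := near_cell q tc.
  by rewrite ler_norml => /andP[h3 h4]; apply/andP; split; lra.
Qed.

End LatticeShells.

(** * Sections of the cusp region and their mean volume *)

Lemma positive_root (R : realType) (a : R) m : (0 < m)%N -> 0 < a ->
  exists2 x : R, 0 < x & x ^+ m = a.
Proof.
move=> m0 a0; exists (a `^ (m%:R^-1)); first exact: powR_gt0.
by rewrite -powR_mulrn ?powR_ge0// -powRrM mulVf ?powRr1 ?ltW// pnatr_eq0 -lt0n.
Qed.

(** Avoids roots: either [x <= 1] or [x <= x ^+ m]. Only boundedness is at stake wherever this is
    applied. *)
Lemma exp_lt_bound (R : realType) (x a : R) m : (0 < m)%N -> 0 <= x ->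
  x ^+ m < a -> x <= 1 + a.
Proof.
move=> m0 x0 xa; have a0 : 0 < a by apply: le_lt_trans xa; exact: exprn_ge0.
have [x1|x1] := leP x 1; first by lra.
have : x <= x ^+ m by rewrite -[leLHS]expr1 ler_weXn2l// ltW.
lra.
Qed.

Section CuspSections.
Variables (R : realType) (m n : nat).
Hypothesis m0 : (0 < m)%N.
Variables (A : 'M[R]_m) (C : 'M[R]_(n, m)) (D : 'M[R]_n) (w : 'cV[R]_n) (c r : R).
Hypotheses (dA : \det A != 0) (dD : \det D != 0) (c0 : 0 < c) (r0 : 0 < r).

(* The section over [q] of the preimage of
   [{(x, y) : |x|^m |y|^n < c, r < |y| < T}] under
   [(z, q) |-> (A z, C z + D q + w)]. *)
Definition cusp_section T (q : 'cV[int]_n) : set 'cV[R]_m :=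
  [set z | enorm (A *m z) ^+ m * enorm (C *m z + (D *m intv R q + w)) ^+ n < c
    /\ r < enorm (C *m z + (D *m intv R q + w)) < T].

Lemma measurable_cusp_section T q : measurable (cusp_section T q).
Proof.
pose f (z : 'cV[R]_m) := enorm (A *m z) ^+ m * enorm (C *m z + (D *m intv R q + w)) ^+ n.
pose g (z : 'cV[R]_m) := enorm (C *m z + (D *m intv R q + w)).
have mg : measurable_fun setT g by exact: measurable_enorm_affine.
have mf : measurable_fun setT f.
  apply: measurable_funM; apply: measurable_funX => //.
  exact: (measurableT_comp (@measurable_enorm R m) (@measurable_mulmx R _ _ _ A)).
rewrite (_ : cusp_section T q = (f @^-1` `]-oo, c[%classic) `&` (g @^-1` `]r, T[%classic)).
  by apply: measurableI; apply: measurable_preimageT => //; exact: measurable_itv.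
by apply/seteqP; split => z /=; rewrite !in_itv.
Qed.

(** On [|A z| <= rho] this bounds [|C z|], the distance from the true second component
    [C z + (D q + w)] to the value [D q + w] given by the index alone. *)
Definition shear_bound rho := entry_sum C * (entry_sum (invmx A) * rho).

Lemma enorm_shear rho z : enorm (A *m z) <= rho -> enorm (C *m z) <= shear_bound rho.
Proof.
move=> h; apply: (le_trans (enorm_mulmx _ _)); apply: ler_wpM2l.
  exact: entry_sum_ge0.
have := enorm_le_affine 0 z dA; rewrite addr0 enorm0 addr0 => /le_trans; apply.
by apply: ler_wpM2l => //; exact: entry_sum_ge0.
Qed.

Lemma shear_bound_ge0 rho : 0 <= rho -> 0 <= shear_bound rho.
Proof. by move=> h; rewrite !mulr_ge0// entry_sum_ge0. Qed.

Lemma cusp_section_bound T q z : cusp_section T q z ->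
  enorm (A *m z) <= 1 + c / r ^+ n.
Proof.
move=> [h /andP[h1 _]]; apply: (exp_lt_bound m0 (enorm_ge0 _)).
rewrite ltr_pdivlMr ?exprn_gt0//; apply: le_lt_trans h.
rewrite ler_wpM2l ?exprn_ge0 ?enorm_ge0// lerXn2r ?nnegrE ?enorm_ge0 ?ltW//.
Qed.

(** Since [|y| > r] forces [|x|^m < c / r^n], one bound serves all [T] and [q]. The size of [B] is
    the constant between variance and mean, so this uniformity is essential. *)
Lemma cusp_section_cover : exists B : {fset 'cV[int]_m},
  forall T q z, cusp_section T q z -> flv z \in B.
Proof.
have [B BP] := finite_cover_affine 0 (1 + c / r ^+ n) dA; exists B => T q z h.
by apply: BP; rewrite addr0; exact: (cusp_section_bound h).
Qed.

(** The bound with [c / r ^+ n] captures every [q] with a nonempty section; the one with [c],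
    together with [cell_diam], leaves the room that the shell counts ask for. *)
Definition index_bound T := T + (shear_bound (1 + c) + shear_bound (1 + c / r ^+ n)) + cell_diam D.

Definition index_cover (Q : {fset 'cV[int]_n}) T :=
  forall v, enorm (D *m v + w) <= index_bound T -> flv v \in Q.

Lemma index_coverP T : exists Q, index_cover Q T.
Proof. exact: (finite_cover_affine w (index_bound T) dD). Qed.

Lemma index_coverW Q T T' : T <= T' -> index_cover Q T' -> index_cover Q T.
Proof. by move=> TT QT v h; apply: QT; apply: (le_trans h); rewrite !lerD2r. Qed.

Lemma index_cover_section Q T q z : index_cover Q T -> cusp_section T q z -> q \in Q.
Proof.
move=> QT h.
have -> : q = flv (intv R q) by rewrite -[intv R q]add0r flvD flv_cube ?add0r// => i; rewrite mxE lexx ltr01.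
apply: QT; have := enorm_shear (cusp_section_bound h); move: h => [_ /andP[_ h1]] h2.
have h3 : 0 <= shear_bound (1 + c) by apply: shear_bound_ge0; rewrite addr_ge0// ltW.
have h4 := cell_diam_ge0 D.
have := enormB_le (D *m intv R q + w) (C *m z); rewrite [_ + w + _]addrC.
rewrite /index_bound; lra.
Qed.

Definition index_set T : {fset 'cV[int]_n} := projT1 (cid (index_coverP T)).

Definition cusp_mean T := mean_hits (index_set T) (cusp_section T).

(** Indices outside a cover have empty sections, so the choice of cover is immaterial; the means at
    two times can then be compared over one common set. *)
Lemma cusp_mean_cover Q T : index_cover Q T ->
  cusp_mean T = mean_hits Q (cusp_section T).
Proof.
move=> QT; rewrite /cusp_mean /mean_hits.
have out Q' q : index_cover Q' T -> q \notin Q' -> fine (leb R m (cusp_section T q)) = 0.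
  move=> Q'T qQ; rewrite (_ : cusp_section T q = set0) ?measure0//.
  by apply/seteqP; split => z //= /(index_cover_section Q'T); rewrite (negbTE qQ).
have QU Q' Q'' : index_cover Q' T ->
    \sum_(q <- Q') fine (leb R m (cusp_section T q)) =
    \sum_(q <- (Q' `|` Q'')%fset) fine (leb R m (cusp_section T q)).
  move=> Q'T; apply: big_fset_incl; first exact: fsubsetUl.
  by move=> q _; exact: out.
by rewrite (QU _ Q (projT2 (cid (index_coverP T)))) (QU _ (index_set T) QT) fsetUC.
Qed.

Definition cusp_shell T T' (q : 'cV[int]_n) : set 'cV[R]_m :=
  [set z | enorm (A *m z) ^+ m * enorm (C *m z + (D *m intv R q + w)) ^+ n < c
    /\ T <= enorm (C *m z + (D *m intv R q + w)) < T'].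

Lemma leb_cusp_section_fin T q : leb R m (cusp_section T q) \is a fin_num.
Proof.
have [B BP] := cusp_section_cover.
exact: (leb_bounded (measurable_cusp_section T) (BP T)).
Qed.

Lemma cusp_sectionD T T' q : r < T -> T <= T' ->
  cusp_section T' q `\` cusp_section T q = cusp_shell T T' q.
Proof.
move=> rT TT; apply/seteqP; split => z /=.
- move=> [[h /andP[h1 h2]] h3]; split => //; rewrite h2 andbT leNgt.
  by apply/negP => h4; apply: h3; split => //; apply/andP.
- move=> [h /andP[h1 h2]]; split; first by split => //; rewrite h2 (lt_le_trans rT h1).
  by move=> [_ /andP[_]]; rewrite ltNge h1.
Qed.

Lemma measurable_cusp_shell T T' q : r < T -> T <= T' -> measurable (cusp_shell T T' q).
Proof.
by move=> rT TT; rewrite -cusp_sectionD//; apply: measurableD; exact: measurable_cusp_section.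
Qed.

Lemma leb_cusp_shell T T' q : r < T -> T <= T' ->
  fine (leb R m (cusp_section T' q)) - fine (leb R m (cusp_section T q)) =
  fine (leb R m (cusp_shell T T' q)).
Proof.
move=> rT TT; rewrite -cusp_sectionD// measureD; first last.
- by rewrite -ge0_fin_numE//; exact: leb_cusp_section_fin.
- exact: measurable_cusp_section.
- exact: measurable_cusp_section.
rewrite setIidr; last by move=> z [h /andP[h1 h2]]; split => //; rewrite h1 (lt_le_trans h2).
by rewrite fineB//; exact: leb_cusp_section_fin.
Qed.

Lemma leb_thin a : 0 < a ->
  leb R m [set z | enorm (A *m z) ^+ m < a] = (a * ball_volume R m / `|\det A|)%:E.
Proof.
move=> a0; have [x x0 xa] := positive_root m0 a0.
rewrite -{2}xa -(leb_open_ball 0 dA x0); congr (leb R m _).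
by apply/seteqP; split => z /=; rewrite addr0 -xa ltr_pXn2r// nnegrE ?enorm_ge0 ?ltW.
Qed.

Lemma measurable_thin a : measurable [set z | enorm (A *m z) ^+ m < a].
Proof.
rewrite (_ : [set z | _] = (fun z => enorm (A *m z) ^+ m) @^-1` `]-oo, a[%classic).
  apply: measurable_preimageT; last exact: measurable_itv.
  apply: measurable_funX.
  exact: (measurableT_comp (@measurable_enorm R m) (@measurable_mulmx R _ _ _ A)).
by apply/seteqP; split => z /=; rewrite in_itv.
Qed.

(** Where [|y| >= 1], the region has [|x|^m < c], hence [|x| <= 1 + c], and [K] bounds the
    displacement [|C z|]. *)
Let K := shear_bound (1 + c).

Let K0 : 0 <= K. Proof. by apply: shear_bound_ge0; rewrite addr_ge0// ltW. Qed.

(** From [|y| >= T] follows [|x|^m < c / T^n], which confines [z] to an ellipsoid of the stated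
    volume; [D q + w] is within [K] of [y]. *)
Lemma cusp_shell_le T T' q : r < T -> 1 <= T -> T <= T' ->
  fine (leb R m (cusp_shell T T' q)) <=
  \1_(shell D w (T - K) (T' + K)) (intv R q) * (c / T ^+ n * ball_volume R m / `|\det A|).
Proof.
move=> rT T1 TT; have T0 : 0 < T by lra.
have Tn1 : 1 <= T ^+ n by rewrite exprn_ege1.
have sub z : cusp_shell T T' q z -> enorm (A *m z) ^+ m < c / T ^+ n.
  move=> [h /andP[h1 _]]; rewrite ltr_pdivlMr ?exprn_gt0//; apply: le_lt_trans h.
  by rewrite ler_wpM2l ?exprn_ge0 ?enorm_ge0// lerXn2r// ?nnegrE ?enorm_ge0 ?(ltW T0).
have ca0 : 0 < c / T ^+ n by rewrite divr_gt0 ?exprn_gt0.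
rewrite indicE; case: (boolP (intv R q \in _)) => qs.
  rewrite mul1r -lee_fin -leb_thin// fineK.
    by apply: le_measure; rewrite ?inE; [exact: measurable_cusp_shell|exact: measurable_thin|exact: sub].
  rewrite ge0_fin_numE//; apply: (@le_lt_trans _ _ (leb R m [set z | (enorm (A *m z) ^+ m < c / T ^+ n)%R])).
    by apply: le_measure; rewrite ?inE; [exact: measurable_cusp_shell|exact: measurable_thin|exact: sub].
  by rewrite leb_thin// ltry.
rewrite mul0r (_ : cusp_shell T T' q = set0) ?measure0//.
apply/seteqP; split => z //= hz; move/negP: qs; apply; apply/mem_set.
have h2 : enorm (C *m z) <= K.
  apply: enorm_shear; apply: (exp_lt_bound m0 (enorm_ge0 _)).
  apply: (lt_le_trans (sub _ hz)); rewrite ler_pdivrMr ?exprn_gt0//.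
  by rewrite ler_peMr// ltW.
move: hz => [_ /andP[h3 h4]].
have h5 := enormB_le (D *m intv R q + w) (C *m z).
have h6 := enormD (C *m z) (D *m intv R q + w).
rewrite [_ + w + _]addrC in h5.
by apply/andP; split; lra.
Qed.

(** If [D q + w] is at depth [K] inside the shell, every [z] with [|x|^m < c / T'^n] has its [y] in
    the shell, where [|y| < T']. *)
Lemma cusp_shell_ge T T' q : r < T -> 1 <= T -> T <= T' ->
  \1_(shell D w (T + K) (T' - K)) (intv R q) * (c / T' ^+ n * ball_volume R m / `|\det A|)
  <= fine (leb R m (cusp_shell T T' q)).
Proof.
move=> rT T1 TT; have T0 : 0 < T' by lra.
have Tn1 : 1 <= T' ^+ n by rewrite exprn_ege1// (le_trans T1).
have ca0 : 0 < c / T' ^+ n by rewrite divr_gt0 ?exprn_gt0.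
rewrite indicE; case: (boolP (intv R q \in _)) => [/set_mem/= /andP[h1 h2]|_]; last first.
  by rewrite mul0r fine_ge0.
have fin : leb R m (cusp_shell T T' q) \is a fin_num.
  rewrite -cusp_sectionD// ge0_fin_numE//.
  apply: (@le_lt_trans _ _ (leb R m (cusp_section T' q))).
    apply: le_measure; rewrite ?inE; [|exact: measurable_cusp_section|by move=> ? []].
    by apply: measurableD; exact: measurable_cusp_section.
  by rewrite -ge0_fin_numE//; exact: leb_cusp_section_fin.
rewrite mul1r -lee_fin -leb_thin// fineK//.
apply: le_measure; rewrite ?inE; [exact: measurable_thin|exact: measurable_cusp_shell|].
move=> z /= hz.
have h3 : enorm (C *m z) <= K.
  apply: enorm_shear; apply: (exp_lt_bound m0 (enorm_ge0 _)).
  apply: (lt_le_trans hz); rewrite ler_pdivrMr ?exprn_gt0//.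
  by rewrite ler_peMr// ltW.
have h5 := enormB_le (D *m intv R q + w) (C *m z).
have h6 := enormD (C *m z) (D *m intv R q + w).
rewrite [_ + w + _]addrC in h5.
have h7 : enorm (C *m z + (D *m intv R q + w)) < T' by lra.
split; last by apply/andP; split; lra.
move: hz; rewrite ltr_pdivlMr ?exprn_gt0//; apply: le_lt_trans.
by rewrite ler_wpM2l ?exprn_ge0 ?enorm_ge0// lerXn2r ?nnegrE ?enorm_ge0 ?ltW.
Qed.

Definition boundary_width := K + cell_diam D.

Let density := c * ball_volume R m * ball_volume R n / (`|\det A| * `|\det D|).

(** The number of indices in the shell grows like [T^n] while each section shrinks like [1 / T^n].
    The powers cancel, so that the increment from [T] to [th * T] depends on [T] only through
    [boundary_width / T]; this is the source of the logarithm. *)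
Lemma cusp_mean_increment_le T th : r < T -> 1 <= T -> boundary_width < T -> 1 <= th ->
  cusp_mean (th * T) - cusp_mean T <=
  density * ((th + boundary_width / T) ^+ n - (1 - boundary_width / T) ^+ n).
Proof.
move=> rT T1 bT th1; have T0 : 0 < T by lra.
have TT : T <= th * T by rewrite ler_peMl// ltW.
have [Q QT] := index_coverP (th * T).
rewrite (cusp_mean_cover QT) (cusp_mean_cover (index_coverW TT QT)) /mean_hits -sumrB.
have k0 := cell_diam_ge0 D; have K00 := K0.
apply: (@le_trans _ _ (\sum_(q <- Q)
    \1_(shell D w (T - K) (th * T + K)) (intv R q) * (c / T ^+ n * ball_volume R m / `|\det A|))).
  by apply: ler_sum => q _; rewrite leb_cusp_shell//; exact: cusp_shell_le.
rewrite -mulr_suml.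
rewrite /index_cover /index_bound in QT.
have h0 : 0 <= shear_bound (1 + c / r ^+ n).
  by apply: shear_bound_ge0; rewrite addr_ge0// divr_ge0// ltW// exprn_gt0.
have := @shell_count_le R n D w dD Q (T - K) (th * T + K).
rewrite /shell_count; move: bT; rewrite /boundary_width; set s := \sum_(_ <- _) _ => bT hs.
have {hs} : s <= T ^+ n * ((th + boundary_width / T) ^+ n - (1 - boundary_width / T) ^+ n)
    * ball_volume R n / `|\det D|.
  rewrite mulrBr -!exprMn.
  rewrite (_ : T * (th + _) = th * T + K + cell_diam D); last first.
    by rewrite /boundary_width; field; rewrite gt_eqF.
  rewrite (_ : T * (1 - _) = T - K - cell_diam D); last first.
    by rewrite /boundary_width; field; rewrite gt_eqF.
  apply: hs; [lra|lra|move=> v hv; apply: QT; rewrite -/K; lra].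
have vA : 0 < `|\det A| by rewrite normr_gt0.
have vD : 0 < `|\det D| by rewrite normr_gt0.
have Tn : 0 < T ^+ n by rewrite exprn_gt0.
set X := _ ^+ n - _ ^+ n => hs.
have -> : density * X = T ^+ n * X * ball_volume R n / `|\det D| *
    (c / T ^+ n * ball_volume R m / `|\det A|).
  by rewrite /density; field; rewrite !gt_eqF.
apply: ler_wpM2r => //.
by rewrite !mulr_ge0 ?invr_ge0 ?ball_volume_ge0 ?(ltW c0)// ltW.
Qed.

(** The factor [1 / th ^+ n] appears because the sections are bounded below by their size at the
    outer radius [th * T]. *)
Lemma cusp_mean_increment_ge T th : r < T -> 1 <= T -> 1 <= th ->
  1 + boundary_width / T <= th - boundary_width / T ->
  density / th ^+ n * ((th - boundary_width / T) ^+ n - (1 + boundary_width / T) ^+ n)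
  <= cusp_mean (th * T) - cusp_mean T.
Proof.
move=> rT T1 th1 bT; have T0 : 0 < T by lra.
have TT : T <= th * T by rewrite ler_peMl// ltW.
have [Q QT] := index_coverP (th * T).
rewrite (cusp_mean_cover QT) (cusp_mean_cover (index_coverW TT QT)) /mean_hits -sumrB.
have k0 := cell_diam_ge0 D; have K00 := K0.
apply: (@le_trans _ _ (\sum_(q <- Q)
    \1_(shell D w (T + K) (th * T - K)) (intv R q) * (c / (th * T) ^+ n * ball_volume R m / `|\det A|))); last first.
  by apply: ler_sum => q _; rewrite leb_cusp_shell//; exact: cusp_shell_ge.
rewrite -mulr_suml.
have h0 : 0 <= shear_bound (1 + c / r ^+ n).
  by apply: shear_bound_ge0; rewrite addr_ge0// divr_ge0// ltW// exprn_gt0.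
have := @shell_count_ge R n D w dD Q (T + K) (th * T - K).
rewrite /shell_count; set s := \sum_(_ <- _) _ => hs.
have {hs} : T ^+ n * ((th - boundary_width / T) ^+ n - (1 + boundary_width / T) ^+ n)
    * ball_volume R n / `|\det D| <= s.
  rewrite mulrBr -!exprMn.
  have e1 : T * (th - boundary_width / T) = th * T - K - cell_diam D.
    by rewrite /boundary_width; field; rewrite gt_eqF.
  have e2 : T * (1 + boundary_width / T) = T + K + cell_diam D.
    by rewrite /boundary_width; field; rewrite gt_eqF.
  rewrite e1 e2; apply: hs.
  - exact: ltr_wpDr.
  - by rewrite -e1 -e2 ler_wpM2l// ltW.
  - move=> v hv; apply: QT; rewrite /index_bound -/K; lra.
have vA : 0 < `|\det A| by rewrite normr_gt0.
have vD : 0 < `|\det D| by rewrite normr_gt0.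
have Tn : 0 < T ^+ n by rewrite exprn_gt0.
have thn : 0 < th ^+ n by rewrite exprn_gt0// (lt_le_trans _ th1).
set X := _ ^+ n - _ ^+ n => hs.
have -> : density / th ^+ n * X = T ^+ n * X * ball_volume R n / `|\det D| *
    (c / (th * T) ^+ n * ball_volume R m / `|\det A|).
  by rewrite /density exprMn; field; rewrite !gt_eqF.
apply: ler_wpM2r => //.
rewrite exprMn !mulr_ge0 ?invr_ge0 ?ball_volume_ge0 ?(ltW c0)// ?ltW// mulr_gt0//.
Qed.

Lemma cusp_mean_homo T T' : r < T -> T <= T' -> cusp_mean T <= cusp_mean T'.
Proof.
move=> rT TT; have [Q QT] := index_coverP T'.
rewrite (cusp_mean_cover QT) (cusp_mean_cover (index_coverW TT QT)).
by apply: ler_sum => q _; rewrite -subr_ge0 leb_cusp_shell// fine_ge0.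
Qed.

Lemma cusp_mean_ge0 T : 0 <= cusp_mean T.
Proof. by apply: sumr_ge0 => q _; rewrite fine_ge0. Qed.

End CuspSections.

(** Monotonicity confines [f t] between its values at the two neighbouring points of the progression
    with step [d]; hence at most one step is lost on either side. *)
Lemma linear_of_increments (R : realType) (f : R -> R) (t0 d lo hi : R) :
  0 < d -> 0 <= lo -> 0 <= hi ->
  (forall s t, t0 <= s -> s <= t -> f s <= f t) ->
  (forall t, t0 <= t -> lo <= f (t + d) - f t <= hi) ->
  forall t, t0 <= t ->
    f t0 + ((t - t0) / d - 1) * lo <= f t <= f t0 + ((t - t0) / d + 1) * hi.
Proof.
move=> d0 lo0 hi0 fH fI t tt.
have iter j : f t0 + j%:R * lo <= f (t0 + j%:R * d) <= f t0 + j%:R * hi.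
  elim: j => [|j /andP[h1 h2]]; first by rewrite !mul0r !addr0 lexx.
  have jd : t0 <= t0 + j%:R * d by rewrite lerDl mulr_ge0// ltW.
  have := fI _ jd; rewrite (_ : t0 + j%:R * d + d = t0 + j.+1%:R * d) => [/andP[h3 h4]|].
    by rewrite -natr1 !mulrDl !mul1r in h3 h4 *; apply/andP; split; lra.
  by rewrite -natr1; ring.
have x0 : 0 <= (t - t0) / d by rewrite divr_ge0 ?subr_ge0// ltW.
pose j := Num.truncn ((t - t0) / d).
have /andP[j1 j2] := truncn_itv x0.
have tE : t = t0 + (t - t0) / d * d by rewrite divfK ?gt_eqF// addrC subrK.
apply/andP; split.
- apply: (@le_trans _ _ (f (t0 + j%:R * d))).
    have /andP[h _] := iter j; apply: le_trans h; rewrite lerD2l ler_wpM2r//.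
    by rewrite lerBlDr natr1 ltW.
  apply: fH; first by rewrite lerDl mulr_ge0// ltW.
  by rewrite [leRHS]tE lerD2l ler_wpM2r// ltW.
- apply: (@le_trans _ _ (f (t0 + j.+1%:R * d))).
    by apply: fH => //; rewrite [leLHS]tE lerD2l ler_wpM2r// ltW.
  have /andP[_ h] := iter j.+1; apply: (le_trans h); rewrite lerD2l ler_wpM2r//.
  by rewrite -natr1 lerD2r.
Qed.

Lemma near0_continuous (R : realType) (phi : R -> R) (e : R) :
  {for 0, continuous phi} -> 0 < e ->
  exists2 x0, 0 < x0 & forall x, 0 <= x < x0 -> `|phi x - phi 0| < e.
Proof.
move=> /cvgrPdist_lt/(_ e) h e0; have {h} := h e0 => /nbhs_ballP[x0 /= x00 h].
exists x0 => // x /andP[h1 h2]; rewrite distrC; apply: h.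
by rewrite /ball/= sub0r normrN ger0_norm.
Qed.

(** * Logarithmic growth of the mean count *)

Section CuspMeanAsymptotics.
Variables (R : realType) (m n : nat).
Hypotheses (m0 : (0 < m)%N) (n0 : (0 < n)%N).
Variables (A : 'M[R]_m) (C : 'M[R]_(n, m)) (D : 'M[R]_n) (w : 'cV[R]_n) (c r : R).
Hypotheses (dA : \det A != 0) (dD : \det D != 0) (c0 : 0 < c) (r0 : 0 < r).

Definition cusp_density := c * ball_volume R m * ball_volume R n / (`|\det A| * `|\det D|).

Lemma cusp_density_gt0 : 0 < cusp_density.
Proof. by rewrite divr_gt0// !mulr_gt0 ?ball_volume_gt0 ?normr_gt0. Qed.

Let M := cusp_mean A C w c r dD.
Let bw := boundary_width A C D c.

Let bw0 : 0 <= bw.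
Proof.
apply: addr_ge0; last exact: cell_diam_ge0.
by apply: shear_bound_ge0; rewrite addr_ge0// ltW.
Qed.

(* With [th ^ n = 1 + s] the increments over [ln th = ln (1 + s) / n] are
   asymptotically between [density s / (1 + s)] and [density s]. *)
Lemma cusp_mean_increments s : 0 < s -> exists2 T0, r < T0 /\ 1 <= T0 &
  forall T, T0 <= T ->
    cusp_density * (s / (1 + s) - s ^+ 2) <=
    M (expR (ln (1 + s) / n%:R) * T) - M T <= cusp_density * (s + s ^+ 2).
Proof.
have kp := cusp_density_gt0; have bw00 := bw0; have rr0 := r0.
move=> s0; set th := expR _.
have thn : th ^+ n = 1 + s.
  rewrite -expRM_natl mulrC divfK ?pnatr_eq0 -?lt0n//.
  by rewrite lnK// posrE; lra.
have th1 : 1 < th.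
  by rewrite -expR0 ltr_expR divr_gt0 ?ltr0n// ln_gt0//; lra.
(* These are the two bounds on increments as functions of [x = bw / T], without the density. At 0
   they equal [s] and [s / (1 + s)], and for small [x] continuity costs less than [s ^+ 2]. *)
pose up x := (th + x) ^+ n - (1 - x) ^+ n.
pose lo x := ((th - x) ^+ n - (1 + x) ^+ n) / th ^+ n.
have cX (f : R -> R) : {for 0, continuous f} -> {for 0, continuous (fun x => f x ^+ n)}.
  by move=> cf; exact: (continuous_comp cf (@exprn_continuous _ _ _)).
have cp a : {for 0, continuous (fun x : R => (a + x) ^+ n)}.
  by apply: cX; apply: cvgD; [exact: cvg_cst|exact: cvg_id].
have cm a : {for 0, continuous (fun x : R => (a - x) ^+ n)}.
  by apply: cX; apply: cvgB; [exact: cvg_cst|exact: cvg_id].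
have cup : {for 0, continuous up} by exact: (cvgB (cp th) (cm 1)).
have clo : {for 0, continuous lo} by exact: (cvgMl (cvgB (cm th) (cp 1))).
have s20 : 0 < s ^+ 2 by rewrite exprn_gt0.
have [x1 x10 hup] := near0_continuous cup s20.
have [x2 x20 hlo] := near0_continuous clo s20.
have x30 : 0 < (th - 1) / 2 by lra.
pose x0 := Num.min x1 (Num.min x2 ((th - 1) / 2)).
have x00 : 0 < x0 by rewrite !lt_min x10 x20.
(* The summands ensure in turn [1 <= T], [r < T], [bw / T < x0] and [bw < T]. *)
pose T0 := 1 + r + bw / x0 + bw.
have bx : 0 <= bw / x0 by rewrite divr_ge0// ltW.
exists T0; first by rewrite /T0; split; lra.
move=> T TT; have T0p : 0 < T by move: TT; rewrite /T0; lra.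
have bT0 : 0 <= bw / T by rewrite divr_ge0// ltW.
have bT : bw / T < x0.
  rewrite ltr_pdivrMr// mulrC -ltr_pdivrMr//; move: TT; rewrite /T0; lra.
have [bT1 bT2 bT3] : [/\ bw / T < x1, bw / T < x2 & bw / T < (th - 1) / 2].
  by move: bT; rewrite !lt_min => /and3P[].
have rT : r < T by move: TT; rewrite /T0; lra.
have T1 : 1 <= T by move: TT; rewrite /T0; lra.
have bwT : bw < T by move: TT; rewrite /T0; lra.
apply/andP; split.
- have h1 : 1 + bw / T <= th - bw / T by lra.
  have := cusp_mean_increment_ge m0 w dA dD c0 r0 rT T1 (ltW th1) h1.
  apply: le_trans; rewrite -/cusp_density -mulrA mulrCA -/bw.
  rewrite [X in _ <= X](_ : _ = cusp_density * lo (bw / T)); last by rewrite /lo; ring.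
  rewrite ler_pM2l//.
  have := hlo (bw / T); rewrite bT0 bT2 => /(_ isT).
  have -> : lo 0 = s / (1 + s).
    by rewrite /lo subr0 addr0 thn expr1n addrAC subrr add0r.
  by rewrite ltr_norml => /andP[h _]; lra.
- have := cusp_mean_increment_le m0 w dA dD c0 r0 rT T1 bwT (ltW th1).
  move=> /le_trans; apply; rewrite -/cusp_density -/bw -/(up (bw / T)) ler_pM2l//.
  have := hup (bw / T); rewrite bT0 bT1 => /(_ isT).
  have -> : up 0 = s by rewrite /up subr0 addr0 thn expr1n addrAC subrr add0r.
  by rewrite ltr_norml => /andP[_ h]; lra.
Qed.

(** Over a step [ln (1 + s) / n] in [t = ln T] the mean grows by [cusp_density * s] up to order
    [s^2], so its slope tends to [cusp_density * n] as [s] tends to 0. *)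
Lemma cusp_mean_asymptotic (e : R) : 0 < e -> exists2 t0, 0 < t0 &
  forall t, t0 <= t -> `|M (expR t) - cusp_density * n%:R * t| <= e * t.
Proof.
have kp := cusp_density_gt0; have rr0 := r0; move=> e0.
have np : 0 < n%:R :> R by rewrite ltr0n.
pose k := cusp_density * n%:R; rewrite -/k; have k0 : 0 < k by rewrite mulr_gt0.
have k6 : 0 < 6 * k by exact: mulr_gt0.
(* All approximations of order [s^2] together change the slope by at most [3 k s], which this choice
   keeps below [e / 2]. *)
pose s := Num.min (2^-1) (e / (6 * k)).
have s0 : 0 < s by rewrite lt_min invr_gt0 ltr0n divr_gt0.
have s1 : s <= 2^-1 by rewrite ge_min lexx.
have ks : 3 * (k * s) <= e / 2.
  have : s <= e / (6 * k) by rewrite ge_min lexx orbT.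
  rewrite ler_pdivlMr// => h.
  have -> : 3 * (k * s) = s * (6 * k) / 2 by field.
  by rewrite ler_pM2r// invr_gt0.
have [T0 [rT0 T01] TP] := cusp_mean_increments s0.
pose d := ln (1 + s) / n%:R.
have ln1 : ln (1 + s) <= s by apply: le_ln1Dx; lra.
have s10 : 0 < 1 + s by lra.
have ln2 : s / (1 + s) <= ln (1 + s).
  have : ln (1 + - (s / (1 + s))) <= - (s / (1 + s)).
    by apply: le_ln1Dx; rewrite ltrN2 ltr_pdivrMr//; lra.
  rewrite (_ : 1 + - (s / (1 + s)) = (1 + s)^-1); last by field; rewrite gt_eqF.
  by rewrite lnV ?posrE// lerN2.
have l0 : 0 < ln (1 + s) by rewrite (lt_le_trans _ ln2)// divr_gt0.
have d0 : 0 < d by rewrite divr_gt0.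
pose hi := cusp_density * (s + s ^+ 2).
pose lo := cusp_density * (s / (1 + s) - s ^+ 2).
have ss : 0 <= s ^+ 2 by rewrite exprn_ge0// ltW.
have sdiv : s - s ^+ 2 <= s / (1 + s).
  by rewrite ler_pdivlMr//; have : 0 <= s * s ^+ 2 by [rewrite mulr_ge0// ltW]; lra.
have hi0 : 0 <= hi by rewrite mulr_ge0 ?(ltW kp)//; lra.
have lo0 : 0 <= lo by rewrite mulr_ge0 ?(ltW kp)//; have : s ^+ 2 <= s / 2 by [rewrite expr2 ler_wpM2l// ltW]; lra.
have hid : hi / d <= k + e / 2.
  rewrite ler_pdivrMr// /d mulrA ler_pdivlMr//.
  apply: (@le_trans _ _ ((k + e / 2) * (s / (1 + s)))); last first.
    by rewrite ler_wpM2l// addr_ge0 ?divr_ge0// ltW.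
  rewrite mulrA ler_pdivlMr//.
  have -> : hi * n%:R * (1 + s) = (k * (1 + s) ^+ 2) * s by rewrite /hi /k; ring.
  rewrite ler_wpM2r ?(ltW s0)//.
  have : k * (s * s) <= k * s by rewrite ler_pM2l// ler_piMl ?(ltW s0)//; lra.
  rewrite sqrrD expr1n mul1r; lra.
have lod : k - e / 2 <= lo / d.
  rewrite ler_pdivlMr// /d mulrA ler_pdivrMr//.
  have [kneg|kpos] := leP (k - e / 2) 0.
    by apply: (@le_trans _ _ 0); [rewrite mulr_le0_ge0// ltW|rewrite mulr_ge0// ltW].
  apply: (@le_trans _ _ ((k - e / 2) * s)); first by rewrite ler_pM2l.
  have -> : lo * n%:R = k * (s / (1 + s) - s ^+ 2) by rewrite /lo /k; ring.
  apply: (@le_trans _ _ (k * (s - s ^+ 2 - s ^+ 2))); last by rewrite ler_pM2l// lerB.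
  have -> : k * (s - s ^+ 2 - s ^+ 2) = (k - 2 * (k * s)) * s by ring.
  rewrite ler_wpM2r ?(ltW s0)//.
  have : 0 <= k * s by rewrite mulr_ge0// ltW.
  lra.
pose f t := M (expR t); pose t0 := ln T0.
have T0p : 0 < T0 by lra.
have t00 : 0 <= t0 by exact: ln_ge0.
have eT t : t0 <= t -> T0 <= expR t by move=> h; rewrite -[T0]lnK ?posrE// ler_expR.
have fH u v : t0 <= u -> u <= v -> f u <= f v.
  move=> tu uv; apply: (cusp_mean_homo m0 C w dA dD c0 r0); last by rewrite ler_expR.
  by rewrite (lt_le_trans rT0)// eT.
have fI t : t0 <= t -> lo <= f (t + d) - f t <= hi.
  by move=> tt; rewrite /f [t + d]addrC expRD; exact: TP (eT _ tt).
have fP := linear_of_increments d0 lo0 hi0 fH fI.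
have f0 : 0 <= f t0 by exact: cusp_mean_ge0.
(* The errors that do not grow with [t]; from [t = 2 * Ct / e] on they are at most [e / 2 * t]. *)
pose Ct := f t0 + hi + k * t0 + lo.
have kt0 : 0 <= k * t0 by rewrite mulr_ge0// ltW.
have C0 : 0 <= Ct by rewrite /Ct; lra.
have Ce : 0 <= 2 * Ct / e by rewrite divr_ge0 ?(ltW e0)//; apply: mulr_ge0.
exists (1 + t0 + 2 * Ct / e); first by lra.
move=> t tt.
have t0t : t0 <= t by lra.
have Ct2 : Ct <= e / 2 * t.
  have : 2 * Ct / e <= t by lra.
  by rewrite ler_pdivrMr//; lra.
have /andP[h1 h2] := fP _ t0t.
have tmt : 0 <= t - t0 by lra.
have h3 : (t - t0) * (hi / d) <= (t - t0) * (k + e / 2) by rewrite ler_wpM2l.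
have h4 : (t - t0) * (k - e / 2) <= (t - t0) * (lo / d) by rewrite ler_wpM2l.
have h5 : 0 <= e * t0 by rewrite mulr_ge0// ltW.
have e3 : (t - t0) * (hi / d) = (t - t0) / d * hi by rewrite mulrA mulrAC.
have e4 : (t - t0) * (lo / d) = (t - t0) / d * lo by rewrite mulrA mulrAC.
have e5 : ((t - t0) / d + 1) * hi = (t - t0) / d * hi + hi by rewrite mulrDl mul1r.
have e6 : ((t - t0) / d - 1) * lo = (t - t0) / d * lo - lo by rewrite mulrBl mul1r.
move: h1 h2; rewrite e5 e6 -e3 -e4 => h1 h2.
rewrite -/(f t) ler_norml; apply/andP; split; move: Ct2; rewrite /Ct; lra.
Qed.

End CuspMeanAsymptotics.

(** The series is dominated by a telescoping one: [1 / (k+1)^2 <= 2 (1 / (k+1) - 1 / (k+2))]. *)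
Lemma borel_cantelli_inv_sqr (R : realType) d (W : measurableType d)
    (P : {measure set W -> \bar R}) (E : (set W)^nat) (K : R) :
  (forall k, measurable (E k)) ->
  (forall k, (P (E k) <= (K / k.+1%:R ^+ 2)%:E)%E) ->
  P (lim_sup_set E) = 0%E.
Proof.
move=> mE EK; have K0 : 0 <= K.
  have := le_trans (measure_ge0 P (E 0%N)) (EK 0%N).
  by rewrite expr1n divr1 lee_fin.
apply: lim_sup_set_cvg0 => //.
apply: (@le_lt_trans _ _ (2 * K)%:E); last exact: ltry.
apply: lime_le; first by apply: is_cvg_nneseries.
apply: nearW => N.
apply: (@le_trans _ _ (\sum_(0 <= k < N) (2 * K * (k.+1%:R^-1 - k.+2%:R^-1))%:E)%E).
  apply: lee_sum => k _; apply: (le_trans (EK k)); rewrite lee_fin.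
  rewrite [2 * K]mulrC -mulrA ler_wpM2l//.
  have h1 : (0 : R) < k.+1%:R by rewrite ltr0n.
  have h2 : (0 : R) < k.+2%:R by rewrite ltr0n.
  have -> : 2 * (k.+1%:R^-1 - k.+2%:R^-1) = 2 / (k.+1%:R * k.+2%:R) :> R.
    have hk : (0 : R) <= k%:R by [].
    by field; apply/andP; split; apply: lt0r_neq0; lra.
  rewrite ler_pdivlMr ?mulr_gt0// expr2 invfM mulrACA mulVf ?gt_eqF// mul1r.
  have hk : (0 : R) <= k%:R by [].
  by rewrite mulrC ler_pdivrMr//; lra.
rewrite sumEFin lee_fin -mulr_sumr -[leRHS]mulr1 ler_wpM2l ?mulr_ge0//.
rewrite -[leRHS]subr0.
have : \sum_(0 <= k < N) (k.+1%:R^-1 - k.+2%:R^-1) = 1 - N.+1%:R^-1 :> R.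
  elim: N => [|N IH]; first by rewrite big_nil invr1 subrr.
  by rewrite big_nat_recr//= IH addrA subrK.
by move=> ->; rewrite lerB// invr_ge0.
Qed.

(** * Almost sure growth along a sparse sequence of times *)

Section AlmostSureCount.
Variables (R : realType) (m n : nat) (d : measure_display) (W : measurableType d).
Variables (P : probability W R) (Th : W -> 'M[R]_(m, n)) (s : W -> 'cV[R]_m).
Hypothesis Ths : pairwise_uniform P Th s.
Hypotheses (m0 : (0 < m)%N) (n0 : (0 < n)%N).
Variables (A : 'M[R]_m) (C : 'M[R]_(n, m)) (D : 'M[R]_n) (w : 'cV[R]_n) (c r : R).
Hypotheses (dA : \det A != 0) (dD : \det D != 0) (c0 : 0 < c) (r0 : 0 < r).
Variable B : {fset 'cV[int]_m}.
Hypothesis BP : forall T q z, cusp_section A C D w c r T q z -> flv z \in B.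
Variable cq : 'cV[int]_n -> 'cV[R]_m.

Definition time_seq k : R := expR (k.+1%:R ^+ 2).

Definition cusp_count T W0 : R :=
  total_hits Th s B (index_set A C w c r dD T) (cusp_section A C D w c r T) cq W0.

Lemma cusp_count_deviation (e : R) : 0 < e ->
  P (lim_sup_set (fun k => [set W0 |
    e * k.+1%:R ^+ 2 <=
    `|cusp_count (time_seq k) W0 - cusp_density A D c * n%:R * k.+1%:R ^+ 2|])) = 0%E.
Proof.
have kp := cusp_density_gt0 dA dD c0; move=> e0.
have e20 : 0 < e / 2 by rewrite divr_gt0.
have [t0 t00 tP] := cusp_mean_asymptotic m0 n0 C w dA dD c0 r0 e20.
set k := cusp_density A D c * n%:R in tP *.
have k0 : 0 < k by rewrite mulr_gt0// ltr0n.
have sq0 j : 0 < j.+1%:R ^+ 2 :> R by rewrite exprn_gt0.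
have mN T : measurable_fun setT (cusp_count T).
  by apply: (measurable_total_hits Ths) => q; exact: measurable_cusp_section.
have mE T (a b : R) : measurable [set W0 | a <= `|cusp_count T W0 - b|].
  rewrite (_ : [set W0 | _] = (fun W0 => `|cusp_count T W0 - b|) @^-1` `[a, +oo[%classic).
    apply: measurable_preimageT; last exact: measurable_itv.
    by apply: measurableT_comp => //; exact: measurable_funB.
  by apply/seteqP; split => x /=; rewrite in_itv/= andbT.
(* While [(j + 1)^2 < t0] the mean is not controlled and the probability is bounded by 1, hence the
   entry [t0]; the other entry is the constant from Chebyshev's inequality. *)
pose K := Num.max t0 (#|` B|%:R * (k + e / 2) / (e / 2) ^+ 2).
apply: (@borel_cantelli_inv_sqr _ _ _ _ _ K) => j; first exact: mE.
have [jt|jt] := leP t0 (j.+1%:R ^+ 2); last first.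
  apply: (@le_trans _ _ 1%E); first by apply: probability_le1; exact: mE.
  by rewrite lee_fin ler_pdivlMr// mul1r le_max ltW.
have h := tP _ jt.
set M := cusp_mean A C w c r dD _ in h.
(* Half of [e] absorbs the distance of the mean from its linear growth. *)
apply: (@le_trans _ _ (P [set W0 | (e / 2 * j.+1%:R ^+ 2 <= `|cusp_count (time_seq j) W0 - M|)%R])).
  apply: le_measure; rewrite ?inE.
  - exact: mE.
  - exact: mE.
  - move=> x /= hx; have := ler_normD (cusp_count (time_seq j) x - M) (M - k * j.+1%:R ^+ 2).
    by rewrite addrA subrK; lra.
have a0 : 0 < e / 2 * j.+1%:R ^+ 2 by rewrite mulr_gt0.
have hdev := total_hits_deviation Ths (index_set A C w c r dD (time_seq j)) cq
  (fun q => measurable_cusp_section A C D w c r (time_seq j) q) (fun q z => @BP (time_seq j) q z) a0.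
apply: (le_trans hdev).
rewrite lee_fin -/(cusp_mean A C w c r dD (time_seq j)) -/M.
have MK : M <= (k + e / 2) * j.+1%:R ^+ 2 by move: h; rewrite ler_norml => /andP[_]; lra.
apply: (@le_trans _ _ ((#|` B|%:R * (k + e / 2) / (e / 2) ^+ 2) / j.+1%:R ^+ 2)); last first.
  by rewrite ler_wpM2r ?invr_ge0 ?(ltW (sq0 j))// le_max lexx orbT.
have -> : #|` B|%:R * (k + e / 2) / (e / 2) ^+ 2 / j.+1%:R ^+ 2 =
    #|` B|%:R * ((k + e / 2) * j.+1%:R ^+ 2) / (e / 2 * j.+1%:R ^+ 2) ^+ 2.
  by field; rewrite !gt_eqF//= ltr0n.
rewrite ler_wpM2r ?invr_ge0 ?sqr_ge0// ler_wpM2l//.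
Qed.

End AlmostSureCount.

(** * The affine special linear group *)

Section MatrixTopology.
Variable R : realType.

Lemma nbhs_mxP p q (M : 'M[R]_(p, q)) (U : set 'M[R]_(p, q)) :
  nbhs M U <-> exists2 e : R, 0 < e & forall N : 'M[R]_(p, q), (forall i j, `|N i j - M i j| < e) -> U N.
Proof.
split.
- move=> /nbhs_ballP[e e0 eU]; exists e => // N NM; apply: eU; split => // i j.
  by rewrite /ball/= distrC.
- move=> [e e0 eU]; apply/nbhs_ballP; exists e => // N [_ MN]; apply: eU => i j.
  by have := MN i j; rewrite /ball/= distrC.
Qed.

Lemma continuous_mxP (T : topologicalType) p q (f : T -> 'M[R]_(p, q)) :
  (forall i j, continuous (fun x => f x i j)) -> continuous f.
Proof.
move=> fc x U /nbhs_mxP[e e0 eU].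
rewrite nbhs_simpl/=.
have : \forall y \near x, forall i j, `|f y i j - f x i j| < e.
  apply: filter_forall => i; apply: filter_forall => j.
  by have /cvgrPdist_lt/(_ e e0) := fc i j x; apply: filterS => y; rewrite distrC.
by apply: filterS => y; exact: eU.
Qed.

Lemma compact_mx_box p q (b : R) :
  compact [set M : 'M[R]_(p, q) | forall i j, `|M i j| <= b].
Proof.
pose rowbox := [set v : 'rV[R]_(p * q) | forall i, `[-b, b]%classic (v ord0 i)].
have cr : compact rowbox by apply: (@rV_compact _ _ (fun=> `[-b, b]%classic)) => _; exact: segment_compact.
have cv : continuous (@vec_mx R p q).
  apply: continuous_mxP => i j.
  rewrite (_ : (fun _ => _) = (fun v : 'rV[R]_(p * q) => v 0 (mxvec_index i j))).
    exact: coord_continuous.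
  by apply/funext => v; rewrite mxE.
have := continuous_compact (continuous_subspaceT cv) cr.
congr compact; apply/seteqP; split => [M [v vb <-] i j|M Mb].
  by rewrite mxE; have := vb (mxvec_index i j); rewrite /= in_itv/= -ler_norml.
exists (mxvec M); last exact: mxvecK.
move=> k; case: (mxvec_indexP k) => i j; rewrite mxvecE.
by rewrite /= in_itv/= -ler_norml.
Qed.

Lemma continuous_det k : continuous (fun M : 'M[R]_k => \det M).
Proof.
rewrite /determinant.
apply: (@continuous_big R _ +%R 0) => [|s _]; first exact: add_continuous.
have cp : continuous (fun M : 'M[R]_k => \prod_i M i (s i)).
  apply: (@continuous_big R _ *%R 1) => [|i _]; first exact: mul_continuous.
  exact: coord_continuous.
by move=> M; exact: (cvgM (cvg_cst _) (cp M)).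
Qed.

Lemma measurable_det d (T : measurableType d) k (f : T -> 'M[R]_k) :
  (forall i j, measurable_fun setT (fun x => f x i j)) ->
  measurable_fun setT (fun x => \det (f x)).
Proof.
move=> mf; rewrite /determinant; apply: measurable_sum => s.
apply: (@measurable_funM _ _ R) => //.
by apply: measurable_prod => i _; exact: mf.
Qed.

End MatrixTopology.

Section AffineGroupTheory.
Variables (R : realType) (d : nat).
Local Notation G := (ASL R d).

Lemma det_SL (g : SL R d) : \det (val g) = 1.
Proof. exact: (set_mem (valP g)). Qed.

Lemma SL_unit (g : SL R d) : val g \in unitmx.
Proof. by rewrite unitmxE det_SL unitr1. Qed.

Lemma det_adj_SL (g : SL R d) : \det (\adj (val g)) = 1.
Proof.
have : \det (\adj (val g) *m val g) = 1 by rewrite mul_adj_mx det_SL det1.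
by rewrite det_mulmx det_SL mulr1.
Qed.

(** With determinant 1 the adjugate is the inverse, and its entries are visibly polynomial, which
    serves [measurable_ASL_inv]. *)
Definition SL_inv (g : SL R d) : SL R d := exist _ (\adj (val g)) (mem_set (det_adj_SL g)).

Definition ASL_inv (a : G) : G := (SL_inv a.1, - (\adj (val a.1) *m a.2)).

Definition ASL_one : G := (SL1 R d, 0).

Lemma ASL_eq (a b : G) : val a.1 = val b.1 -> a.2 = b.2 -> a = b.
Proof. by case: a b => [a1 a2] [b1 b2] /= /val_inj -> ->. Qed.

Lemma ASL_mulA (a b c : G) : ASL_mul a (ASL_mul b c) = ASL_mul (ASL_mul a b) c.
Proof. by apply: ASL_eq => /=; rewrite ?mulmxA// mulmxDr mulmxA addrA. Qed.

Lemma ASL_mul1 (a : G) : ASL_mul ASL_one a = a.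
Proof. by apply: ASL_eq => /=; rewrite mul1mx ?addr0. Qed.

Lemma ASL_mulr1 (a : G) : ASL_mul a ASL_one = a.
Proof. by apply: ASL_eq => /=; rewrite ?mulmx1// mulmx0 add0r. Qed.

Lemma ASL_mulV (a : G) : ASL_mul (ASL_inv a) a = ASL_one.
Proof. by apply: ASL_eq => /=; rewrite ?mul_adj_mx ?det_SL// subrr. Qed.

Lemma ASL_mulrV (a : G) : ASL_mul a (ASL_inv a) = ASL_one.
Proof.
apply: ASL_eq => /=; first by rewrite mul_mx_adj det_SL.
by rewrite mulmxN mulmxA mul_mx_adj det_SL mul1mx addNr.
Qed.

Lemma ASL_mulK (a b : G) : ASL_mul (ASL_inv a) (ASL_mul a b) = b.
Proof. by rewrite ASL_mulA ASL_mulV ASL_mul1. Qed.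

Lemma ASL_mulVK (a b : G) : ASL_mul a (ASL_mul (ASL_inv a) b) = b.
Proof. by rewrite ASL_mulA ASL_mulrV ASL_mul1. Qed.

Lemma ASL_invM (a b : G) : ASL_inv (ASL_mul a b) = ASL_mul (ASL_inv b) (ASL_inv a).
Proof.
rewrite -[LHS]ASL_mulr1 -{1}(ASL_mulrV a) -{1}(ASL_mulVK b (ASL_inv a)).
by rewrite (ASL_mulA a b) ASL_mulK.
Qed.

Lemma ASL_invK (a : G) : ASL_inv (ASL_inv a) = a.
Proof. by rewrite -[LHS]ASL_mulr1 -(ASL_mulV a) ASL_mulK. Qed.

Lemma image_ASL_mul (a : G) (A : set G) :
  ASL_mul a @` A = [set b | A (ASL_mul (ASL_inv a) b)].
Proof.
apply/seteqP; split => [_ [b Ab <-]|b Ab] /=; first by rewrite ASL_mulK.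
by exists (ASL_mul (ASL_inv a) b) => //; rewrite ASL_mulVK.
Qed.

End AffineGroupTheory.

Section BorelAffineGroup.
Variables (R : realType) (d : nat).
Local Notation G := (borelASL R d).

Let continuous_val : continuous (fun g : SL R d => val g : 'M[R]_d).
Proof. exact: initial_continuous. Qed.

Lemma continuous_ASL1 i j : continuous (fun a : ASL R d => val a.1 i j).
Proof.
move=> a; apply: (@continuous_comp _ _ _ (fun a : ASL R d => val a.1) (fun M => M i j)).
  apply: (@continuous_comp _ _ _ fst (fun g : SL R d => val g)); first exact: cvg_fst.
  exact: continuous_val.
exact: coord_continuous.
Qed.

Lemma continuous_ASL2 i : continuous (fun a : ASL R d => a.2 i 0).
Proof.
move=> a; apply: (@continuous_comp _ _ _ snd (fun v : 'cV[R]_d => v i 0)).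
  exact: cvg_snd.
exact: coord_continuous.
Qed.

Lemma measurable_continuous_ASL (f : ASL R d -> R) :
  continuous f -> measurable_fun [set: G] f.
Proof.
move=> cf; apply: (measurability _ (RGenOInfty.measurableE R)) => //.
move=> _ [_ [x ->] <-]; rewrite setTI; apply: sub_sigma_algebra.
move/continuousP : cf; apply; exact: rray_open.
Qed.

Lemma measurable_ASL1 i j : measurable_fun [set: G] (fun a => val a.1 i j : R).
Proof. exact: (measurable_continuous_ASL (@continuous_ASL1 i j)). Qed.

Lemma measurable_ASL2 i : measurable_fun [set: G] (fun a => a.2 i 0 : R).
Proof. exact: (measurable_continuous_ASL (@continuous_ASL2 i)). Qed.

(** Boxes with rational centres and radii [1 / (k + 1)]: a countable family that refines all
    neighbourhoods and is described by matrix entries. *)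
Definition ASL_box (x : 'M[rat]_d * 'cV[rat]_d * nat) : set (ASL R d) :=
  [set a : ASL R d | (forall i j, `|val a.1 i j - ratr (x.1.1 i j)| < x.2.+1%:R^-1) /\
           (forall i, `|a.2 i 0 - ratr (x.1.2 i 0)| < x.2.+1%:R^-1)].

Lemma nbhs_ASL_box (a : ASL R d) (U : set (ASL R d)) : nbhs a U ->
  exists x, ASL_box x a /\ ASL_box x `<=` U.
Proof.
move=> [[V1 V2] /= [aV1 /nbhs_mxP[e2 e20 eV2]] VU].
have [_ [[V oV <-] /= Va VV1]] := aV1.
have /nbhs_mxP[e1 e10 eV] : nbhs (val a.1) V by exact: open_nbhs_nbhs.
have e0 : 0 < Num.min e1 e2 by rewrite lt_min e10.
have [k kP] : exists k, k.+1%:R^-1 < Num.min e1 e2 / 2 :> R.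
  have := @near_infty_natSinv_lt R (PosNum (divr_gt0 e0 (ltr0n R 2))).
  by move=> [k _ /(_ k (leqnn k))]; exists k.
have k0 : (0 : R) < k.+1%:R^-1 by rewrite invr_gt0 ltr0n.
have rat_near (y : R) : {q : rat | `|y - ratr q| < k.+1%:R^-1}.
  apply: cid; have [|q] := @rat_in_itvoo R (y - k.+1%:R^-1) (y + k.+1%:R^-1); first by rewrite ltrBlDr -addrA ltrDl addr_gt0.
  by rewrite in_itv/= => /andP[h1 h2]; exists q; rewrite ltr_distlC h1.
exists (\matrix_(i, j) projT1 (rat_near (val a.1 i j)), \col_i projT1 (rat_near (a.2 i 0)), k).
split.
  by split => /= [i j|i]; rewrite mxE; case: (rat_near _).
have [min1 min2] : Num.min e1 e2 <= e1 /\ Num.min e1 e2 <= e2.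
  by rewrite !ge_min !lexx orbT.
move=> b [/= b1 b2]; apply: VU; split => /=.
  apply: VV1; apply: eV => i j; have := b1 i j; rewrite mxE.
  case: (rat_near _) => q /= q1 q2; have := ler_normD (val b.1 i j - ratr q) (ratr q - val a.1 i j).
  rewrite addrA subrK (distrC (ratr q)).
  by move: q1 q2 kP; set t : R := _.+1%:R^-1; lra.
apply: eV2 => i j; rewrite (ord1 j); have := b2 i; rewrite mxE.
case: (rat_near _) => q /= q1 q2; have := ler_normD (b.2 i 0 - ratr q) (ratr q - a.2 i 0).
rewrite addrA subrK (distrC (ratr q)).
  by move: q1 q2 kP; set t : R := _.+1%:R^-1; lra.
Qed.

Lemma measurable_to_ASL d' (T : measurableType d') (f : T -> G) :
  (forall i j, measurable_fun setT (fun t => val (f t).1 i j : R)) ->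
  (forall i, measurable_fun setT (fun t => (f t).2 i 0 : R)) ->
  measurable_fun setT f.
Proof.
move=> mf1 mf2.
apply: (@measurability _ _ _ _ setT f (@open (ASL R d))) => //.
move=> _ [U oU <-]; rewrite setTI.
have mb x : measurable (f @^-1` ASL_box x).
  rewrite (_ : f @^-1` _ =
    (\bigcap_(ij in [set: 'I_d * 'I_d]) [set t | `|val (f t).1 ij.1 ij.2 - ratr (x.1.1 ij.1 ij.2)| < x.2.+1%:R^-1])
    `&` (\bigcap_(i in [set: 'I_d]) [set t | `|(f t).2 i 0 - ratr (x.1.2 i 0)| < x.2.+1%:R^-1])); last first.
    apply/seteqP; split => t /= [h1 h2]; split.
    - by move=> ij _; exact: h1.
    - by move=> i _; exact: h2.
    - by move=> i j; exact: (h1 (i, j)).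
    - by move=> i; exact: h2.
  have mlt (g : T -> R) (y z : R) : measurable_fun setT g -> measurable [set t | `|g t - y| < z].
    move=> mg; rewrite (_ : [set t | _] = (fun t => `|g t - y|) @^-1` `]-oo, z[%classic).
      apply: measurable_preimageT; last exact: measurable_itv.
      by apply: measurableT_comp => //; exact: measurable_funB.
    by apply/seteqP; split => t /=; rewrite in_itv.
  apply: measurableI; apply: fin_bigcap_measurable => // i _; exact: mlt.
(* An open set is the union of the boxes it contains, and these are countably many. *)
pose F k := if (choice.unpickle k : option ('M[rat]_d * 'cV[rat]_d * nat)) is Some x then
  (if pselect (ASL_box x `<=` U) then f @^-1` ASL_box x else set0) else set0.
rewrite (_ : f @^-1` U = \bigcup_k F k).
  apply: bigcupT_measurable => k; rewrite /F; case: choice.unpickle => // x.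
  by case: (pselect (ASL_box x `<=` U)) => ?; [exact: mb|exact: measurable0].
apply/seteqP; split => [t Ut|t [k _]].
  have [x [xt xU]] := @nbhs_ASL_box (f t) U (open_nbhs_nbhs (conj oU Ut)).
  by exists (choice.pickle x) => //; rewrite /F choice.pickleK; case: pselect.
by rewrite /F; case: choice.unpickle => // x; case: pselect => // xU; exact: xU.
Qed.

Lemma measurable_ASL_mul : measurable_fun [set: G * G] (fun ab => ASL_mul ab.1 ab.2 : G).
Proof.
apply: measurable_to_ASL => [i j|i] /=.
  under eq_fun do rewrite mxE.
  apply: measurable_sum => l; apply: (@measurable_funM _ _ R).
  - exact: (measurableT_comp (@measurable_ASL1 i l) measurable_fst).
  - exact: (measurableT_comp (@measurable_ASL1 l j) measurable_snd).
under eq_fun do rewrite !mxE.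
apply: (@measurable_funD _ _ R); last exact: (measurableT_comp (@measurable_ASL2 i) measurable_fst).
apply: measurable_sum => l; apply: (@measurable_funM _ _ R).
- exact: (measurableT_comp (@measurable_ASL1 i l) measurable_fst).
- exact: (measurableT_comp (@measurable_ASL2 l) measurable_snd).
Qed.

Lemma measurable_ASL_inv : measurable_fun [set: G] (@ASL_inv R d : G -> G).
Proof.
have madj i j : measurable_fun [set: G] (fun a => (\adj (val a.1) : 'M[R]_d) i j : R).
  under eq_fun do rewrite mxE.
  apply: (@measurable_funM _ _ R) => //.
  apply: measurable_det => k l; under eq_fun do rewrite !mxE.
  exact: measurable_ASL1.
apply: measurable_to_ASL => [i j|i] /=; first exact: madj.
under eq_fun do rewrite !mxE -sumrN.
apply: measurable_sum => l; under eq_fun do rewrite -mulNr.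
apply: (@measurable_funM _ _ R); last exact: measurable_ASL2.
by apply: (measurableT_comp (f := (-%R : R -> R))) => //; exact: madj.
Qed.

Lemma compact_ASL_box (b : R) :
  compact [set a : ASL R d | (forall i j, `|val a.1 i j| <= b) /\ (forall i, `|a.2 i 0| <= b)].
Proof.
have c1 : compact [set g : SL R d | forall i j, `|val g i j| <= b].
  have cM : compact ([set M : 'M[R]_d | forall i j, `|M i j| <= b] `&` [set M | \det M = 1]).
    apply: compact_closedI; first exact: compact_mx_box.
    by apply: (proj1 (continuous_closedP _) (@continuous_det R d) [set x | x = 1]); exact: closed_eq.
  (* The image filter has a cluster point among the matrices; as the topology of [SL] is induced by
     [val], the filter [F] clusters there too. *)
  move=> F FF FK.
  have FKM : F ((fun g : SL R d => val g : 'M[R]_d) @^-1`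
      ([set M : 'M[R]_d | forall i j, `|M i j| <= b] `&` [set M | \det M = 1])).
    by apply: filterS FK => g gb; split; [exact: gb|exact: (det_SL g)].
  have [M [[Mb dM] clM]] := cM ((fun g : SL R d => val g : 'M[R]_d) @ F) _ FKM.
  exists (exist _ M (mem_set dM)); split => // A U FA [_ [[V oV <-] /= VM VU]].
  have FA' : F ((fun g : SL R d => val g : 'M[R]_d) @^-1` ((fun g : SL R d => val g) @` A)).
    by apply: filterS FA => g Ag; exists g.
  have [_ [[g Ag <-] Vg]] := clM _ _ FA' (open_nbhs_nbhs (conj oV VM)).
  by exists g; split => //; exact: VU.
have := compact_setX c1 (@compact_mx_box R d 1 b); congr compact.
apply/seteqP; split => [a /= [h1 h2]|a /= [h1 h2]]; split => // i.
by move=> j; rewrite (ord1 j).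
Qed.

(** The boxes of elements with entries bounded by [k] are compact, hence of finite measure. *)
Lemma haar_sigma_finite (nu : {measure set G -> \bar R}) :
  is_haar nu -> sigma_finite setT nu.
Proof.
move=> [_ nuK _].
exists (fun k => [set a : G | (forall i j, `|val a.1 i j| <= k%:R :> R) /\ (forall i, `|a.2 i 0| <= k%:R :> R)]).
  apply/seteqP; split => // a _.
  pose x : R := \sum_i \sum_j `|val a.1 i j| + \sum_i `|a.2 i 0|.
  have x0 : 0 <= x by rewrite addr_ge0// ?sumr_ge0// => i _; exact: sumr_ge0.
  exists (Num.truncn x).+1 => //; have xk : x <= (Num.truncn x).+1%:R.
    by have /andP[_ /ltW] := truncn_itv x0.
  split => [i j|i]; apply: le_trans xk; rewrite /x.
    rewrite (bigD1 i)//= (bigD1 j)//= -!addrA lerDl !addr_ge0// ?sumr_ge0//.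
    by move=> ? _; exact: sumr_ge0.
  rewrite [X in _ + X](bigD1 i)//= addrCA lerDl addr_ge0// ?sumr_ge0//.
  by move=> ? _; exact: sumr_ge0.
move=> k; split; last exact: nuK (@compact_ASL_box k%:R).
have mle (g : G -> R) (z : R) : measurable_fun setT g -> measurable [set t | `|g t| <= z].
  move=> mg; rewrite (_ : [set t | _] = (fun t => `|g t|) @^-1` `]-oo, z]%classic).
    apply: measurable_preimageT; last exact: measurable_itv.
    exact: measurableT_comp.
  by apply/seteqP; split => t /=; rewrite in_itv.
rewrite (_ : [set a | _] =
    (\bigcap_(ij in [set: 'I_d * 'I_d]) [set a : G | `|val a.1 ij.1 ij.2| <= k%:R :> R])
    `&` (\bigcap_(i in [set: 'I_d]) [set a : G | `|a.2 i 0| <= k%:R :> R])).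
  apply: measurableI; apply: fin_bigcap_measurable => // i _; apply: mle.
  - exact: measurable_ASL1.
  - exact: measurable_ASL2.
apply/seteqP; split => t /= [h1 h2]; split.
- by move=> ij _; exact: h1.
- by move=> i _; exact: h2.
- by move=> i j; exact: (h1 (i, j)).
- by move=> i; exact: h2.
Qed.

End BorelAffineGroup.

(** * Null sets of Haar measure *)

Section HaarNull.
Variables (R : realType) (d : nat) (nu : {measure set (borelASL R d) -> \bar R}).
Hypothesis haar : is_haar nu.
Local Notation G := (borelASL R d).

Lemma measurable_fun_ASL_mul d' (T : measurableType d') (f g : T -> G) :
  measurable_fun setT f -> measurable_fun setT g ->
  measurable_fun setT (fun t => ASL_mul (f t) (g t) : G).
Proof.
move=> mf mg.
have mfg : measurable_fun setT (fun t => (f t, g t)) by exact/measurable_fun_pair.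
exact: (measurableT_comp (@measurable_ASL_mul R d) mfg).
Qed.

Let nu_sf : exists nu' : {sigma_finite_measure set G -> \bar R}, forall A, nu' A = nu A.
Proof.
have sf := haar_sigma_finite haar.
pose H1 := isSFinite.Build _ _ _ _ (sfinite_measure_sigma_finite sf).
pose H2 := isSigmaFinite.Build _ _ _ _ sf.
pose nu' : {sigma_finite_measure set G -> \bar R} :=
  HB.pack_for (SigmaFiniteMeasure.type G R) (Measure.sort nu) H1 H2.
by exists nu'.
Qed.

Let haar_left (a : G) (A : set G) : measurable A ->
  nu [set b | A (ASL_mul (ASL_inv a) b)] = nu A.
Proof. by case: haar => inv _ _ mA; rewrite -(inv a A mA) image_ASL_mul. Qed.

(* Right translation may rescale a left Haar measure, but inversion preserves
   null sets by Fubini; this is how right translates are handled below. *)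
Lemma haar_null_inv (A : set G) : measurable A -> nu A = 0%E ->
  nu [set a : G | A (ASL_inv a)] = 0%E.
Proof.
move=> mA nA; have [mu muE] := nu_sf.
(* Integrating over [x] first gives the measure of a left translate of [A], which is 0; integrating
   over [y] first gives, for every [x], the measure of a left translate of the inverse of [A]. *)
pose f (xy : G * G) := (\1_A (ASL_mul (ASL_inv xy.2) xy.1) : R)%:E.
have mphi : measurable_fun setT (fun xy : G * G => ASL_mul (ASL_inv xy.2) xy.1 : G).
  apply: measurable_fun_ASL_mul => //.
  exact: (measurableT_comp (@measurable_ASL_inv R d) measurable_snd).
have mf : measurable_fun setT f.
  apply/measurable_EFinP; apply: (measurableT_comp (f := \1_A : G -> R)) => //.
have f0 xy : (0 <= f xy)%E by rewrite lee_fin indicE.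
have secx x : measurable [set y : G | A (ASL_mul (ASL_inv y) x)].
  apply: (measurable_preimageT (f := fun y : G => ASL_mul (ASL_inv y) x : G)) => //.
  by apply: measurable_fun_ASL_mul => //; exact: measurable_ASL_inv.
have secy y : measurable [set x : G | A (ASL_mul (ASL_inv y) x)].
  apply: (measurable_preimageT (f := fun x : G => ASL_mul (ASL_inv y) x : G)) => //.
  exact: measurable_fun_ASL_mul.
have h := fubini_tonelli (m1 := mu) (m2 := mu) f mf f0.
have secE (B : set G) : measurable B -> (\int[mu]_x (\1_B x : R)%:E = nu B)%E.
  move=> mB.
  have e := integral_indic mu measurableT mB.
  rewrite setIT in e.
  by rewrite -muE -e.
have h0 : (\int[mu]_y \int[mu]_x f (x, y) = 0)%E.
  apply: integral0_eq => y _.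
  rewrite -[RHS]nA -(haar_left y mA) -(secE _ (secy y)).
  by apply: eq_integral => x _; rewrite /f !indicE.
rewrite h0 in h.
have Nx x : (\int[mu]_y f (x, y) = nu [set y : G | A (ASL_mul (ASL_inv y) x)])%E.
  rewrite -(secE _ (secx x)).
  by apply: eq_integral => y _; rewrite /f !indicE.
have Nx2 x : nu [set y : G | A (ASL_mul (ASL_inv y) x)] = nu [set a : G | A (ASL_inv a)].
  rewrite -[RHS](haar_left x); last first.
    exact: (measurable_preimageT (@measurable_ASL_inv R d)).
  by congr (nu _); apply/seteqP; split => y /=; rewrite ASL_invM ASL_invK.
move: h; rewrite (eq_integral (cst (nu [set a : G | A (ASL_inv a)]))); last first.
  by move=> x _; rewrite Nx Nx2.
rewrite integral_cst// [X in (_ * X = _)%E](muE setT) => /eqP; rewrite mule_eq0 => /orP[/eqP//|/eqP nuT].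
by case: haar => _ _; rewrite nuT.
Qed.

(** With [A] the inverse of [E], the indicator of [u(w)^-1 x] in [A] has mean 0 over [w] by
    hypothesis, and integral [nu A] over [x] by left invariance. Hence [A] is null, and so is [E] by
    [haar_null_inv]. *)
Lemma haar_null_random d' (W : measurableType d') (P : probability W R)
    (u : W -> G) (E : set G) : measurable_fun setT u -> measurable E ->
  (forall a, P [set w | E (ASL_mul a (u w))] = 0%E) -> nu E = 0%E.
Proof.
move=> mu mE PE; have [nu' nuE] := nu_sf.
pose A := [set a : G | E (ASL_inv a)].
have mA : measurable A by exact: (measurable_preimageT (@measurable_ASL_inv R d) mE).
have EA : E = [set a : G | A (ASL_inv a)].
  by apply/seteqP; split => a; rewrite /A /= ASL_invK.
rewrite EA; apply: haar_null_inv => //.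
pose f (xy : G * W) := (\1_A (ASL_mul (ASL_inv (u xy.2)) xy.1) : R)%:E.
have mphi : measurable_fun setT (fun xy : G * W => ASL_mul (ASL_inv (u xy.2)) xy.1 : G).
  apply: measurable_fun_ASL_mul => //.
  exact: (measurableT_comp (@measurable_ASL_inv R d) (measurableT_comp mu measurable_snd)).
have mf : measurable_fun setT f.
  apply/measurable_EFinP; apply: (measurableT_comp (f := \1_A : G -> R)) => //.
have f0 xy : (0 <= f xy)%E by rewrite lee_fin indicE.
have secx x : measurable [set y : W | A (ASL_mul (ASL_inv (u y)) x)].
  apply: (measurable_preimageT (f := fun y : W => ASL_mul (ASL_inv (u y)) x : G)) => //.
  apply: measurable_fun_ASL_mul => //; exact: (measurableT_comp (@measurable_ASL_inv R d)).
have secy y : measurable [set x : G | A (ASL_mul (ASL_inv (u y)) x)].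
  apply: (measurable_preimageT (f := fun x : G => ASL_mul (ASL_inv (u y)) x : G)) => //.
  exact: measurable_fun_ASL_mul.
have h := fubini_tonelli (m1 := nu') (m2 := P) f mf f0.
have h0 : (\int[nu']_x \int[P]_y f (x, y) = 0)%E.
  apply: integral0_eq => x _.
  transitivity (\int[P]_y (\1_[set y : W | A (ASL_mul (ASL_inv (u y)) x)] y : R)%:E)%E.
    by apply: eq_integral => y _; rewrite /f !indicE.
  rewrite integral_indic// setIT -[RHS](PE (ASL_inv x)); congr (P _).
  by apply/seteqP; split => y /=; rewrite /A /= ASL_invM ASL_invK.
rewrite h0 in h; symmetry in h; move: h.
rewrite (eq_integral (cst (nu A))); first by rewrite integral_prob_cst.
move=> y _; rewrite /cst -(haar_left (u y) mA) -nuE.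
transitivity (\int[nu']_x (\1_[set x : G | A (ASL_mul (ASL_inv (u y)) x)] x : R)%:E)%E.
  by apply: eq_integral => x _; rewrite /f !indicE.
by rewrite integral_indic// setIT.
Qed.

End HaarNull.

(** * Lattice points in the cusp region *)

Lemma card_fset_set_seq (T : choiceType) (A : set T) (s : seq T) :
  uniq s -> (forall x, A x <-> x \in s) -> #|` fset_set A | = size s.
Proof.
move=> us As; have -> : A = [set` s] by apply/seteqP; split => x /As.
have -> : fset_set [set` s] = [fset x in s]%fset.
  apply/fsetP => x; rewrite in_fset_set ?inE; last exact: finite_seq.
  by apply/idP/idP => [/set_mem|h]; [|exact: mem_set].
by rewrite card_fseq undup_id.
Qed.

Lemma card_fset_set_le (T : choiceType) (A B : set T) : finite_set B ->
  A `<=` B -> (#|` fset_set A | <= #|` fset_set B |)%N.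
Proof.
move=> fB AB; apply: fsubset_leq_card.
by rewrite -fset_set_sub//; exact: sub_finite_set fB.
Qed.

Section CuspRegion.
Variables (R : realType) (m n : nat).
Local Notation V := 'cV[R]_(m + n).

(** All inequalities are strict, which makes the region open, as required in
    [measurable_cusp_points_ge]. *)
Definition cusp_region (c r T : R) : set V :=
  [set p | enorm (usubmx p) ^+ m * enorm (dsubmx p) ^+ n < c /\ r < enorm (dsubmx p) < T].

Lemma continuous_enorm k : continuous (@enorm R k).
Proof.
have h : continuous (fun v : 'cV[R]_k => \sum_i v i 0 ^+ 2).
  apply: (@continuous_big R _ +%R 0) => [|i _]; first exact: add_continuous.
  move=> v; apply: (@continuous_comp _ _ _ (fun v : 'cV[R]_k => v i 0) (fun x : R => x ^+ 2)).
    exact: coord_continuous.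
  exact: exprn_continuous.
by move=> v; exact: (continuous_comp (h v) (@sqrt_continuous R _)).
Qed.

Lemma continuous_usubmx : continuous (fun p : V => usubmx p).
Proof.
apply: continuous_mxP => i j; rewrite (_ : (fun _ => _) = (fun p : V => p (lshift n i) j)).
  exact: coord_continuous.
by apply/funext => p; rewrite mxE.
Qed.

Lemma continuous_dsubmx : continuous (fun p : V => dsubmx p).
Proof.
apply: continuous_mxP => i j; rewrite (_ : (fun _ => _) = (fun p : V => p (rshift m i) j)).
  exact: coord_continuous.
by apply/funext => p; rewrite mxE.
Qed.

Lemma open_cusp_region c r T : open (cusp_region c r T).
Proof.
have cu : continuous (fun p : V => enorm (usubmx p)).
  by move=> p; exact: (continuous_comp (@continuous_usubmx p) (@continuous_enorm m _)).
have cd : continuous (fun p : V => enorm (dsubmx p)).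
  by move=> p; exact: (continuous_comp (@continuous_dsubmx p) (@continuous_enorm n _)).
have cf : continuous (fun p : V => enorm (usubmx p) ^+ m * enorm (dsubmx p) ^+ n).
  move=> p; exact: (cvgM (continuous_comp (cu p) (@exprn_continuous _ _ _))
    (continuous_comp (cd p) (@exprn_continuous _ _ _))).
rewrite (_ : cusp_region c r T =
  ((fun p : V => enorm (usubmx p) ^+ m * enorm (dsubmx p) ^+ n) @^-1` `]-oo, c[%classic)
  `&` ((fun p : V => enorm (dsubmx p)) @^-1` `]r, T[%classic)).
  apply: openI; [move/continuousP : cf|move/continuousP : cd]; apply; exact: interval_open.
by apply/seteqP; split => p /=; rewrite !in_itv.
Qed.

Lemma enorm_col_mx (x : 'cV[R]_m) (y : 'cV[R]_n) : enorm (col_mx x y) <= enorm x + enorm y.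
Proof.
have -> : col_mx x y = col_mx x 0 + col_mx 0 y by rewrite add_col_mx addr0 add0r.
apply: (le_trans (enormD _ _)); rewrite le_eqVlt; apply/orP; left; apply/eqP.
congr (_ + _); rewrite /enorm big_split_ord/=.
  rewrite [X in _ + X]big1 => [|i _]; last by rewrite col_mxEd mxE expr0n.
  by rewrite addr0; congr Num.sqrt; apply: eq_bigr => i _; rewrite col_mxEu.
rewrite big1 => [|i _]; last by rewrite col_mxEu mxE expr0n.
by rewrite add0r; congr Num.sqrt; apply: eq_bigr => i _; rewrite col_mxEd.
Qed.

(* The closed counterpart of [cusp_region], as counted by [count_points]. *)
Lemma closed_cusp_bound (c r T : R) (p : V) : (0 < m)%N -> 0 < r ->
  enorm (usubmx p) ^+ m * enorm (dsubmx p) ^+ n <= c -> r <= enorm (dsubmx p) < T ->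
  enorm p <= 1 + (1 + c / r ^+ n) + T.
Proof.
move=> m0 r0 h /andP[h1 h2].
rewrite -{1}[p]vsubmxK (le_trans (enorm_col_mx _ _))// lerD ?(ltW h2)//.
apply: (exp_lt_bound m0 (enorm_ge0 _)).
apply: (@le_lt_trans _ _ (c / r ^+ n)); last by rewrite ltrDr.
rewrite ler_pdivlMr ?exprn_gt0//; apply: le_trans h.
by rewrite ler_wpM2l ?exprn_ge0 ?enorm_ge0// lerXn2r// ?nnegrE ?enorm_ge0 ?(ltW r0).
Qed.

Lemma intvP k (z : 'cV[R]_k) : int_vector z -> z = intv R (flv z).
Proof.
move=> /mxOverP zi; apply/matrixP => i j; rewrite (ord1 j) !mxE.
by rewrite floorK.
Qed.

Lemma int_vector_intv k (p : 'cV[int]_k) : int_vector (intv R p).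
Proof. by apply/mxOverP => i j; rewrite mxE intr_int. Qed.

Lemma intv_inj k : injective (@intv R k).
Proof.
by move=> p q /matrixP e; apply/matrixP => i j; have := e i j; rewrite !mxE => /intr_inj.
Qed.

Lemma finite_lattice_ball (L : affine_lattices R (m + n)) (rho : R) :
  finite_set (lattice_points L `&` [set p | enorm p <= rho]).
Proof.
have [L0 [g dg L0E] [v LE]] : affine_unimodular_lattice (val L) by exact: (set_mem (valP L)).
have dg0 : \det g != 0 by rewrite -normr_gt0 dg.
have [Q QP] := finite_cover_affine v rho dg0.
apply: (@sub_finite_set _ _ ((fun p => g *m intv R p + v) @` [set` Q])); last first.
  by apply: finite_image; exact: finite_fset.
move=> p; rewrite /lattice_points LE L0E => -[[_ [z zi <-] <-]] /= h.
by exists (flv z); [exact: QP|rewrite -intvP].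
Qed.

Lemma finite_cusp_points (L : affine_lattices R (m + n)) (c r T : R) :
  (0 < m)%N -> 0 < r -> finite_set (lattice_points L `&` cusp_region c r T).
Proof.
move=> m0 r0; apply: (sub_finite_set _ (finite_lattice_ball L (1 + (1 + c / r ^+ n) + T))).
move=> p [Lp [h /andP[h1 h2]]]; split => //=.
by apply: (closed_cusp_bound m0 r0 (ltW h)); rewrite ltW.
Qed.

Definition cusp_points (L : affine_lattices R (m + n)) (c r T : R) : nat :=
  #|` fset_set (lattice_points L `&` cusp_region c r T) |.

Definition ASL_act (a : ASL R (m + n)) (z : 'cV[int]_(m + n)) : V :=
  val a.1 *m intv R z + a.2.

Lemma ASL_act_inj a : injective (ASL_act a).
Proof.
move=> z z' /addIr e; apply: intv_inj.
by rewrite -[LHS](mulKmx (SL_unit a.1)) e mulKmx// SL_unit.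
Qed.

Lemma lattice_points_of (a : ASL R (m + n)) p :
  lattice_points (lattice_of a) p <-> exists z, p = ASL_act a z.
Proof.
split=> [[_ [z zi <-] <-]|[z ->]].
  by exists (flv z); rewrite /ASL_act -intvP.
by exists (val a.1 *m intv R z) => //; exists (intv R z) => //; exact: int_vector_intv.
Qed.

Lemma continuous_ASL_act z : continuous (fun a => ASL_act a z).
Proof.
apply: continuous_mxP => i j; rewrite (ord1 j).
rewrite (_ : (fun _ => _) = (fun a : ASL R (m + n) =>
    (\sum_l val a.1 i l * intv R z l 0) + a.2 i 0)); last first.
  by apply/funext => a; rewrite /ASL_act !mxE.
have h : continuous (fun a : ASL R (m + n) => \sum_l val a.1 i l * intv R z l 0).
  apply: (@continuous_big R _ +%R 0) => [|l _]; first exact: add_continuous.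
  by move=> a; exact: (cvgM (@continuous_ASL1 R _ i l a) (cvg_cst _)).
by move=> a; exact: (cvgD (h a) (@continuous_ASL2 R _ i a)).
Qed.

Lemma near_fset (T : topologicalType) (I : choiceType) (x : T) (F : {fset I})
    (Pr : I -> T -> Prop) : (forall i, i \in F -> \forall y \near x, Pr i y) ->
  \forall y \near x, forall i, i \in F -> Pr i y.
Proof.
move=> h; have : forall s : seq I, {subset s <= F} -> \forall y \near x, forall i, i \in s -> Pr i y.
  elim=> [|i s IH] sF; first by apply: nearW.
  have h1 := h i (sF i (mem_head _ _)).
  have h2 : \forall y \near x, forall j, j \in s -> Pr j y.
    by apply: IH => j js; apply: sF; rewrite in_cons js orbT.
  by apply: filterS2 h1 h2 => y p1 p2 j; rewrite in_cons => /orP[/eqP ->//|]; exact: p2.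
by move=> /(_ F (fun _ h => h)).
Qed.

(** The finitely many integral vectors that [a] sends into the open region are still sent there by
    all elements near [a]; so the condition is open in the quotient. *)
Lemma measurable_cusp_points_ge c r T k : (0 < m)%N -> 0 < r ->
  measurable [set L : affine_lattices R (m + n) | (k <= cusp_points L c r T)%N].
Proof.
move=> m0 r0; apply: sub_sigma_algebra => /=.
have ptsE b : lattice_points (lattice_of b) `&` cusp_region c r T =
    ASL_act b @` (ASL_act b @^-1` cusp_region c r T).
  apply/seteqP; split => [p [/lattice_points_of[z ->] pO]|_ [z zO <-]].
    by exists z.
  by split => //; apply/lattice_points_of; exists z.
have finZ b : finite_set (ASL_act b @^-1` cusp_region c r T).
  have := finite_cusp_points (lattice_of b) c T m0 r0; rewrite ptsE.
  by rewrite (eq_finite_set (inj_card_eq _))// => z z' _ _; exact: ASL_act_inj.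
have cntE b : cusp_points (lattice_of b) c r T =
    #|` fset_set (ASL_act b @^-1` cusp_region c r T) |.
  rewrite /cusp_points ptsE fset_set_image// card_imfset//; exact: ASL_act_inj.
rewrite openE => a /= ka; rewrite cntE in ka.
have : \forall b \near a, forall z, z \in fset_set (ASL_act a @^-1` cusp_region c r T) ->
    cusp_region c r T (ASL_act b z).
  apply: near_fset => z; rewrite in_fset_set// => /set_mem/= zO.
  by apply: (@continuous_ASL_act z a); exact: open_nbhs_nbhs (conj (@open_cusp_region c r T) zO).
apply: filterS => b bP /=; rewrite cntE (leq_trans ka)//; apply: card_fset_set_le => //.
by move=> z /= zO; apply: bP; rewrite in_fset_set//; exact: mem_set.
Qed.

End CuspRegion.

Lemma addr_cancel2 (V : zmodType) (x y z t : V) :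
  x + y + ((z - x) + (t - y)) = z + t.
Proof. by rewrite [z - x + _]addrACA -opprD addrCA subrr addr0. Qed.

(** * Counts for randomly sheared lattices *)

Section ShearedCount.
Variables (R : realType) (m n : nat).
Hypothesis m0 : (0 < m)%N.
Local Notation G := (ASL R (m + n)).

Lemma det_shear (Th : 'M[R]_(m, n)) : \det (block_mx 1%:M Th 0 1%:M : 'M[R]_(m + n)) = 1.
Proof. by rewrite det_ublock !det1 mulr1. Qed.

Definition shear (Th : 'M[R]_(m, n)) (s : 'cV[R]_m) : G :=
  (exist _ (block_mx 1%:M Th 0 1%:M) (mem_set (det_shear Th)), col_mx s 0).

Variables (c r : R).
Hypotheses (c0 : 0 < c) (r0 : 0 < r).
Variable a : G.
Let A := ulsubmx (val a.1 : 'M[R]_(m + n)).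
Let Bk := ursubmx (val a.1 : 'M[R]_(m + n)).
Let C := dlsubmx (val a.1 : 'M[R]_(m + n)).
(** The Schur complement of [A]; [w] and [cq] are the translations left over when the first
    component is written as [A z]. *)
Let D := drsubmx (val a.1 : 'M[R]_(m + n)) - C *m invmx A *m Bk.
Let w := dsubmx a.2 - C *m invmx A *m usubmx a.2.
Let cq (q : 'cV[int]_n) := invmx A *m (Bk *m intv R q + usubmx a.2).
Hypothesis dA : \det A != 0.

Let Au : A \in unitmx. Proof. by rewrite unitmxE unitfE. Qed.

(** This identity makes the asymptotic count independent of the group element. *)
Lemma det_schur : \det A * \det D = 1.
Proof.
rewrite -(det_SL a.1) -[val a.1]submxK -/A -/Bk -/C.
have -> : block_mx A Bk C (drsubmx (val a.1)) =
    block_mx 1%:M 0 (C *m invmx A) 1%:M *m block_mx A Bk 0 D.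
  rewrite mulmx_block !(mul1mx, mul0mx, mulmx0, addr0, add0r).
  by rewrite mulmxKV// /D addrC subrK.
by rewrite det_mulmx det_lblock !det1 !mul1r det_ublock.
Qed.

Let dD : \det D != 0.
Proof. by apply/eqP => D0; have := det_schur; rewrite D0 mulr0 => /esym/eqP; rewrite oner_eq0. Qed.

Lemma ASL_act_shear Th s (p : 'cV[int]_m) (q : 'cV[int]_n) :
  let z := intv R p + (Th *m intv R q + s + cq q) in
  ASL_act (ASL_mul a (shear Th s)) (col_mx p q) =
  col_mx (A *m z) (C *m z + (D *m intv R q + w)).
Proof.
move=> z; rewrite /ASL_act /= -mulmxA addrA -mulmxDr.
have -> : block_mx 1%:M Th 0 1%:M *m intv R (col_mx p q) + col_mx s 0 =
    col_mx (intv R p + (Th *m intv R q + s)) (intv R q).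
  rewrite /intv map_col_mx mul_block_col !(mul1mx, mul0mx, add0r) add_col_mx addr0.
  by rewrite addrA.
rewrite -{1}[val a.1]submxK -{1}[a.2]vsubmxK -/A -/Bk -/C mul_block_col add_col_mx.
have zE : z = (intv R p + (Th *m intv R q + s)) + cq q by rewrite /z !addrA.
rewrite zE; set y := intv R p + _; congr col_mx.
  by rewrite [RHS]mulmxDr /cq mulKVmx// addrA.
rewrite [C *m (y + _)]mulmxDr -!addrA; congr (_ + _).
rewrite /D /w /cq mulmxBl !mulmxDr !mulmxA.
set t1 := C *m invmx A *m Bk *m _; set t2 := C *m invmx A *m _.
set t3 := drsubmx _ *m _; set t4 := dsubmx _.
have := addr_cancel2 t1 t2 t3 t4.
by rewrite !addrA => ->.
Qed.

Lemma ASL_act_shear_region Th s (p : 'cV[int]_m) (q : 'cV[int]_n) T :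
  cusp_region c r T (ASL_act (ASL_mul a (shear Th s)) (col_mx p q)) <->
  cusp_section A C D w c r T q (intv R p + (Th *m intv R q + s + cq q)).
Proof. by rewrite ASL_act_shear /cusp_region /cusp_section /= col_mxKu col_mxKd. Qed.

Variable B : {fset 'cV[int]_m}.
Hypothesis BP : forall T q z, cusp_section A C D w c r T q z -> flv z \in B.

(** The lattice points over [q] correspond to the integral [p] for which [p + t q] lies in the
    section over [q], and [hits] counts these. *)
Lemma cusp_points_shear d (W : measurableType d) (Th : W -> 'M[R]_(m, n))
    (s : W -> 'cV[R]_m) T x :
  (cusp_points (lattice_of (ASL_mul a (shear (Th x) (s x)))) c r T)%:R =
  cusp_count Th s A C w c r dD B cq T x.
Proof.
pose t q := Th x *m intv R q + s x + cq q.
pose Q := index_set A C w c r dD T.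
have QP : index_cover A C D w c r Q T by exact: (projT2 (cid (index_coverP A C w c r dD T))).
pose S := cusp_section A C D w c r T.
pose hit (qp : 'cV[int]_n * 'cV[int]_m) :=
  t qp.1 - intv R (flv (t qp.1)) + intv R qp.2 \in S qp.1.
pose l := [seq qp <- [seq (q, p) | q <- Q, p <- B] | hit qp].
(* [hits] first reduces [t q] to the unit cube; subtracting [flv (t q)] recovers the integral
   coordinate of the lattice point. *)
pose pt (qp : 'cV[int]_n * 'cV[int]_m) :=
  ASL_act (ASL_mul a (shear (Th x) (s x))) (col_mx (qp.2 - flv (t qp.1)) qp.1).
have hitE qp : hit qp <-> cusp_region c r T (pt qp).
  rewrite /pt ASL_act_shear_region -/(t _) /hit -/(S _).
  have -> : t qp.1 - intv R (flv (t qp.1)) + intv R qp.2 =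
      intv R (qp.2 - flv (t qp.1)) + t qp.1.
    have -> : intv R (qp.2 - flv (t qp.1)) = intv R qp.2 - intv R (flv (t qp.1)).
      exact: map_mxB.
    move: (intv R qp.2) (intv R (flv (t qp.1))) (t qp.1) => u1 u2 u3.
    by rewrite addrAC [RHS]addrAC [u1 + u3]addrC.
  by split => [/set_mem|/mem_set].
have pt_inj : injective pt.
  move=> [q p] [q' p'] /ASL_act_inj/eq_col_mx[/= h1 h2].
  by rewrite h2 in h1 *; move/addIr : h1 => ->.
have ul : uniq [seq pt qp | qp <- l].
  rewrite map_inj_uniq// filter_uniq// allpairs_uniq ?fset_uniq//.
  by move=> [q p] [q' p'] _ _.
rewrite /cusp_points (card_fset_set_seq ul) => [|y]; last first.
  split=> [[/lattice_points_of[z ->] zO]|/mapP[qp]].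
    pose p := usubmx z; pose q := dsubmx z.
    have zE : z = col_mx p q by rewrite vsubmxK.
    have : S q (intv R p + t q) by apply/ASL_act_shear_region; rewrite -zE.
    move=> Sqp; apply/mapP; exists (q, p + flv (t q)); last first.
      by rewrite /pt /= addrK zE.
    rewrite mem_filter; apply/andP; split.
      by apply/hitE; rewrite /pt /= addrK -zE.
    apply/allpairsP; exists (q, p + flv (t q)); split => //=.
      exact: (index_cover_section m0 dA c0 r0 QP Sqp).
    by have := BP Sqp; rewrite addrC flvD addrC.
  rewrite mem_filter => /andP[/hitE h _] ->; split => //.
  by apply/lattice_points_of; eexists; reflexivity.
rewrite size_map /cusp_count /total_hits /hits -sum1_size big_filter natr_sum big_mkcond.
rewrite big_allpairs_dep /=; apply: eq_bigr => q _; apply: eq_bigr => p _.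
by rewrite indicE /hit /=; case: ifP => _.
Qed.

End ShearedCount.

(* Adding to a row of [P], which depends on the other rows, a row of [N] outside
   the row space of [P] increases the rank. *)
Lemma int_combination_unit (F : numFieldType) m n (P : 'M[F]_m) (N : 'M[F]_(n, m)) :
  row_full (col_mx P N) ->
  exists Z : 'M[int]_(m, n), P + map_mx intr Z *m N \in unitmx.
Proof.
have [k] := ubnP (m - \rank P); elim: k P => // k IH P rk full.
have [Pu|Pu] := boolP (P \in unitmx).
  by exists 0; rewrite map_mx0 mul0mx addr0.
have rP : (\rank P < m)%N by rewrite ltn_neqAle rank_leq_col andbT -/(row_full P) row_full_unit.
have [j jP] : exists j, ~~ (row j N <= P)%MS.
  apply/existsP; apply: contraNT Pu => /existsPn/= NP.
  have NP' : (N <= P)%MS by apply/row_subP => j; have /negPn := NP j.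
  rewrite -row_full_unit -sub1mx; apply: (submx_trans (B := col_mx P N)).
    by rewrite sub1mx.
  by rewrite col_mx_sub submx_refl.
have [i [u [ui uP]]] : exists i, exists u : 'rV[F]_m, u 0 i != 0 /\ u *m P = 0.
  have : kermx P != 0 by rewrite kermx_eq0 row_free_unit.
  case/rowV0Pn => u /sub_kermxP uP u0.
  have [i ui] : exists i, u 0 i != 0.
    apply/existsP; apply: contraNT u0 => /existsPn/= u0.
    by apply/eqP/rowP => i; rewrite mxE; apply/eqP; have /negPn := u0 i.
  by exists i, u.
pose E : 'M[int]_(m, n) := delta_mx i j.
pose P' := P + map_mx intr E *m N.
have rowP'E l : row l P' = row l P + (l == i)%:R *: row j N.
  rewrite /P' linearD/= row_mul /E map_delta_mx; congr (_ + _).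
  have -> : row l (delta_mx i j) = (l == i)%:R *: delta_mx 0 j :> 'rV[F]_n.
    by apply/rowP => q; rewrite !mxE eqxx andTb; case: (l == i); rewrite ?mul1r ?mul0r.
  by rewrite -scalemxAl -rowE.
have other l : l != i -> (row l P <= P')%MS.
  by move=> li; have := row_sub l P'; rewrite rowP'E (negbTE li) scale0r addr0.
have rowi : (row i P <= P')%MS.
  have : u *m P = \sum_l u 0 l *: row l P by exact: mulmx_sum_row.
  rewrite uP (bigD1 i)//= => /esym/eqP; rewrite addr_eq0 => /eqP e.
  have -> : row i P = (u 0 i)^-1 *: (u 0 i *: row i P) by rewrite scalerA mulVf// scale1r.
  rewrite e scalemx_sub// eqmx_opp; apply: summx_sub => l li.
  by rewrite scalemx_sub// other.
have PP : (P <= P')%MS by apply/row_subP => l; have [->|/other] := eqVneq l i.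
have jP' : (row j N <= P')%MS.
  have -> : row j N = row i P' - row i P by rewrite rowP'E eqxx scale1r addrC addKr.
  by rewrite addmx_sub ?row_sub// eqmx_opp.
have ltPP : (P < P')%MS by rewrite ltmxE PP; apply: contra jP => /(submx_trans jP').
have rPP := rank_ltmx ltPP.
have [||Z ZP] := IH P'.
- by rewrite -ltnS (leq_ltn_trans _ rk)// ltn_sub2l.
- rewrite -sub1mx; apply: (submx_trans (B := col_mx P N)); first by rewrite sub1mx.
  rewrite col_mx_sub -!addsmxE addsmxSr andbT.
  exact: (submx_trans PP (addsmxSl P' N)).
exists (E + Z); move: ZP; rewrite /P' map_mxD mulmxDl addrA.
by [].
Qed.

Section IntegerShear.
Variables (R : realType) (m n : nat).
Local Notation G := (ASL R (m + n)).

Lemma det_int_shear (Z : 'M[int]_(n, m)) :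
  \det (block_mx 1%:M 0 (map_mx intr Z) 1%:M : 'M[R]_(m + n)) = 1.
Proof. by rewrite det_lblock !det1 mulr1. Qed.

Definition int_shear (Z : 'M[int]_(n, m)) : G :=
  (exist _ (block_mx 1%:M 0 (map_mx intr Z) 1%:M) (mem_set (det_int_shear Z)), 0).

Lemma int_shearN Z : ASL_mul (int_shear (- Z)) (int_shear Z) = ASL_one R (m + n).
Proof.
apply: ASL_eq => /=; last by rewrite mulmx0 addr0.
rewrite mulmx_block !(mul1mx, mulmx1, mul0mx, mulmx0, addr0, add0r).
by rewrite map_mxN addNr -scalar_mx_block.
Qed.

Lemma ASL_act_mul (a b : G) z v : val b.1 *m intv R z + b.2 = intv R v ->
  ASL_act (ASL_mul a b) z = ASL_act a v.
Proof.
by move=> e; rewrite /ASL_act /= -mulmxA addrA -mulmxDr e.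
Qed.

Lemma lattice_of_sub (a : G) Z :
  lattice_points (lattice_of (ASL_mul a (int_shear Z))) `<=` lattice_points (lattice_of a).
Proof.
move=> p /lattice_points_of[z ->]; apply/lattice_points_of.
exists (block_mx 1%:M 0 Z 1%:M *m z); apply: ASL_act_mul.
by rewrite /= addr0 /intv map_mxM map_block_mx !map_mx1 map_mx0.
Qed.

(** One inclusion holds for every element and every integral shear; applied to the inverse shear it
    gives the other. *)
Lemma lattice_of_int_shear (a : G) Z :
  lattice_of (ASL_mul a (int_shear Z)) = lattice_of a.
Proof.
apply/val_inj/seteqP; split; first exact: (@lattice_of_sub a Z).
have := @lattice_of_sub (ASL_mul a (int_shear Z)) (- Z).
have := int_shearN (- Z); rewrite opprK -ASL_mulA => ->.
by rewrite ASL_mulr1.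
Qed.

(** The first [m] rows of an invertible matrix are independent. The shear adds integral combinations
    of the last [n] columns to the first [m], so [int_combination_unit] applies to the
    transposes. *)
Lemma int_shear_corner (a : G) : exists Z,
  \det (ulsubmx (val (ASL_mul a (int_shear Z)).1 : 'M[R]_(m + n))) != 0.
Proof.
pose g : 'M[R]_(m + n) := val a.1.
have gu : g \in unitmx by exact: SL_unit.
have [|Z ZP] := @int_combination_unit R m n (ulsubmx g)^T (ursubmx g)^T.
  have : row_free (usubmx g).
    apply/row_freeP; exists (invmx g *m col_mx 1%:M 0).
    rewrite mulmxA mul_usub_mx mulmxV// scalar_mx_block.
    by rewrite /block_mx col_mxKu mul_row_col mul1mx mul0mx addr0.
  rewrite -[usubmx g]hsubmxK -/(ulsubmx g) -/(ursubmx g).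
  by rewrite /row_free /row_full -tr_row_mx mxrank_tr.
exists Z^T; rewrite /= -/g -[g]submxK mulmx_block block_mxKul mulmx1.
move: ZP; rewrite unitmxE unitfE -det_tr linearD/= trmx_mul !trmxK map_trmx.
by [].
Qed.

End IntegerShear.

(** * Lattices with deviating counts *)

Section ExceptionalLattices.
Variables (R : realType) (m n : nat).
Hypotheses (m0 : (0 < m)%N) (n0 : (0 < n)%N).
Local Notation Y := (affine_lattices R (m + n)).
Local Notation G := (borelASL R (m + n)).

Lemma measurable_cusp_points c r T (p : pred nat) : 0 < r ->
  measurable [set L : Y | p (cusp_points L c r T)].
Proof.
move=> r0.
pose F k := if p k then [set L : Y | (k <= cusp_points L c r T)%N] `\`
  [set L : Y | (k.+1 <= cusp_points L c r T)%N] else set0.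
rewrite (_ : [set L : Y | _] = \bigcup_k F k).
  apply: bigcupT_measurable => k; rewrite /F; case: (p k); last exact: measurable0.
  by apply: measurableD; exact: measurable_cusp_points_ge.
apply/seteqP; split => [L pL|L [k _]].
  exists (cusp_points L c r T) => //; rewrite /F pL; split => //=.
  by rewrite ltnn.
rewrite /F; case: ifP => // pk [/= k1 k2].
suff -> : cusp_points L c r T = k by [].
by apply/eqP; rewrite eqn_leq k1 andbT leqNgt; apply/negP.
Qed.

(* [n%:R * ball_volume R n] is the area of the unit sphere of [R^n], by
   [sphere_areaE]. *)
Definition growth_rate (c : R) : R := c * ball_volume R m * ball_volume R n * n%:R.

(** The factor [k.+1%:R ^+ 2] is the logarithm of [time_seq R k]. *)
Definition deviation c r e (k : nat) : set Y :=
  [set L | e * k.+1%:R ^+ 2 <=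
    `|(cusp_points L c r (time_seq R k))%:R - growth_rate c * k.+1%:R ^+ 2|].

Definition exceptional c r e : set Y := lim_sup_set (deviation c r e).

Lemma measurable_exceptional c r e : 0 < r -> measurable (exceptional c r e).
Proof.
move=> r0; apply: bigcapT_measurable => k; apply: bigcup_measurable => j _.
exact: (@measurable_cusp_points _ _ _ (fun N => e * j.+1%:R ^+ 2 <=
  `|N%:R - growth_rate c * j.+1%:R ^+ 2|)).
Qed.

Lemma measurable_lattice_of : measurable_fun [set: G] (@lattice_of R (m + n) : G -> Y).
Proof.
apply: (@measurability _ _ _ _ setT (@lattice_of R (m + n) : G -> Y)
  [set U : set (lattice_space R (m + n)) | open (@lattice_of R (m + n) @^-1` U)]) => //.
move=> _ [U oU <-]; rewrite setTI; exact: sub_sigma_algebra.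
Qed.

Variables (c r e : R).
Hypotheses (c0 : 0 < c) (r0 : 0 < r) (e0 : 0 < e).

Lemma exceptional_shear d (W : measurableType d) (P : probability W R)
    (Th : W -> 'M[R]_(m, n)) (s : W -> 'cV[R]_m) (a : G) :
  pairwise_uniform P Th s ->
  \det (ulsubmx (val a.1 : 'M[R]_(m + n))) != 0 ->
  P [set w | exceptional c r e (lattice_of (ASL_mul a (shear (Th w) (s w))))] = 0%E.
Proof.
move=> Ths dA.
set A := ulsubmx _ in dA.
pose C := dlsubmx (val a.1 : 'M[R]_(m + n)).
pose Bk := ursubmx (val a.1 : 'M[R]_(m + n)).
pose D := drsubmx (val a.1 : 'M[R]_(m + n)) - C *m invmx A *m Bk.
pose w := dsubmx a.2 - C *m invmx A *m usubmx a.2.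
have dAD : \det A * \det D = 1 by exact: det_schur.
have dD : \det D != 0 by apply/eqP => D0; move: dAD; rewrite D0 mulr0 => /esym/eqP; rewrite oner_eq0.
have [B BP] := cusp_section_cover m0 C D w c dA r0.
pose cq (q : 'cV[int]_n) := invmx A *m (Bk *m intv R q + usubmx a.2).
rewrite -[RHS](cusp_count_deviation Ths m0 n0 dA dD c0 r0 BP cq e0).
have dens : cusp_density A D c * n%:R = growth_rate c.
  by rewrite /cusp_density /growth_rate -normrM dAD normr1 divr1.
congr (P _); apply/seteqP; split => x /= h k _; have [j kj hj] := h k Logic.I; exists j => //.
- move: hj; rewrite /deviation /= (cusp_points_shear m0 c0 r0 dA BP) dens.
  (* The two counts differ only in the proof that [\det D] is nonzero, on which [index_set]
     depends. *)
  by congr (is_true (_ <= `|_ - _|)); congr (cusp_count _ _ _ _ _ _ _ _ _ _ _ _); exact: Prop_irrelevance.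
- move: hj; rewrite /deviation /= (cusp_points_shear m0 c0 r0 dA BP) dens.
  by congr (is_true (_ <= `|_ - _|)); congr (cusp_count _ _ _ _ _ _ _ _ _ _ _ _); exact: Prop_irrelevance.
Qed.

Lemma measurable_shear d (W : measurableType d) (Th : W -> 'M[R]_(m, n)) (s : W -> 'cV[R]_m) :
  measurable_fun setT Th -> measurable_fun setT s ->
  measurable_fun setT (fun w => shear (Th w) (s w) : G).
Proof.
move=> mTh ms; apply: measurable_to_ASL => [i j|i] /=.
- case: (fintype.split_ordP i) => k ->; case: (fintype.split_ordP j) => l ->.
  + by under eq_fun do rewrite block_mxEul; exact: measurable_cst.
  + under eq_fun do rewrite block_mxEur.
    exact: (measurableT_comp (measurable_mx_coord k l) mTh).
  + by under eq_fun do rewrite block_mxEdl; exact: measurable_cst.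
  + by under eq_fun do rewrite block_mxEdr; exact: measurable_cst.
- case: (fintype.split_ordP i) => k ->.
  + under eq_fun do rewrite col_mxEu.
    exact: (measurableT_comp (measurable_mx_coord k 0) ms).
  + by under eq_fun do rewrite col_mxEd; exact: measurable_cst.
Qed.

Lemma exceptional_null (nu : {measure set G -> \bar R}) : is_haar nu ->
  nu (@lattice_of R (m + n) @^-1` exceptional c r e) = 0%E.
Proof.
move=> haar.
have [d [W [P [Th [s Ths]]]]] := random_affine R m n.
pose E : set G := @lattice_of R (m + n) @^-1` exceptional c r e.
have mE : measurable E.
  exact: (measurable_preimageT measurable_lattice_of (measurable_exceptional _ _ r0)).
pose corner (Z : 'M[int]_(n, m)) (a : G) : R :=
  \det (ulsubmx (val (ASL_mul a (int_shear R Z)).1 : 'M[R]_(m + n))).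
(* Right multiplication by [int_shear Z] fixes the lattice, and some [Z] makes
   the corner invertible. *)
pose GZ Z : set G := [set a | corner Z a != 0].
have mGZ Z : measurable (GZ Z).
  have mc : measurable_fun setT (corner Z).
    apply: measurable_det => i j; under eq_fun do rewrite !mxE.
    apply: measurable_sum => l; apply: (@measurable_funM _ _ R) => //.
    exact: measurable_ASL1.
  rewrite (_ : GZ Z = ~` (corner Z @^-1` [set 0])).
    by apply: measurableC; apply: measurable_preimageT => //; exact: measurable_set1.
  by apply/seteqP; split => a /= /eqP.
have nEZ Z : nu (E `&` GZ Z) = 0%E.
  (* The shear is conjugated so that [a u(w)], followed by [int_shear Z], is the shear applied to
     [a] times [int_shear Z], whose corner is the one under consideration. *)
  pose u w : G := ASL_mul (int_shear R Z) (ASL_mul (shear (Th w) (s w)) (int_shear R (- Z))).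
  have mu : measurable_fun setT u.
    by case: Ths => mTh ms _ _; do 2 apply: measurable_fun_ASL_mul => //; exact: measurable_shear.
  apply: (haar_null_random haar (P := P) mu); first exact: measurableI.
  move=> a.
  have auZ w : ASL_mul (ASL_mul a (u w)) (int_shear R Z) =
      ASL_mul (ASL_mul a (int_shear R Z)) (shear (Th w) (s w)).
    by rewrite /u -!ASL_mulA int_shearN ASL_mulr1.
  (* A shear adds multiples of the first block column to the second, so the corner stays fixed. *)
  have cornerE w : corner Z (ASL_mul a (u w)) = corner Z a.
    rewrite /corner auZ /= -[val a.1 *m _]submxK mulmx_block block_mxKul.
    by rewrite mulmx1 mulmx0 addr0 [in RHS]block_mxKul.
  have [ca|ca] := eqVneq (corner Z a) 0.
    rewrite (_ : [set w | _] = set0) ?measure0//; apply/seteqP; split => w //= [_].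
    by rewrite /GZ /= cornerE ca eqxx.
  rewrite -[RHS](exceptional_shear Ths ca); congr (P _); apply/seteqP; split => w /=.
    by move=> [+ _]; rewrite /E /= -(lattice_of_int_shear _ Z) auZ.
  move=> h; split; last by rewrite /GZ /= cornerE.
  by rewrite /E /= -(lattice_of_int_shear _ Z) auZ.
(* There are countably many integral matrices [Z]. *)
pose F k := if (choice.unpickle k : option 'M[int]_(n, m)) is Some Z then E `&` GZ Z else set0.
have mF k : measurable (F k).
  by rewrite /F; case: choice.unpickle => [Z|]; [exact: measurableI|exact: measurable0].
have EF : E = \bigcup_k F k.
  apply/seteqP; split => [a Ea|a [k _]].
    have [Z ZP] := int_shear_corner a.
    by exists (choice.pickle Z) => //; rewrite /F choice.pickleK.
  by rewrite /F; case: choice.unpickle => // Z [].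
rewrite -/E; apply/negligibleP => //; rewrite EF; apply: negligible_bigcup => k.
apply/negligibleP => //; rewrite /F; case: choice.unpickle => [Z|]; last exact: measure0.
exact: nEZ.
Qed.

End ExceptionalLattices.

(** * Sphere area and the limit *)

Section SphereArea.
Variables (R : realType) (k : nat).

(** For nonzero [x] the point [x / |x|] of the sphere is at distance [||x| - 1|]; [e < 1] keeps [x]
    away from 0. *)
Lemma sphere_neighbourhood (e : R) : 0 < e -> e < 1 ->
  [set x : 'cV[R]_k | exists2 u, enorm u = 1 & enorm (x - u) < e] =
  [set x | enorm x < 1 + e] `\` [set x | enorm x <= 1 - e].
Proof.
move=> e0 e1; apply/seteqP; split => x /=.
- move=> [u u1 xu]; have := enormD (x - u) u; rewrite subrK u1 => h1.
  have := enormB_le u (x - u); rewrite subrKC u1 => h2.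
  by split; [lra|apply/negP; rewrite -ltNge; lra].
- move=> [h1 /negP]; rewrite -ltNge => h2.
  have x0 : 0 < enorm x by lra.
  exists ((enorm x)^-1 *: x); first by rewrite enormZ gtr0_norm ?invr_gt0// mulVf ?gt_eqF.
  rewrite -{1}[x]scale1r -scalerBl enormZ.
  rewrite -{2}[enorm x](gtr0_norm x0) -normrM mulrBl mul1r mulVf ?gt_eqF//.
  by rewrite ltr_norml; apply/andP; split; lra.
Qed.

(** The factorization of [a^k - b^k] cancels the denominator [2 e] and leaves a polynomial, whose
    limit at 0 is its value. *)
Lemma volume_sphere_neighbourhood (e : R) : 0 < e -> e < 1 ->
  fine (volume [set x : 'cV[R]_k | exists2 u, enorm u = 1 & enorm (x - u) < e]) / (2 * e) =
  ball_volume R k * \sum_(i < k) (1 + e) ^+ (k.-1 - i) * (1 - e) ^+ i.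
Proof.
move=> e0 e1; rewrite sphere_neighbourhood// -lebE; last first.
  by apply: measurableD; [exact: measurable_ball_lt|exact: measurable_ball_le].
have ball r : 0 < r -> leb R k [set x | enorm x < r] = (r ^+ k * ball_volume R k)%:E /\
    leb R k [set x | enorm x <= r] = (r ^+ k * ball_volume R k)%:E.
  move=> r0; have d1 : \det (1%:M : 'M[R]_k) != 0 by rewrite det1 oner_eq0.
  split; [have := leb_open_ball 0 d1 r0|have := leb_ball 0 d1 r0];
    rewrite det1 normr1 divr1 => <-; congr (leb R k _);
    by apply/seteqP; split => x /=; rewrite mul1mx addr0.
have [e3 _] := ball (1 + e) ltac:(lra); have [_ e4] := ball (1 - e) ltac:(lra).
rewrite measureD//; first last.
- by rewrite [X in (X < _)%E]e3 ltry.
- exact: measurable_ball_le.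
- exact: measurable_ball_lt.
rewrite setIidr; last by move=> x /=; lra.
rewrite [X in fine (X - _)%E]e3 [X in fine (_ - X)%E]e4 -EFinB /= -mulrBl subrXX.
rewrite (_ : 1 + e - (1 - e) = 2 * e); last by ring.
set S := \sum_(i < k) _; have -> : 2 * e * S * ball_volume R k / (2 * e) = ball_volume R k * S.
  by field; rewrite gt_eqF.
by congr (_ * _); apply: eq_bigr => i _; congr (_ ^+ _ * _).
Qed.

Lemma sphere_areaE : sphere_area R k = k%:R * ball_volume R k.
Proof.
apply/cvg_lim => //.
have cv : (fun e : R => ball_volume R k * \sum_(i < k) (1 + e) ^+ (k.-1 - i) * (1 - e) ^+ i)
    @ 0^'+ --> k%:R * ball_volume R k.
  rewrite (_ : k%:R * _ = ball_volume R k * \sum_(i < k) (1 + 0) ^+ (k.-1 - i) * (1 - 0) ^+ i); last first.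
    rewrite mulrC; congr (_ * _); rewrite addr0 subr0.
    by under [RHS]eq_bigr do rewrite !expr1n mulr1; rewrite sumr_const card_ord.
  apply: cvg_at_right_filter; apply: cvgM; first exact: cvg_cst.
  have cp j : (1 + x : R) ^+ j @[x --> (0 : R)] --> (1 + 0 : R) ^+ j.
    exact: (continuous_cvg _ (@exprn_continuous R j _) (cvgD (cvg_cst _) cvg_id)).
  have cm j : (1 - x : R) ^+ j @[x --> (0 : R)] --> (1 - 0 : R) ^+ j.
    exact: (continuous_cvg _ (@exprn_continuous R j _) (cvgB (cvg_cst _) cvg_id)).
  apply: (cvg_big (op := +%R)) => [|i _]; first exact: add_continuous.
  exact: (cvgM (cp _) (cm _)).
apply: cvg_trans cv; apply: near_eq_cvg; near=> e.
by rewrite volume_sphere_neighbourhood.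
Unshelve. all: by end_near. Qed.

End SphereArea.

(** * From sparse times to all times *)

Section CountingLimit.
Variables (R : realType) (m n : nat).
Hypotheses (m0 : (0 < m)%N) (n0 : (0 < n)%N).
Variable b : R.
Hypothesis b0 : 0 < b.
Local Notation Y := (affine_lattices R (m + n)).
Implicit Type L : Y.

Lemma not_exceptional c r e L : ~ exceptional c r e L ->
  \forall k \near \oo,
    `|(cusp_points L c r (time_seq R k))%:R - growth_rate m n c * k.+1%:R ^+ 2| <
    e * k.+1%:R ^+ 2.
Proof.
move=> h; apply: contrapT => h'; apply: h => K _; apply: contrapT => h; apply: h'.
exists K => // k Kk; rewrite ltNge; apply/negP => h'; apply: h.
by exists k.
Qed.

Lemma cusp_points_le_count L (T T' : R) : T <= T' ->
  (cusp_points L b 1 T <= count_points L b T')%N.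
Proof.
move=> TT'; apply: card_fset_set_le => /=.
  apply: (sub_finite_set _ (finite_lattice_ball L (1 + (1 + b / 1 ^+ n) + T'))).
  by move=> p [Lp h1 h2]; split => //=; exact: (closed_cusp_bound m0 ltr01).
move=> p [Lp [/ltW h1 /andP[h2 h3]]]; split => //.
by rewrite (ltW h2) (lt_le_trans h3).
Qed.

Lemma count_le_cusp_points L (c r T T' : R) : b < c -> 0 < r -> r < 1 -> T <= T' ->
  (count_points L b T <= cusp_points L c r T')%N.
Proof.
move=> bc r0 r1 TT'; apply: card_fset_set_le => /=; first exact: finite_cusp_points.
move=> p [Lp h1 /andP[h2 h3]]; split => //; split; first exact: le_lt_trans bc.
by rewrite (lt_le_trans r1 h2) (lt_le_trans h3).
Qed.

Lemma growth_rate_gt0 : 0 < growth_rate m n b.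
Proof. by rewrite /growth_rate !mulr_gt0// ?ball_volume_gt0// ltr0n. Qed.

(* With [s = sqrt (ln T)] and [s >= 1 / d], the squares of the integers next to
   [s] are within a factor [1 + 3 d] of [ln T]; the constant [11] comes from
   [(1 + 2 d) (1 + 3 d) <= 1 + 11 d]. *)
Lemma count_points_asymptotic L :
  (forall j, ~ exceptional b 1 j.+1%:R^-1 L /\
     ~ exceptional (b * (1 + j.+1%:R^-1)) 2^-1 j.+1%:R^-1 L) ->
  (count_points L b T)%:R / (growth_rate m n b * ln T) @[T --> +oo] --> (1 : R).
Proof.
move=> hL; have G0 := growth_rate_gt0; set G := growth_rate m n b in G0 *.
apply/cvgrPdist_le => e e0.
have [d [d0 d1 de]] : exists d : R, [/\ 0 < d, d <= 1 & 11 * d <= e].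
  exists (Num.min 1 (e / 11)); rewrite lt_min ltr01 divr_gt0// ge_min lexx; split => //.
  by rewrite mulrC -ler_pdivlMr// ge_min lexx orbT.
have [j jd] : exists j, j.+1%:R^-1 <= Num.min d (d * G).
  have x0 : 0 < Num.min d (d * G) by rewrite lt_min d0 mulr_gt0.
  exists (Num.truncn (Num.min d (d * G))^-1).
  by rewrite invf_ple ?posrE// ltW// truncnS_gt.
have [/not_exceptional[K1 _ H1] /not_exceptional[K2 _ H2]] := hL j.
set a := j.+1%:R^-1 in jd H1 H2.
have a0 : 0 < a by rewrite invr_gt0 ltr0n.
move: jd; rewrite le_min => /andP[ad adG].
have G' : growth_rate m n (b * (1 + a)) = G * (1 + a) by rewrite /G /growth_rate; ring.
rewrite {}G' in H2; rewrite -/G in H1; clearbody G.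
(* Beyond [S], the square root of [ln T] exceeds [1 / d] and its integer neighbours are past both
   thresholds [K1] and [K2]. *)
pose S := d^-1 + (K1 + K2).+2%:R.
exists (expR (S ^+ 2)); split; first exact: num_real.
move=> T hT; have T0 : 0 < T := lt_trans (expR_gt0 _) hT.
have lnT : S ^+ 2 < ln T by rewrite -ltr_expR lnK.
pose s := Num.sqrt (ln T).
have lnT0 : 0 <= ln T := le_trans (sqr_ge0 _) (ltW lnT).
have lnTE : ln T = s ^+ 2 by rewrite sqr_sqrtr.
have S0 : 0 <= S by rewrite addr_ge0 ?invr_ge0 ?(ltW d0).
have Ss : S <= s by rewrite -(ger0_norm S0) -sqrtr_sqr ler_wsqrtr// ltW.
have sd : d^-1 <= s by apply: le_trans Ss; rewrite lerDl.
have s0 : 0 < s by apply: lt_le_trans sd; rewrite invr_gt0.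
have ds : 1 <= d * s by rewrite -(mulfV (lt0r_neq0 d0)) ler_pM2l.
have sK : (K1 + K2).+2%:R <= s by apply: le_trans Ss; rewrite lerDr invr_ge0 ltW.
have := truncn_itv (ltW s0); set t := Num.truncn s => /andP[t1 t2].
have tK : ((K1 + K2).+2 <= t)%N by rewrite truncn_ge_nat// ltW.
(* Since [time_seq R k] is [exp ((k + 1)^2)], an integer part [k + 1] places [T] between the times
   of index [k] and [k + 1]. *)
case: t t1 t2 tK => // k k1 k2; rewrite ltnS => kK.
have /H1 h1 : (K1 <= k)%N by apply: leq_trans kK; rewrite -addnS leq_addr.
have /H2 h2 : (K2 <= k.+1)%N by apply: leq_trans (leqW kK); rewrite leqW// leq_addl.
have Tk1 : time_seq R k <= T.
  by rewrite -[leRHS]lnK// ler_expR lnTE lerXn2r ?nnegrE// ltW.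
have Tk2 : T <= time_seq R k.+1.
  by rewrite -[leLHS]lnK// ler_expR lnTE lerXn2r ?nnegrE// ltW.
have c1 := cusp_points_le_count L Tk1.
have bc : b < b * (1 + a) by rewrite mulrDr mulr1 ltrDl mulr_gt0.
have c2 := count_le_cusp_points L bc (r := 2^-1) ltac:(lra) ltac:(lra) Tk2.
move: c1 c2; rewrite -!(ler_nat R).
move: h1 h2; rewrite !ltr_norml.
set X := (cusp_points _ _ _ _)%:R; set Z := (cusp_points _ _ _ _)%:R; set N := (count_points _ _ _)%:R.
move=> /andP[h1 _] /andP[_ h2] XN NZ.
have h1' : (G - a) * k.+1%:R ^+ 2 < X by rewrite mulrBl; lra.
have h2' : Z < (G * (1 + a) + a) * k.+2%:R ^+ 2 by rewrite mulrDl; lra.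
have sG : 0 < G * s ^+ 2 by rewrite mulr_gt0// exprn_gt0.
have s2 : 2 <= s by apply: le_trans sK; rewrite ler_nat.
(* Errors linear in [s], as in [(s - 1)^2] and [(s + 1)^2], become relative errors of size [d]. *)
have ss : s <= d * s ^+ 2 by rewrite expr2 mulrA -[leLHS]mul1r ler_pM2r.
have p2 : s ^+ 2 - 2 * (d * s ^+ 2) <= k.+1%:R ^+ 2.
  have : (s - 1) ^+ 2 <= k.+1%:R ^+ 2.
    by rewrite lerXn2r ?nnegrE//; move: k2; rewrite -[k.+2%:R]natr1; lra.
  by rewrite sqrrB1 mulr2n; lra.
have p3 : k.+1%:R ^+ 2 <= s ^+ 2 by rewrite lerXn2r ?nnegrE// ltW.
have q2 : k.+2%:R ^+ 2 <= s ^+ 2 * (1 + 3 * d).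
  have : k.+2%:R ^+ 2 <= (s + 1) ^+ 2.
    by apply: lerXn2r; rewrite ?nnegrE ?ler0n ?addr_ge0 ?(ltW s0)// -natr1 lerD2r.
  by rewrite sqrrD1 mulr2n mulrDr mulr1; lra.
have lower : G * s ^+ 2 * (1 - e) <= N.
  apply: le_trans XN; apply: le_trans (ltW h1').
  apply: (@le_trans _ _ (G * (1 - d) * k.+1%:R ^+ 2)); last first.
    by rewrite ler_wpM2r// mulrBr mulr1 lerB// mulrC.
  rewrite -[leLHS]mulrA -[leRHS]mulrA ler_pM2l//.
  have e1 : d * k.+1%:R ^+ 2 <= d * s ^+ 2 by rewrite ler_wpM2l ?(ltW d0).
  have e2 : 11 * d * s ^+ 2 <= e * s ^+ 2 by rewrite ler_wpM2r ?sqr_ge0.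
  have e3 : 0 <= d * s ^+ 2 by rewrite mulr_ge0 ?sqr_ge0 ?(ltW d0).
  have -> : s ^+ 2 * (1 - e) = s ^+ 2 - e * s ^+ 2 by ring.
  have -> : (1 - d) * k.+1%:R ^+ 2 = k.+1%:R ^+ 2 - d * k.+1%:R ^+ 2 by ring.
  by lra.
have upper : N <= G * s ^+ 2 * (1 + e).
  apply: (le_trans NZ); apply: (le_trans (ltW h2')).
  apply: (@le_trans _ _ (G * (1 + 2 * d) * (s ^+ 2 * (1 + 3 * d)))).
    apply: ler_pM => //; first by rewrite addr_ge0 ?mulr_ge0 ?addr_ge0// ltW.
    have e1 : G * a <= G * d by rewrite ler_pM2l.
    by rewrite mulrDr mulr1 mulrDr mulr1; lra.
  have -> : G * (1 + 2 * d) * (s ^+ 2 * (1 + 3 * d)) =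
    G * s ^+ 2 * (1 + 5 * d + 6 * (d * d)) by ring.
  rewrite ler_pM2l//.
  have e1 : d * d <= d by rewrite ger_pMr.
  by lra.
rewrite lnTE; have [l u] : 1 - e <= N / (G * s ^+ 2) /\ N / (G * s ^+ 2) <= 1 + e.
  by rewrite ler_pdivlMr// ler_pdivrMr// ![_ * (G * _)]mulrC.
by rewrite ler_norml; apply/andP; split; lra.
Qed.

End CountingLimit.

Theorem theorem1p6 (R : realType) (m n : nat) (hm : (0 < m)%N) (hn : (0 < n)%N)
    (mu : probability (affine_lattices R (m + n)) R)
    (hmu : is_haar_probability mu) (b : R) (hb : 0 < b) :
  {ae mu, forall L : affine_lattices R (m + n),
    (count_points L b T)%:R
      / (b * ball_volume R m * sphere_area R n * ln T)
      @[T --> +oo] --> (1 : R)}.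
Proof.
have null c r e : 0 < c -> 0 < r -> 0 < e -> mu.-negligible (exceptional c r e).
  move=> c0 r0 e0; have mE : measurable (exceptional c r e : set (affine_lattices R (m + n))).
    exact: measurable_exceptional.
  (* The measure [mu] only sees the part of a preimage inside the fundamental domain, which is
     bounded by the whole preimage, a null set for [nu]. *)
  apply/negligibleP => //; have [nu [F [haar [mF _] muE]]] := hmu; rewrite [LHS](muE _ mE).
  have mP := measurable_preimageT (@measurable_lattice_of R m n) mE.
  apply/eqP; rewrite eq_le measure_ge0 andbT.
  rewrite -[leRHS](exceptional_null hm hn c0 r0 e0 haar).
  by apply: le_measure; rewrite ?inE//; exact: measurableI.
have growthE : b * ball_volume R m * sphere_area R n = growth_rate m n b.
  by rewrite sphere_areaE /growth_rate; ring.
have j0 j : 0 < j.+1%:R^-1 :> R by rewrite invr_gt0 ltr0n.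
(* Countably many tolerances [j.+1%:R^-1] suffice for the limit. *)
apply: (@negligibleS _ _ _ _ (\bigcup_j (exceptional b 1 j.+1%:R^-1 `|`
    exceptional (b * (1 + j.+1%:R^-1)) 2^-1 j.+1%:R^-1))) => [L /= nL|].
  apply: contrapT => h; apply: nL; rewrite growthE; apply: count_points_asymptotic => // j.
  by split => ex; apply: h; exists j => //; [left|right].
apply: negligible_bigcup => j; apply: negligibleU; apply: null => //.
by rewrite mulr_gt0// addr_gt0.
Qed.
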